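(* Let $\Gamma$ be a Fuchsian group and $t_0\in\mathbb T$ be such that $\sum_{\gamma\in\Gamma}|\gamma'(t_0)|<\infty$, $m'_{t_0}$ is of bounded characteristic, and assumptions (A1) and (A2) of the context hold. Let $\beta$ be a unitary character of $\Gamma$ and let $w$ be a $\beta$-automorphic analytic function on $\mathbb D$ with $|w(\zeta)|\le 1$ for $\zeta\in\mathbb D$. Assume that $w$ and $w'$ have nontangential boundary values $w_0$ with $|w_0|=1$, and $w'_0$ (finite), respectively, at $t_0$. Then for every unitary character $\alpha$ of $\Gamma$ $$ t_0\frac{w'_0}{w_0}\ \ge\ \int_{\mathbb T}\frac{|k^{\alpha\beta}_{t_0}(t)-1|^2}{|t-t_0|^2}\,\mu(dt)-\int_{\mathbb T}\frac{|k^{\alpha}_{t_0}(t)-1|^2}{|t-t_0|^2}\,\mu(dt). $$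
   Context: $\mathbb D$ is the open unit disk, $\mathbb T$ the unit circle, $\mu$ the normalized Lebesgue measure on $\mathbb T$, $H^2$ the Hardy space of $\mathbb D$ (functions identified with their boundary values). A Fuchsian group $\Gamma$ is a discrete subgroup of the group of conformal automorphisms $\zeta\mapsto\frac{a\zeta+b}{\overline b\zeta+\overline a}$, $|a|^2-|b|^2=1$, of $\mathbb D$; $e$ is its identity. A unitary character of $\Gamma$ is a homomorphism $\alpha:\Gamma\to\mathbb T$; products of characters are pointwise. A function $f$ analytic on $\mathbb D$ is $\alpha$-automorphic if $f(\gamma(\zeta))=\alpha(\gamma)f(\zeta)$ for all $\gamma\in\Gamma$, $\zeta\in\mathbb D$. When $\sum_{\gamma\in\Gamma}|\gamma'(t_0)|<\infty$, the Martin function is $m_{t_0}(\zeta)=\frac i2\sum_{\gamma\in\Gamma}\frac{\gamma(t_0)+\zeta}{\gamma(t_0)-\zeta}|\gamma'(t_0)|$, so $m'_{t_0}(\zeta)=i t_0\sum_{\gamma\in\Gamma}\frac{\gamma'(t_0)}{(\gamma(t_0)-\zeta)^2}$, $\zeta\in\mathbb D$. A function is of bounded characteristic if it is a quotient of two bounded analytic functions on $\mathbb D$. When $m'_{t_0}$ is of bounded characteristic it factors as $m'_{t_0}=\Delta_{t_0}/\varphi$ with $\Delta_{t_0}$ inner and $\varphi$ outer, $|\varphi|\le4$; $\Delta_{t_0}$ is determined up to a unimodular constant and is fixed. (A1) The nontangential limits $\Delta_{t_0}(t_0)$, with $|\Delta_{t_0}(t_0)|=1$, and $\Delta'_{t_0}(t_0)$,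 finite, exist; that is, $\Delta_{t_0}(\zeta)=\Delta_{t_0}(t_0)+\Delta'_{t_0}(t_0)(\zeta-t_0)+o(\zeta-t_0)$ as $\zeta\to t_0$ nontangentially. (A2) $|t_0-\zeta|\sum_{\gamma\in\Gamma,\gamma\ne e}\frac{|\gamma'(t_0)|}{|\gamma(t_0)-\zeta|^2}=o(1)$ as $\zeta\to t_0$ nontangentially. Under these assumptions, for every unitary character $\alpha$ there is a unique function, denoted $k^\alpha_{t_0}$, that minimizes $\int_{\mathbb T}\frac{|g(t)-1|^2}{|t-t_0|^2}\mu(dt)$ over all $\alpha$-automorphic $g$ with $\frac{g(t)-1}{t-t_0}\in H^2$. *)

(* Defs.v *)
From HB Require Import structures.
From mathcomp Require Import all_boot all_order all_algebra.
From mathcomp Require Import complex.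
From mathcomp Require Import all_classical all_reals all_analysis.

Set Implicit Arguments.
Unset Strict Implicit.
Unset Printing Implicit Defensive.
Import Order.TTheory GRing.Theory Num.Theory.
Import numFieldNormedType.Exports.
Local Open Scope classical_set_scope.
Local Open Scope ring_scope.

(* The regular algebra R[i]^o (convertible to R[i]) is used as the type of
   complex numbers because it carries the normed-module structure over R[i]:
   for f : Cplx R -> Cplx R, [derivable f z 1] and [derive1 f z] are complex
   differentiability and the complex derivative. *)
Notation Cplx R := (GRing.regular (complex R)).

(* The library norm of R[i] takes its values in R[i]; cmod is the same
   modulus, as a real number. *)
Definition cmod (R : realType) (z : Cplx R) : R := ComplexField.Normc.normc z.

Definition cexp (R : realType) (z : Cplx R) : Cplx R :=
  (expR (complex.Re z) * cos (complex.Im z) +i*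
   (expR (complex.Re z) * sin (complex.Im z)))%C.

Definition expi (R : realType) (x : R) : Cplx R := (cos x +i* sin x)%C.

Definition disk (R : realType) : set (Cplx R) := [set z | cmod z < 1].

Definition holomorphic (R : realType) (f : Cplx R -> Cplx R) : Prop :=
  forall z, disk z -> derivable f z 1.

Definition circ_int (R : realType) (F : Cplx R -> \bar R) : \bar R :=
  (((2 * pi)^-1)%:E *
   \int[@lebesgue_measure R]_(x in `[0%R, (2 * pi)%R]) F (expi x))%E.

(* Only used for integrable F (fine sends infinite values to 0). *)
Definition circ_cint (R : realType) (F : Cplx R -> Cplx R) : Cplx R :=
  (fine (circ_int (fun t => (complex.Re (F t))%:E)) +i*
   fine (circ_int (fun t => (complex.Im (F t))%:E)))%C.

Definition stolz (R : realType) (t : Cplx R) (M : R) : set (Cplx R) :=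
  [set z | disk z /\ cmod (z - t) < M * (1 - cmod z)].

Notation stolz_nbhs t M := (within (stolz t M) (nbhs t)).

Definition nt_cvg (R : realType) (T : topologicalType)
    (f : Cplx R -> T) (t : Cplx R) (l : T) : Prop :=
  forall M : R, 1 < M -> f z @[z --> stolz_nbhs t M] --> l.

(* The boundary function on the circle; an arbitrary value at the points where
   the nontangential limit fails to exist. *)
Definition bval (R : realType) (f : Cplx R -> Cplx R) (t : Cplx R) : Cplx R :=
  get [set l | nt_cvg f t l].

Definition hardy2 (R : realType) (f : Cplx R -> Cplx R) : Prop :=
  holomorphic f /\
  exists M : R, forall r : R, 0 <= r -> r < 1 ->
    (circ_int (fun t => (cmod (f ((r%:C)%C * t)) ^+ 2)%:E) <= M%:E)%E.

Definition bounded_holomorphic (R : realType) (f : Cplx R -> Cplx R) : Prop :=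
  holomorphic f /\ exists M : R, forall z, disk z -> cmod (f z) <= M.

Definition bounded_characteristic (R : realType) (f : Cplx R -> Cplx R) :
    Prop :=
  exists p q : Cplx R -> Cplx R,
    [/\ bounded_holomorphic p, bounded_holomorphic q,
        exists2 z, disk z & q z != 0
      & forall z, disk z -> f z * q z = p z].

Definition inner_fun (R : realType) (f : Cplx R -> Cplx R) : Prop :=
  [/\ holomorphic f,
      forall z, disk z -> cmod (f z) <= 1
    & {ae @lebesgue_measure R, forall x, x \in `[0, 2 * pi] ->
        exists2 l, nt_cvg f (expi x) l & cmod l = 1}].

(* f(z) = c exp (\int (t + z) / (t - z) h(t) mu(dt)) with |c| = 1 and h real
   and integrable (so that h = log |f| a.e. on the circle). *)
Definition outer_fun (R : realType) (f : Cplx R -> Cplx R) : Prop :=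
  exists (c : Cplx R) (h : Cplx R -> R),
    [/\ cmod c = 1,
        (@lebesgue_measure R).-integrable `[0, 2 * pi]
          (fun x => (h (expi x))%:E)
      & forall z, disk z ->
          f z = c * cexp (circ_cint (fun t =>
                   (t + z) / (t - z) * ((h t)%:C)%C))].

Definition moebius (R : realType) (a b z : Cplx R) : Cplx R :=
  (a * z + b) / ((b^*)%C * z + (a^*)%C).

Definition su11 (R : realType) (a b : Cplx R) : Prop :=
  cmod a ^+ 2 - cmod b ^+ 2 = 1.

(* An automorphism of the disk is represented by the total function
   [moebius a b], which determines the pair (a, b) exactly up to sign, so that
   sums over G count every group element once.  Since division is total,
   products of moebius functions are moebius only away from the poles (which
   lie outside the closed disk); group operations are therefore stated
   on the disk. *)
Record fuchsian (R : realType) (G : set (Cplx R -> Cplx R)) : Prop := {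
  fuchsian_aut : forall g, G g -> exists a b, su11 a b /\ g = moebius a b;
  fuchsian_id : G id;
  fuchsian_comp : forall g h, G g -> G h ->
    exists2 k, G k & forall z, disk z -> k z = g (h z);
  fuchsian_inv : forall g, G g ->
    exists2 h, G h & forall z, disk z -> h (g z) = z;
  fuchsian_discrete : forall a b, su11 a b -> G (moebius a b) ->
    exists2 e : R, 0 < e & forall a' b', su11 a' b' -> G (moebius a' b') ->
      cmod (a' - a) < e -> cmod (b' - b) < e -> moebius a' b' = moebius a b }.

Definition unitary_character (R : realType) (G : set (Cplx R -> Cplx R))
    (alpha : (Cplx R -> Cplx R) -> Cplx R) : Prop :=
  (forall g, G g -> cmod (alpha g) = 1) /\
  (forall g h k, G g -> G h -> G k -> (forall z, disk z -> k z = g (h z)) ->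
     alpha k = alpha g * alpha h).

Definition automorphic (R : realType) (G : set (Cplx R -> Cplx R))
    (alpha : (Cplx R -> Cplx R) -> Cplx R) (f : Cplx R -> Cplx R) : Prop :=
  holomorphic f /\
  forall g z, G g -> disk z -> f (g z) = alpha g * f z.

(* Sums of absolutely summable families, by positive and negative parts. *)
Definition rsum (R : realType) (I : choiceType) (D : set I) (f : I -> R) : R :=
  fine (\esum_(i in D) (Num.max (f i) 0)%:E) -
  fine (\esum_(i in D) (Num.max (- f i) 0)%:E).

Definition csum (R : realType) (I : choiceType) (D : set I) (f : I -> Cplx R) :
    Cplx R :=
  (rsum D (fun i => complex.Re (f i)) +i* rsum D (fun i => complex.Im (f i)))%C.

(* Differentiating termwise and using |g'(t0)| g(t0) = t0 g'(t0), the derivative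
   is 'i t0 \sum_(g in G) g'(t0) / (g(t0) - z)^2. *)
Definition martin (R : realType) (G : set (Cplx R -> Cplx R)) (t0 z : Cplx R) :
    Cplx R :=
  ('i)%C / 2%:R *
  csum G (fun g => (g t0 + z) / (g t0 - z) * ((cmod (derive1 g t0))%:C)%C).

Definition inner_outer_factorization (R : realType)
    (f Delta phi : Cplx R -> Cplx R) : Prop :=
  [/\ inner_fun Delta, outer_fun phi,
      forall z, disk z -> cmod (phi z) <= 4
    & forall z, disk z -> f z = Delta z / phi z].

(* Delta(z) = d0 + d1 (z - t0) + o(z - t0) as z tends to t0 nontangentially. *)
Definition assumption_A1 (R : realType) (Delta : Cplx R -> Cplx R)
    (t0 : Cplx R) : Prop :=
  exists d0 d1 : Cplx R, cmod d0 = 1 /\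
    forall M : R, 1 < M -> forall e : R, 0 < e ->
      \forall z \near stolz_nbhs t0 M,
        cmod (Delta z - (d0 + d1 * (z - t0))) <= e * cmod (z - t0).

Definition assumption_A2 (R : realType) (G : set (Cplx R -> Cplx R))
    (t0 : Cplx R) : Prop :=
  nt_cvg (fun z => (cmod (t0 - z))%:E *
      \esum_(g in G `\ id)
         (cmod (derive1 g t0) / cmod (g t0 - z) ^+ 2)%:E)%E t0 0%E.

Definition admissible (R : realType) (G : set (Cplx R -> Cplx R))
    (t0 : Cplx R) (alpha : (Cplx R -> Cplx R) -> Cplx R)
    (g : Cplx R -> Cplx R) : Prop :=
  automorphic G alpha g /\ hardy2 (fun z => (g z - 1) / (z - t0)).

Definition deviation (R : realType) (t0 : Cplx R) (g : Cplx R -> Cplx R) :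
    \bar R :=
  circ_int (fun t => (cmod (bval g t - 1) ^+ 2 / cmod (t - t0) ^+ 2)%:E).

Definition extremal (R : realType) (G : set (Cplx R -> Cplx R))
    (t0 : Cplx R) (alpha : (Cplx R -> Cplx R) -> Cplx R)
    (k : Cplx R -> Cplx R) : Prop :=
  admissible G t0 alpha k /\
  forall g, admissible G t0 alpha g -> (deviation t0 k <= deviation t0 g)%E.

(* Main.v *)
(** Normalize W = w / w0 and put f = (k - 1) / (z - t0), h = (W - 1) / (z - t0).
    Since W k is automorphic with character alpha beta and
    (W k - 1) / (z - t0) = W f + h, the function W k competes in the extremal
    problem for alpha beta, so it suffices to bound the H2 norm of W f + h.
    Almost everywhere on the circle h (t - t0) = W - 1 and |W| <= 1 give
      |W f + h|^2 <= |f|^2 + 2 (1 - Re W) / |t - t0|^2 + 2 Re (t0 t f h).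
    The last term has mean zero, because t f h is the boundary value of
    z f(z) h(z) with f and h in H2, and the mean of the middle term is at most
    the angular derivative t0 w0' / w0 (Julia-Caratheodory). *)

Require Import Defs.
From HB Require Import structures.
From mathcomp Require Import all_boot all_order all_algebra.
From mathcomp Require Import complex.
From mathcomp Require Import ring lra.
From mathcomp Require Import all_classical all_reals all_analysis.
From mathcomp Require Import measurable_realfun.
Import Order.TTheory GRing.Theory Num.Theory.
Import numFieldNormedType.Exports.
Local Open Scope classical_set_scope.
Local Open Scope ring_scope.

Set Implicit Arguments.
Unset Strict Implicit.
Unset Printing Implicit Defensive.

(** Membership of h in H2 is where the angular derivative is first needed. On the circle of radius
    r, |h|^2 is at most 2 (1 - Re W) / (1 - r^2) times the Poisson kernel at r t0, whose mean is 2
    (1 - Re W(r^2 t0)) / (1 - r^2); the first-order expansion of W at t0 bounds this as r -> 1.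
    Since W need not be inner, the defect 1 - |W|^2 on the circle is absorbed pointwise, not through
    an identity of norms.

    The conclusion is an inequality in R[i], so it contains the claim that t0 w0' / w0 is real. The
    radius alone cannot show this: W is expanded along rays of every slope at t0.

    [bval] is a choice where the nontangential limit fails, and need not be measurable. Integrals
    are therefore computed with measurable L2 limits of the dilations f(r z), which are
    differentiable on the closed disk and so obey the Cauchy and Poisson formulas. Fatou's theorem
    identifies these limits a.e. with the nontangential ones, and [deviation] is translated into
    them only in [deviationE]. *)

(** * The modulus and complex derivatives *)

Section Modulus.
Context {R : realType}.
Implicit Types (z u : R[i]).
Local Notation C := R[i].

Lemma normcE z : `|z| = (cmod z)%:C%C. Proof. by []. Qed.

Lemma cmod_ge0 z : 0 <= cmod z.
Proof. by rewrite -ler0c -normcE. Qed.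

Lemma cmod0 : cmod (0 : C) = 0.
Proof. exact: ComplexField.Normc.normc0. Qed.

Lemma cmod1 : cmod (1 : C) = 1.
Proof. exact: ComplexField.Normc.normc1. Qed.

Lemma cmodM z u : cmod (z * u) = cmod z * cmod u.
Proof. exact: ComplexField.Normc.normcM. Qed.

Lemma cmodV z : cmod z^-1 = (cmod z)^-1.
Proof. exact: ComplexField.Normc.normcV. Qed.

Lemma cmodN z : cmod (- z) = cmod z.
Proof. by apply/complexI; rewrite -!normcE normrN. Qed.

Lemma cmodB z u : cmod (z - u) = cmod (u - z).
Proof. by rewrite -cmodN opprB. Qed.

Lemma cmodX z n : cmod (z ^+ n) = cmod z ^+ n.
Proof. by elim: n => [|n IH]; rewrite ?expr0 ?cmod1 // !exprS cmodM IH. Qed.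

Lemma cmod_eq0 z : (cmod z == 0) = (z == 0).
Proof.
apply/eqP/eqP => [|->]; last exact: cmod0.
exact: ComplexField.Normc.eq0_normc.
Qed.

Lemma cmod_gt0 z : (0 < cmod z) = (z != 0).
Proof. by rewrite lt_def cmod_ge0 andbT cmod_eq0. Qed.

Lemma cmodD z u : cmod (z + u) <= cmod z + cmod u.
Proof. by rewrite -lecR rmorphD /= -!normcE ler_normD. Qed.

Lemma cmod_triangle z u v : cmod (z - v) <= cmod (z - u) + cmod (u - v).
Proof. by rewrite (le_trans _ (cmodD _ _)) // addrA subrK. Qed.

Lemma cmodBD z u : cmod z - cmod u <= cmod (z - u).
Proof. by rewrite lerBlDr (le_trans _ (cmodD _ _)) // subrK. Qed.

Lemma cmod_sqr z : cmod z ^+ 2 = complex.Re z ^+ 2 + complex.Im z ^+ 2.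
Proof. by case: z => a b; rewrite /cmod /= sqr_sqrtr // addr_ge0 // sqr_ge0. Qed.

Lemma cmodR (x : R) : cmod (x%:C%C) = `|x|.
Proof. by rewrite /cmod /= expr0n /= addr0 sqrtr_sqr. Qed.

Lemma cmodJ z : cmod (z^*%C) = cmod z.
Proof. by case: z => a b; rewrite /cmod /= sqrrN. Qed.

Lemma ReN z : complex.Re (- z) = - complex.Re z. Proof. by case: z. Qed.
Lemma ImN z : complex.Im (- z) = - complex.Im z. Proof. by case: z. Qed.
Lemma ReD z u : complex.Re (z + u) = complex.Re z + complex.Re u.
Proof. by case: z; case: u. Qed.
Lemma ImD z u : complex.Im (z + u) = complex.Im z + complex.Im u.
Proof. by case: z; case: u. Qed.
Lemma ReB z u : complex.Re (z - u) = complex.Re z - complex.Re u.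
Proof. by case: z; case: u. Qed.
Lemma ImB z u : complex.Im (z - u) = complex.Im z - complex.Im u.
Proof. by case: z; case: u. Qed.
Lemma ReM z u : complex.Re (z * u) =
  complex.Re z * complex.Re u - complex.Im z * complex.Im u.
Proof. by case: z; case: u. Qed.
Lemma ImM z u : complex.Im (z * u) =
  complex.Re z * complex.Im u + complex.Im z * complex.Re u.
Proof. by case: z => a b; case: u => c d /=. Qed.
Lemma ReMr (x : R) z : complex.Re (x%:C%C * z) = x * complex.Re z.
Proof. by rewrite ReM /= mul0r subr0. Qed.
Lemma ImMr (x : R) z : complex.Im (x%:C%C * z) = x * complex.Im z.
Proof. by rewrite ImM /= mul0r addr0. Qed.

Lemma Re_le_cmod z : `|complex.Re z| <= cmod z.
Proof.
rewrite -(ler_pXn2r (n := 2)) // ?nnegrE ?cmod_ge0 //.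
by rewrite cmod_sqr real_normK ?num_real // lerDl sqr_ge0.
Qed.

Lemma Im_le_cmod z : `|complex.Im z| <= cmod z.
Proof.
rewrite -(ler_pXn2r (n := 2)) // ?nnegrE ?cmod_ge0 //.
by rewrite cmod_sqr real_normK ?num_real // lerDr sqr_ge0.
Qed.

Lemma cmod_le_ReIm z : cmod z <= `|complex.Re z| + `|complex.Im z|.
Proof.
rewrite -(ler_pXn2r (n := 2)) // ?nnegrE ?cmod_ge0 ?addr_ge0 //.
rewrite cmod_sqr sqrrD !real_normK ?num_real // lerD2r lerDl.
by rewrite mulrn_wge0 // mulr_ge0.
Qed.

Lemma complex_eqP z u :
  complex.Re z = complex.Re u -> complex.Im z = complex.Im u -> z = u.
Proof. by case: z; case: u => /= a b c d -> ->. Qed.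

Lemma mulcJ z : z * z^*%C = ((cmod z ^+ 2)%:C)%C.
Proof. by rewrite cmod_sqr; case: z => a b; apply: complex_eqP => /=; ring. Qed.

Lemma ReJ z : complex.Re (z^*)%C = complex.Re z. Proof. by case: z. Qed.
Lemma ImJ z : complex.Im (z^*)%C = - complex.Im z. Proof. by case: z. Qed.

(* [Cplx R] carries the topology of its R[i]-valued norm. *)
Lemma nbhs_cmodP z (P : set C) :
  nbhs (z : Cplx R) P <->
  exists2 e : R, 0 < e & forall u, cmod (u - z) < e -> P u.
Proof.
split=> [/nbhs_ballP[e /= e0 He]|[e e0 He]].
  have eE : e = (complex.Re e)%:C%C by case: e e0 {He} => a b; rewrite ltcE /= => /andP[/eqP -> _].
  exists (complex.Re e); first by move: e0; rewrite eE ltcR.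
  move=> u ue; apply: He; rewrite -ball_normE /ball_ /=.
  by rewrite -normrN opprB eE (_ : `| _ | = (cmod (u - z))%:C%C) // ltcR.
apply/nbhs_ballP; exists (e%:C)%C; first by rewrite /= ltcR.
move=> u; rewrite -ball_normE /ball_ /= => ue; apply: He.
by rewrite -ltcR cmodB.
Qed.

Lemma within_cmodP z (A P : set C) :
  (within A (nbhs (z : Cplx R))) P <->
  exists2 e : R, 0 < e & forall u, cmod (u - z) < e -> A u -> P u.
Proof. exact: (nbhs_cmodP z [set u | A u -> P u]). Qed.

(** Differentiability as a first-order expansion with a real [e], free of division and of
    R[i]-valued radii: the form used by Goursat's estimate and by the chain rules. *)
Definition cder (f : C -> C) z d := forall e : R, 0 < e ->
  exists2 h : R, 0 < h & forall u, cmod (u - z) < h ->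
    cmod (f u - f z - d * (u - z)) <= e * cmod (u - z).

Lemma derivable_cder (f : Cplx R -> Cplx R) (z : Cplx R) :
  derivable f z 1 -> cder f z (derive1 f z).
Proof.
rewrite derive1E => /cvg_ex[/= d Hd]; have dE : 'D_1 f z = d by exact: cvg_lim Hd.
rewrite {}dE => e e0.
have e0' : (0 : R[i]) < (e%:C)%C by rewrite ltcR.
move/cvgrPdist_le: Hd => /(_ _ e0').
move/(within_cmodP (0 : R[i])) => [h h0 Hh].
exists h => // u uh; case: (eqVneq u z) => [->|uz].
  by rewrite !subrr mulr0 subr0 cmod0 mulr0.
have := Hh (u - z); rewrite subr0 subr_eq0 => /(_ uh uz).
rewrite (_ : `| _ | = (cmod (d - (u - z)^-1 * (f u - f z)))%:C%C); last first.
  by congr (`|_ - _|); rewrite /GRing.scale /= mulr1 subrK.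
rewrite lecR => H.
have -> : f u - f z - d * (u - z) = - ((d - (u - z)^-1 * (f u - f z)) * (u - z)).
  by rewrite mulrBl mulrAC mulVf ?subr_eq0 // mul1r opprB.
by rewrite cmodN cmodM; exact: (ler_wpM2r (cmod_ge0 _) H).
Qed.

Lemma cder_derivable (f : Cplx R -> Cplx R) (z d : Cplx R) :
  cder f z d -> derivable f z 1.
Proof.
move=> H; apply/cvg_ex; exists d; apply/cvgrPdist_le => /= e e0.
have eE : e = (complex.Re e)%:C%C by case: e e0 => a b; rewrite ltcE /= => /andP[/eqP -> _].
have e1 : 0 < complex.Re e by move: e0; rewrite eE ltcR.
have [h h0 Hh] := H _ e1.
apply/(within_cmodP (0 : R[i])); exists h => // u; rewrite subr0 => uh u0.
rewrite {1}eE (_ : `| _ | = (cmod (d - u^-1 * (f (u + z) - f z)))%:C%C); last first.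
  by congr (`|_ - _|); rewrite /GRing.scale /= mulr1.
have := Hh (u + z); rewrite addrK => /(_ uh) {}Hh; rewrite lecR.
have u1 : 0 < cmod u by rewrite cmod_gt0.
rewrite -(ler_pM2r u1) -cmodM; apply: le_trans Hh.
by rewrite cmodB mulrBl mulrAC mulVf // mul1r.
Qed.

End Modulus.

(** * Integrals of complex-valued functions *)

Section ComplexIntegral.
Context {R : realType}.
Local Notation C := R[i].
Local Notation mu := (@lebesgue_measure R).
Implicit Types (f g : R -> R) (phi psi : R -> C) (D : set R).

(** Continuity is asked of the two real coordinates, so that the integration theory of real
    functions applies to each of them. *)
Definition ccont phi := continuous (fun x => complex.Re (phi x)) /\
  continuous (fun x => complex.Im (phi x)).

Lemma ccont_cst c : ccont (fun=> c).
Proof. by split; exact: cst_continuous. Qed.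

Lemma ccontD phi psi : ccont phi -> ccont psi -> ccont (fun x => phi x + psi x).
Proof.
move=> [a1 a2] [b1 b2]; split=> x.
  under eq_fun do rewrite ReD; exact: (continuousD (a1 x) (b1 x)).
under eq_fun do rewrite ImD; exact: (continuousD (a2 x) (b2 x)).
Qed.

Lemma ccontN phi : ccont phi -> ccont (fun x => - phi x).
Proof.
move=> [a1 a2]; split=> x.
  under eq_fun do rewrite ReN; exact: (continuousN (a1 x)).
under eq_fun do rewrite ImN; exact: (continuousN (a2 x)).
Qed.

Lemma ccontB phi psi : ccont phi -> ccont psi -> ccont (fun x => phi x - psi x).
Proof. by move=> a b; apply: ccontD => //; exact: ccontN. Qed.

Lemma ccontM phi psi : ccont phi -> ccont psi -> ccont (fun x => phi x * psi x).
Proof.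
move=> [a1 a2] [b1 b2]; split=> x.
  under eq_fun do rewrite ReM; exact: (continuousB (continuousM (a1 x) (b1 x)) (continuousM (a2 x) (b2 x))).
under eq_fun do rewrite ImM; exact: (continuousD (continuousM (a1 x) (b2 x)) (continuousM (a2 x) (b1 x))).
Qed.

Lemma ccontJ phi : ccont phi -> ccont (fun x => ((phi x)^*)%C).
Proof.
move=> [a1 a2]; split=> x.
  by under eq_fun do rewrite ReJ; exact: a1.
under eq_fun do rewrite ImJ; exact: (continuousN (a2 x)).
Qed.

Lemma ccontR f : continuous f -> ccont (fun x => (f x)%:C%C).
Proof. by move=> cf; split => //= x; exact: cst_continuous. Qed.

Lemma ccont_sqr phi : ccont phi -> continuous (fun x => cmod (phi x) ^+ 2).
Proof.
move=> [a1 a2] x; under eq_fun do rewrite cmod_sqr.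
under eq_fun do rewrite !expr2.
exact: (continuousD (continuousM (a1 x) (a1 x)) (continuousM (a2 x) (a2 x))).
Qed.

Lemma ccont_cmod phi : ccont phi -> continuous (fun x => cmod (phi x)).
Proof.
move=> cp x.
have -> : (fun x => cmod (phi x)) = Num.sqrt \o (fun x => cmod (phi x) ^+ 2).
  by apply/funext => y /=; rewrite sqrtr_sqr ger0_norm ?cmod_ge0.
apply: continuous_comp; first exact: ccont_sqr.
exact: sqrt_continuous.
Qed.

Lemma ccontV phi : ccont phi -> (forall x, phi x != 0) ->
  ccont (fun x => (phi x)^-1).
Proof.
move=> cp p0.
have -> : (fun x => (phi x)^-1) =
    (fun x => ((cmod (phi x) ^+ 2)^-1)%:C%C * ((phi x)^*)%C).
  apply/funext => x; rewrite fmorphV /=.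
  have h : ((cmod (phi x) ^+ 2)%:C)%C != 0 :> C by rewrite -mulcJ mulf_neq0 // conjc_eq0.
  by apply: (mulfI (p0 x)); rewrite mulfV // mulrCA mulcJ mulVf.
apply: ccontM; last exact: ccontJ.
apply: ccontR => x; apply: cvgV; last exact: ccont_sqr.
by rewrite expf_neq0 // cmod_eq0.
Qed.

Lemma ccontX phi n : ccont phi -> ccont (fun x => phi x ^+ n).
Proof.
move=> cp; elim: n => [|n IH]; first by under eq_fun do rewrite expr0; exact: ccont_cst.
by under eq_fun do rewrite exprS; exact: ccontM.
Qed.

Lemma continuousP_eps f : (forall x e, 0 < e -> exists2 d, 0 < d &
    forall y, `|y - x| < d -> `|f y - f x| < e) -> continuous f.
Proof.
move=> H x; apply/cvgrPdist_lt => e /(H x)[d d0 Hd].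
apply/nbhs_ballP; exists d => //= y; rewrite /ball /= distrC => /Hd.
by rewrite distrC.
Qed.

Lemma continuous_at_eps f x e : {for x, continuous f} -> 0 < e -> exists2 d, 0 < d &
    forall y, `|y - x| < d -> `|f y - f x| < e.
Proof.
move=> /cvgrPdist_lt H e0; have /nbhs_ballP[d /= d0 h] := H _ e0.
exists d => // y yd; rewrite distrC; apply: h.
by rewrite /ball /= distrC.
Qed.

Lemma ccontP phi : (forall x e, 0 < e -> exists2 d, 0 < d &
    forall y, `|y - x| < d -> cmod (phi y - phi x) < e) -> ccont phi.
Proof.
move=> H; split; apply: continuousP_eps => x e /(H x)[d d0 Hd];
  exists d => // y /Hd; rewrite -?ReB -?ImB; apply: le_lt_trans.
  exact: Re_le_cmod.
exact: Im_le_cmod.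
Qed.

Lemma ccont_at phi x e : ccont phi -> 0 < e -> exists2 d, 0 < d &
    forall y, `|y - x| < d -> cmod (phi y - phi x) < e.
Proof.
move=> [a b] e0; have e2 : 0 < e / 2 by rewrite divr_gt0.
have [d1 d10 h1] := continuous_at_eps (a x) e2.
have [d2 d20 h2] := continuous_at_eps (b x) e2.
exists (Num.min d1 d2); first by rewrite lt_min d10.
move=> y; rewrite lt_min => /andP[/h1 u1 /h2 u2].
rewrite (le_lt_trans (cmod_le_ReIm _)) // ReB ImB [ltRHS](splitr e).
exact: ltrD.
Qed.

Definition cint D phi : C :=
  (\int[mu]_(x in D) complex.Re (phi x) +i* \int[mu]_(x in D) complex.Im (phi x))%C.

Definition cintble D phi := mu.-integrable D (fun x => (complex.Re (phi x))%:E) /\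
  mu.-integrable D (fun x => (complex.Im (phi x))%:E).

Lemma continuous_integrable f a b : continuous f ->
  mu.-integrable `[a, b] (fun x => (f x)%:E).
Proof.
move=> cf; apply: continuous_compact_integrable; first exact: segment_compact.
exact: continuous_subspaceT.
Qed.

Lemma ccont_cintble phi a b : ccont phi -> cintble `[a, b] phi.
Proof. by move=> [? ?]; split; exact: continuous_integrable. Qed.

Lemma eq_cint D phi psi : (forall x, D x -> phi x = psi x) ->
  cint D phi = cint D psi.
Proof.
move=> H; rewrite /cint.
congr (_ +i* _)%C; apply: eq_Rintegral => x /[!inE] /H -> //.
Qed.

Lemma cintbleD D phi psi : measurable D -> cintble D phi -> cintble D psi ->
  cintble D (fun x => phi x + psi x).
Proof.
move=> mD [a b] [c d]; split.
  by under eq_fun do rewrite ReD EFinD; exact: integrableD.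
by under eq_fun do rewrite ImD EFinD; exact: integrableD.
Qed.

Lemma cintD D phi psi : measurable D -> cintble D phi -> cintble D psi ->
  cint D (fun x => phi x + psi x) = cint D phi + cint D psi.
Proof.
move=> mD [a b] [c d]; apply: complex_eqP => /=.
  by under eq_Rintegral do rewrite ReD; exact: RintegralD.
by under eq_Rintegral do rewrite ImD; exact: RintegralD.
Qed.

Lemma integrableZE D f c : measurable D -> mu.-integrable D (fun x => (f x)%:E) ->
  mu.-integrable D (fun x => (c * f x)%:E).
Proof. by move=> mD h; under eq_fun do rewrite EFinM; exact: integrableZl. Qed.

Lemma cintbleZ D phi c : measurable D -> cintble D phi ->
  cintble D (fun x => c * phi x).
Proof.
move=> mD [a b]; split.
  under eq_fun do rewrite ReM EFinB.
  by apply: integrableB => //; exact: integrableZE.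
under eq_fun do rewrite ImM EFinD.
by apply: integrableD => //; exact: integrableZE.
Qed.

Lemma cintZ D phi c : measurable D -> cintble D phi ->
  cint D (fun x => c * phi x) = c * cint D phi.
Proof.
move=> mD [a b]; apply: complex_eqP.
  rewrite ReM /=; under eq_Rintegral do rewrite ReM.
  by rewrite RintegralB ?RintegralZl //; exact: integrableZE.
rewrite ImM /=; under eq_Rintegral do rewrite ImM.
by rewrite RintegralD ?RintegralZl //; exact: integrableZE.
Qed.

Lemma cintbleN D phi : measurable D -> cintble D phi -> cintble D (fun x => - phi x).
Proof.
by move=> mD h; under eq_fun do rewrite -mulN1r; exact: cintbleZ.
Qed.

Lemma cintB D phi psi : measurable D -> cintble D phi -> cintble D psi ->
  cint D (fun x => phi x - psi x) = cint D phi - cint D psi.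
Proof.
move=> mD a b; rewrite cintD //; last exact: cintbleN.
congr (_ + _); under eq_fun do rewrite -mulN1r.
by rewrite cintZ // mulN1r.
Qed.

Lemma cintbleB D phi psi : measurable D -> cintble D phi -> cintble D psi ->
  cintble D (fun x => phi x - psi x).
Proof. by move=> mD a b; apply: cintbleD => //; exact: cintbleN. Qed.

(** The factor 2 is the price of bounding real and imaginary parts separately. It is harmless: these
    bounds serve to show that a quantity vanishes or stays bounded. *)
Lemma cmod_cint_le D phi g : measurable D -> cintble D phi ->
  mu.-integrable D (fun x => (g x)%:E) -> (forall x, D x -> cmod (phi x) <= g x) ->
  cmod (cint D phi) <= 2 * \int[mu]_(x in D) g x.
Proof.
move=> mD [a b] ig H; rewrite (le_trans (cmod_le_ReIm _)) // mulr_natl mulr2n /=.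
apply: lerD.
  rewrite (le_trans (le_normr_Rintegral _ a)) //; apply: le_Rintegral => //.
    exact: (integrable_norm a).
  by move=> x Dx; rewrite (le_trans (Re_le_cmod _)) // H.
rewrite (le_trans (le_normr_Rintegral _ b)) //; apply: le_Rintegral => //.
  exact: (integrable_norm b).
by move=> x Dx; rewrite (le_trans (Im_le_cmod _)) // H.
Qed.

Lemma Rint_cst a b c : a <= b -> \int[mu]_(x in `[a, b]) c = c * (b - a).
Proof.
by move=> ab; rewrite Rintegral_cst //= lebesgue_measure_itv /= lte_fin lt_neqAle ab andbT;
  case: eqVneq => [->|_] /=; rewrite ?subrr.
Qed.

Lemma cmod_cint_bound phi a b M : a <= b -> cintble `[a, b] phi ->
  (forall x, a <= x <= b -> cmod (phi x) <= M) ->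
  cmod (cint `[a, b] phi) <= 2 * M * (b - a).
Proof.
move=> ab ip H; rewrite -mulrA -Rint_cst //; apply: cmod_cint_le => //.
exact/continuous_integrable/cst_continuous.
Qed.

Lemma Rint_split f a b c : a <= b -> b <= c -> continuous f ->
  \int[mu]_(x in `[a, c]) f x = \int[mu]_(x in `[a, b]) f x + \int[mu]_(x in `[b, c]) f x.
Proof.
move=> ab bc cf.
have h := @Rintegral_itvB _ f (BLeft a) (BRight c) b (continuous_integrable a c cf).
rewrite -(@Rintegral_itv_obnd_cbnd _ b); last first.
  by apply: integrableS (continuous_integrable b c cf) => //; exact: subset_itv_oc_cc.
by rewrite -h ?bnd_simp // addrC subrK.
Qed.

Lemma cint_split phi a b c : a <= b -> b <= c -> ccont phi ->
  cint `[a, c] phi = cint `[a, b] phi + cint `[b, c] phi.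
Proof. by move=> ab bc [c1 c2]; apply: complex_eqP => /=; exact: Rint_split. Qed.

Lemma FTC_cont f F a b : a <= b -> continuous f ->
  (forall x, is_derive x (1 : R) F (f x)) ->
  \int[mu]_(x in `[a, b]) f x = F b - F a.
Proof.
rewrite le_eqVlt => /predU1P[-> _ _|ab cf dF].
  by rewrite set_itv1 Rintegral_set1 subrr.
have cF : continuous F.
  by move=> x; apply/differentiable_continuous/derivable1_diffP; exact: (@ex_derive _ _ _ _ _ _ _ (dF x)).
rewrite /Rintegral (@continuous_FTC2 _ f F) //.
- exact: continuous_subspaceT.
- split.
  + by move=> x _; exact: (@ex_derive _ _ _ _ _ _ _ (dF x)).
  + by apply: cvg_at_right_filter; exact: cF.
  + by apply: cvg_at_left_filter; exact: cF.
- by move=> x _; rewrite derive1E; exact: (@derive_val _ _ _ _ _ _ _ (dF x)).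
Qed.

End ComplexIntegral.

(** * Cauchy and Poisson formulas *)

Section Goursat.
Context {R : realType}.
(* [I a b c d] stands for the integral of a 1-form along the boundary of the
   rectangle [a, b] x [c, d]. *)
Variable I : R -> R -> R -> R -> R[i].
Variables (a0 b0 c0 d0 : R).
Hypothesis ab0 : a0 <= b0.
Hypothesis cd0 : c0 <= d0.
Hypothesis addU : forall a m b c d, a <= m -> m <= b -> c <= d ->
  I a b c d = I a m c d + I m b c d.
Hypothesis addT : forall a b c m d, a <= b -> c <= m -> m <= d ->
  I a b c d = I a b c m + I a b m d.
(** For a derivable integrand, the affine part at (u, t) integrates to zero, and the rest is
    o(distance) times a perimeter. *)
Hypothesis local_small : forall u t e, a0 <= u -> u <= b0 -> c0 <= t -> t <= d0 -> 0 < e ->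
  exists2 h : R, 0 < h & forall a b c d, a <= u -> u <= b -> c <= t -> t <= d ->
    b - a < h -> d - c < h -> cmod (I a b c d) <= e * (b - a + (d - c)) ^+ 2.

Let halfU (s : (R * R) * (R * R)) : (R * R) * (R * R) :=
  let: ((a, b), (c, d)) := s in let m := (a + b) / 2 in
  if cmod (I a b c d) / 2 <= cmod (I a m c d) then ((a, m), (c, d)) else ((m, b), (c, d)).

Let halfT (s : (R * R) * (R * R)) : (R * R) * (R * R) :=
  let: ((a, b), (c, d)) := s in let m := (c + d) / 2 in
  if cmod (I a b c d) / 2 <= cmod (I a b c m) then ((a, b), (c, m)) else ((a, b), (m, d)).

Let Q n := iter n (halfT \o halfU) ((a0, b0), (c0, d0)).
Let Qa n := (Q n).1.1.
Let Qb n := (Q n).1.2.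
Let Qc n := (Q n).2.1.
Let Qd n := (Q n).2.2.
Let QI n := I (Qa n) (Qb n) (Qc n) (Qd n).

Let QS n : Q n.+1 = halfT (halfU (Q n)). Proof. by []. Qed.

(** A round bisects both directions and keeps the heavier part, so the modulus loses at most a
    factor 4. The square of the semi-perimeter loses exactly a factor 4, which is the balance that
    [goursat_rectangle] exploits. *)
Let Qinv n : [/\ Qa n <= Qb n, Qc n <= Qd n,
  Qb n - Qa n = (b0 - a0) / 2 ^+ n, Qd n - Qc n = (d0 - c0) / 2 ^+ n &
  cmod (I a0 b0 c0 d0) / 4 ^+ n <= cmod (QI n)].
Proof.
elim: n => [|n]; first by rewrite /QI /Qa /Qb /Qc /Qd /= !expr0 !divr1.
rewrite /QI /Qa /Qb /Qc /Qd QS.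
case: (Q n) => -[a b] [c d]; rewrite [X in X -> _]/= => -[ab cd wab wcd Ige].
rewrite ![2 ^+ n.+1]exprSr [4 ^+ n.+1]exprSr !invfM !mulrA -wab -wcd.
set m := (a + b) / 2.
have [a' [b' [-> [ab' wab' I']]]] : exists a' b', halfU ((a, b), (c, d)) = ((a', b'), (c, d)) /\
    [/\ a' <= b', b' - a' = (b - a) / 2 & cmod (I a b c d) / 2 <= cmod (I a' b' c d)].
  rewrite /halfU -/m; case: ifPn => h; [exists a, m|exists m, b]; split => //.
    by split=> //; rewrite /m; lra.
  split; [rewrite /m; lra|rewrite /m; lra|].
  have := cmodD (I a m c d) (I m b c d); rewrite -addU //; try by rewrite /m; lra.
set l := (c + d) / 2.
have [c' [d' [-> [cd' wcd' I'']]]] : exists c' d', halfT ((a', b'), (c, d)) = ((a', b'), (c', d')) /\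
    [/\ c' <= d', d' - c' = (d - c) / 2 & cmod (I a' b' c d) / 2 <= cmod (I a' b' c' d')].
  rewrite /halfT -/l; case: ifPn => h; [exists c, l|exists l, d]; split => //.
    by split=> //; rewrite /l; lra.
  split; [rewrite /l; lra|rewrite /l; lra|].
  have := cmodD (I a' b' c l) (I a' b' l d); rewrite -addT //; try by rewrite /l; lra.
split => //=.
rewrite (le_trans _ I'') // ler_pdivlMr // (le_trans _ I') // ler_pdivlMr //.
by rewrite (le_trans _ Ige) // -!mulrA ler_wpM2l ?cmod_ge0 //; lra.
Qed.

Let Qmono n : [/\ Qa n <= Qa n.+1, Qb n.+1 <= Qb n, Qc n <= Qc n.+1 & Qd n.+1 <= Qd n].
Proof.
have [] := Qinv n.
rewrite /QI /Qa /Qb /Qc /Qd QS.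
case: (Q n) => -[a b] [c d] /= ab cd _ _ _.
by case: ifPn => _ /=; case: ifPn => _ /=; split => //; lra.
Qed.

Let nested (x y : nat -> R) : (forall n, x n <= y n) -> (forall n, x n <= x n.+1) ->
  (forall n, y n.+1 <= y n) -> exists u, forall n, x n <= u <= y n.
Proof.
move=> xy hx hy.
have mx : {homo x : m n / (m <= n)%N >-> m <= n} by exact: (homo_leq (@le_refl _ _) (@le_trans _ _)).
have my : {homo y : m n / (m <= n)%N >-> n <= m}.
  by apply: (@homo_leq _ y (fun p q => q <= p)) => // p q r h1 h2; exact: le_trans h2 h1.
have xym m n : x m <= y n.
  by rewrite (le_trans (mx _ _ (leq_maxl m n))) // (le_trans (xy _)) // my // leq_maxr.
exists (sup (range x)) => n; apply/andP; split.
  by apply: ub_le_sup; [exists (y 0%N) => _ [m _ <-]|exists n].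
by apply: ge_sup; [exists (x 0%N), 0%N|move=> _ [m _ <-]].
Qed.

Lemma goursat_rectangle : I a0 b0 c0 d0 = 0.
Proof.
apply/eqP; rewrite -cmod_eq0; apply/negPn/negP => I0.
have {}I0 : 0 < cmod (I a0 b0 c0 d0) by rewrite lt_def I0 cmod_ge0.
have [u Hu] := @nested Qa Qb (fun n => let: And5 h _ _ _ _ := Qinv n in h)
  (fun n => let: And4 h _ _ _ := Qmono n in h) (fun n => let: And4 _ h _ _ := Qmono n in h).
have [t Ht] := @nested Qc Qd (fun n => let: And5 _ h _ _ _ := Qinv n in h)
  (fun n => let: And4 _ _ h _ := Qmono n in h) (fun n => let: And4 _ _ _ h := Qmono n in h).
have /andP[u1 u2] := Hu 0%N; have /andP[t1 t2] := Ht 0%N.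
set L := b0 - a0 + (d0 - c0).
have L0 : 0 <= L by rewrite addr_ge0 // subr_ge0.
(* With this [e] the local bound e (L / 2^n)^2 is strictly below |I| / 4^n, against [Qinv]. The
   summand 1 keeps the inequality strict and covers L = 0. *)
pose e := cmod (I a0 b0 c0 d0) / (L ^+ 2 + 1).
have L1 : 0 < L ^+ 2 + 1 by rewrite ltr_pwDr // sqr_ge0.
have e0 : 0 < e by rewrite /e divr_gt0.
have [h h0 Hh] := local_small u1 u2 t1 t2 e0.
pose n := Num.bound (L / h).
have Ln : L / 2 ^+ n < h.
  rewrite ltr_pdivrMr ?exprn_gt0 // mulrC -ltr_pdivrMr //; exact: upper_nthrootP.
have [_ _ wab wcd Ige] := Qinv n.
have /andP[u3 u4] := Hu n; have /andP[t3 t4] := Ht n.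
have n0 : 0 < (2 ^+ n)^-1 :> R by rewrite invr_gt0 exprn_gt0.
have small x : x <= L -> x / 2 ^+ n < h.
  by move=> xL; rewrite (le_lt_trans _ Ln) // ler_wpM2r ?(ltW n0).
have := Hh _ _ _ _ u3 u4 t3 t4; rewrite wab wcd -mulrDl -/L => Hh'.
have {Hh'} := Hh' (small _ _) (small _ _).
have s1 : b0 - a0 <= L by rewrite lerDl subr_ge0.
have s2 : d0 - c0 <= L by rewrite lerDr subr_ge0.
move=> /(_ s1 s2).
apply/negP; rewrite -ltNge (lt_le_trans _ Ige) //.
rewrite expr_div_n -exprM mulnC exprM (_ : 2 ^+ 2 = 4 :> R); last by ring.
rewrite mulrA ltr_pM2r ?invr_gt0 ?exprn_gt0 // /e mulrAC ltr_pdivrMr //.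
by rewrite ltr_pM2l // ltrDl.
Qed.

End Goursat.

(** * The unit circle parametrized by [expi] *)

Section Expi.
Context {R : realType}.
Local Notation C := R[i].

Lemma cmod_expi (x : R) : cmod (expi x) = 1.
Proof.
apply/eqP; rewrite -(@eqrXn2 _ 2) ?cmod_ge0 ?ler01 // cmod_sqr expr1n /=.
by rewrite cos2Dsin2.
Qed.

Lemma cmod_expi_le1 (x : R) : cmod (expi x) <= 1.
Proof. by rewrite cmod_expi. Qed.

Lemma expi_neq0 (x : R) : expi x != 0 :> C.
Proof. by rewrite -cmod_eq0 cmod_expi oner_eq0. Qed.

Lemma ccont_expi : ccont (@expi R).
Proof. by split; [exact: continuous_cos|exact: continuous_sin]. Qed.

Lemma expi0 : expi (0 : R) = 1 :> C.
Proof. by rewrite /expi cos0 sin0. Qed.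

Lemma expi2pi : expi (2 * pi : R) = 1 :> C.
Proof. by rewrite /expi mulr_natl cos2pi sin2pi. Qed.

Lemma expiJ (x : R) : expi x * ((expi x)^*)%C = 1 :> C.
Proof. by rewrite mulcJ cmod_expi expr1n. Qed.

Lemma derive_le1_lipschitz (f df : R -> R) : (forall x, is_derive x (1:R) f (df x)) ->
  (forall x, `|df x| <= 1) -> forall x y, `|f x - f y| <= `|x - y|.
Proof.
move=> dF dle; suff H x y : x <= y -> `|f x - f y| <= `|x - y|.
  by move=> x y; case: (leP x y) => [|/ltW] /H //; rewrite distrC [leRHS]distrC.
move=> xy; have cf : {within `[x, y], continuous f}.
  apply: continuous_subspaceT => z; apply/differentiable_continuous/derivable1_diffP.
  exact: (@ex_derive _ _ _ _ _ _ _ (dF z)).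
have [c _ E] := @MVT_segment _ f df x y xy (fun z _ => dF z) cf.
by rewrite distrC [leRHS]distrC E normrM ler_piMl.
Qed.

Lemma expi_lipschitz (x y : R) : cmod (expi x - expi y) <= 2 * `|x - y|.
Proof.
rewrite (le_trans (cmod_le_ReIm _)) // mulr_natl mulr2n; apply: lerD.
  rewrite /=; apply: (@derive_le1_lipschitz (@cos R) (fun x => - sin x)).
  by move=> z; rewrite normrN sin_max.
rewrite /=; apply: (@derive_le1_lipschitz (@sin R) (@cos R)).
exact: cos_max.
Qed.

End Expi.

Section Derivable.
Context {R : realType}.
Implicit Types (f q : Cplx R -> Cplx R) (z d : Cplx R).

Lemma derivable_lip f z : derivable f z 1 -> exists2 K, 0 < K & exists2 h, 0 < h &
  forall u, cmod (u - z) < h -> cmod (f u - f z) <= K * cmod (u - z).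
Proof.
move=> /derivable_cder H; have [h h0 Hh] := H 1 ltr01.
exists (cmod (derive1 f z) + 1); first by rewrite ltr_wpDl ?cmod_ge0.
exists h => // u /Hh H1; rewrite mulrDl -cmodM [leRHS]addrC.
rewrite -[X in cmod X <= _](subrK (derive1 f z * (u - z))).
by rewrite (le_trans (cmodD _ _)) // lerD2r.
Qed.

Lemma derivable_cont f z e : derivable f z 1 -> 0 < e -> exists2 h, 0 < h &
  forall u, cmod (u - z) < h -> cmod (f u - f z) < e.
Proof.
move=> /derivable_lip[K K0 [h h0 Hh]] e0.
exists (Num.min h (e / K)); first by rewrite lt_min h0 divr_gt0.
move=> u; rewrite lt_min ltr_pdivlMr // => /andP[/Hh uh uK].
by rewrite (le_lt_trans uh) // mulrC.
Qed.

Lemma derivable_scale f z (c : Cplx R) :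
  derivable f (c * z) 1 -> derivable (fun u => f (c * u) : Cplx R) z 1.
Proof.
case: (eqVneq c 0) => [->|c0].
  by rewrite (_ : (fun _ => _) = cst (f 0)); [move=> _; exact: derivable_cst|apply/funext => u /=; rewrite mul0r].
have c1 : 0 < cmod c by rewrite cmod_gt0.
move=> /derivable_cder H; apply: (@cder_derivable _ _ _ (derive1 f (c * z) * c)).
move=> e e0; have [h h0 Hh] := H (e / cmod c) (divr_gt0 e0 c1).
exists (h / cmod c); first by rewrite divr_gt0.
move=> u; set u' := u - z; rewrite ltr_pdivlMr // => uh.
have E : cmod (c * u - c * z) = cmod u' * cmod c by rewrite -mulrBr cmodM mulrC.
have := Hh (c * u); rewrite E => /(_ uh) H1.
rewrite -mulrA (_ : c * u' = c * u - c * z); last by rewrite mulrBr.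
apply: (le_trans H1).
by rewrite [cmod u' * _]mulrC mulrA divfK // gt_eqF.
Qed.

Lemma ccont_comp (D : set R[i]) q (P : R -> R[i]) :
  (forall z, D z -> derivable q z 1) -> (forall x, D (P x)) -> ccont P ->
  ccont (fun x => q (P x)).
Proof.
move=> Hq DP cP; apply: ccontP => x e e0.
have [h h0 Hh] := derivable_cont (Hq _ (DP x)) e0.
have [d d0 Hd] := ccont_at x cP h0.
by exists d => // y /Hd /Hh.
Qed.

End Derivable.

Section IntegralExtras.
Context {R : realType}.
Local Notation C := R[i].
Local Notation mu := (@lebesgue_measure R).

Lemma cintR (D : set R) (f : R -> R) :
  cint D (fun x => (f x)%:C%C) = (\int[mu]_(x in D) f x)%:C%C.
Proof.
apply: complex_eqP => //=.
by rewrite /Rintegral integral0.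
Qed.

Lemma RintegralN (D : set R) (f : R -> R) : measurable D ->
  mu.-integrable D (fun x => (f x)%:E) ->
  \int[mu]_(x in D) - f x = - \int[mu]_(x in D) f x.
Proof.
by move=> mD fi; under eq_Rintegral do rewrite -mulN1r; rewrite RintegralZl // mulN1r.
Qed.

Lemma cintJ (D : set R) (phi : R -> C) : measurable D -> cintble D phi ->
  cint D (fun x => ((phi x)^*)%C) = ((cint D phi)^*)%C.
Proof.
move=> mD [a b]; apply: complex_eqP; rewrite ?ReJ ?ImJ /=.
  by under eq_Rintegral do rewrite ReJ.
by under eq_Rintegral do rewrite ImJ; rewrite RintegralN.
Qed.

Lemma cint_expi (c d : R) : c <= d -> cint `[c, d] (fun t => 'i%C * expi t) = expi d - expi c.
Proof.
move=> cd; apply: complex_eqP.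
  rewrite ReB /=; under eq_Rintegral do rewrite mul0r mul1r sub0r.
  by apply: FTC_cont => // x; apply: continuousN; exact: continuous_sin.
rewrite ImB /=; under eq_Rintegral do rewrite mul0r mul1r add0r.
by apply: FTC_cont => // x; exact: continuous_cos.
Qed.

End IntegralExtras.

(** * Cauchy's formula up to the winding integral *)

Section Cauchy.
Context {R : realType}.
Local Notation C := R[i].
Local Notation mu := (@lebesgue_measure R).
Variable z : C.
Hypothesis z1 : cmod z < 1.

(* [P] contracts the unit circle ([u = 0]) onto [z] ([u -> +oo]).  The form
   d zeta / (zeta - z) pulls back along [P] to [kA u] du + [kB t] dt, whose
   coefficients are separated: Goursat on rectangles of the (u, t)-plane then
   only needs one-dimensional integrals. *)
Let g (u : R) : R := (1 + u ^+ 2)^-1.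
Let P u t : C := z + (g u)%:C%C * (expi t - z).
Let kB t : C := 'i%C * expi t / (expi t - z).
Let kA u : C := (- 2 * u * g u)%:C%C.

Let one_sqr_gt0 (u : R) : 0 < 1 + u ^+ 2.
Proof. by rewrite ltr_pwDl // sqr_ge0. Qed.

Let g_gt0 u : 0 < g u. Proof. by rewrite invr_gt0. Qed.
Let g_le1 u : g u <= 1.
Proof. by rewrite invf_le1 // lerDl sqr_ge0. Qed.

Let kA_le1 u : cmod (kA u) <= 1.
Proof.
rewrite cmodR !normrM (gtr0_norm (g_gt0 u)) ler_pdivrMr // mul1r normrN.
rewrite normr_nat.
have -> : u ^+ 2 = `|u| ^+ 2 by rewrite real_normK ?num_real.
rewrite -subr_ge0.
by rewrite (_ : _ - _ = (`|u| - 1) ^+ 2) ?sqr_ge0 //; ring.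
Qed.

Let g_lip u v : `|g u - g v| <= `|u - v|.
Proof.
have a := one_sqr_gt0 u; have b := one_sqr_gt0 v.
have -> : g u - g v = (u - v) * (- (u + v) / ((1 + u ^+ 2) * (1 + v ^+ 2))).
  by rewrite /g; field; rewrite !gt_eqF.
rewrite normrM ler_piMr // normrM normrN normfV (gtr0_norm (mulr_gt0 a b)).
rewrite ler_pdivrMr ?mulr_gt0 // mul1r (le_trans (ler_normD _ _)) //.
have -> : u ^+ 2 = `|u| ^+ 2 by rewrite real_normK ?num_real.
have -> : v ^+ 2 = `|v| ^+ 2 by rewrite real_normK ?num_real.
set x := `|u|; set y := `|v|; have x0 : 0 <= x := normr_ge0 _; have y0 : 0 <= y := normr_ge0 _.
have := sqr_ge0 (x - 2^-1); have := sqr_ge0 (y - 2^-1).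
have := mulr_ge0 (sqr_ge0 x) (sqr_ge0 y); rewrite !expr2; nra.
Qed.

Let cont_g : continuous g.
Proof.
apply: continuousP_eps => x e e0; exists e => // y ye.
by rewrite (le_lt_trans (g_lip _ _)).
Qed.

Let dist_ge t : 1 - cmod z <= cmod (expi t - z).
Proof. by rewrite -(cmod_expi t) cmodBD. Qed.

Let dist_gt0 t : 0 < cmod (expi t - z).
Proof. by rewrite (lt_le_trans _ (dist_ge t)) // subr_gt0. Qed.

Let dist_neq0 t : expi t - z != 0.
Proof. by rewrite -cmod_gt0. Qed.

Let kB_le t : cmod (kB t) <= (1 - cmod z)^-1.
Proof.
rewrite /kB !cmodM cmod_expi mulr1 cmodV /cmod /= expr0n expr1n /= add0r sqrtr1 mul1r.
by rewrite lef_pV2 ?posrE ?dist_ge ?dist_gt0 // subr_gt0.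
Qed.

Let P_le1 u t : cmod (P u t) <= 1.
Proof.
have -> : P u t = (1 - g u)%:C%C * z + (g u)%:C%C * expi t.
  by rewrite /P rmorphB /= rmorph1; ring.
rewrite (le_trans (cmodD _ _)) // !cmodM !cmodR cmod_expi mulr1.
rewrite (ger0_norm (ltW (g_gt0 u))) ger0_norm ?subr_ge0 ?g_le1 // -lerBrDr.
by rewrite ler_piMr ?(ltW z1) // subr_ge0 g_le1.
Qed.

Let ccontP1 u : ccont (P u).
Proof.
apply: ccontD; first exact: ccont_cst.
apply: ccontM; first exact: ccont_cst.
by apply: ccontB; [exact: ccont_expi|exact: ccont_cst].
Qed.

Let ccontP2 t : ccont (P^~ t).
Proof.
apply: ccontD; first exact: ccont_cst.
by apply: ccontM; [exact: ccontR|exact: ccont_cst].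
Qed.

Let ccont_kB : ccont kB.
Proof.
apply: ccontM.
  by apply: ccontM; [exact: ccont_cst|exact: ccont_expi].
by apply: ccontV => //; apply: ccontB; [exact: ccont_expi|exact: ccont_cst].
Qed.

Let ccont_kA : ccont kA.
Proof.
apply: ccontR => u; apply: continuousM; last exact: cont_g.
by apply: continuousM; [exact: cst_continuous|].
Qed.

Let P_lip u t u0 t0 : cmod (P u t - P u0 t0) <= 2 * (`|u - u0| + `|t - t0|).
Proof.
have -> : P u t - P u0 t0 = (g u - g u0)%:C%C * (expi t - z) + (g u0)%:C%C * (expi t - expi t0).
  by rewrite /P rmorphB /=; ring.
rewrite (le_trans (cmodD _ _)) // [leRHS]mulrDr; apply: lerD.
  rewrite cmodM cmodR mulrC ler_pM ?cmod_ge0 ?normr_ge0 ?g_lip //.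
  by rewrite (le_trans (cmodD _ _)) // cmodN cmod_expi lerD2l (ltW z1).
rewrite cmodM cmodR (ger0_norm (ltW (g_gt0 u0))) (le_trans _ (expi_lipschitz _ _)) //.
by rewrite ler_piMl ?cmod_ge0 ?g_le1.
Qed.

Let sepc (psi : R -> R -> C) := (forall u, ccont (psi u)) /\ (forall t, ccont (psi^~ t)).

(** The counterclockwise boundary integral of psi (kA du + kB dt), with opposite sides of the
    rectangle combined. *)
Let Iof (psi : R -> R -> C) a b c d : C :=
  cint `[c, d] (fun t => (psi b t - psi a t) * kB t) -
  cint `[a, b] (fun u => (psi u d - psi u c) * kA u).

Let IofD psi chi a b c d : sepc psi -> sepc chi ->
  Iof (fun u t => psi u t + chi u t) a b c d = Iof psi a b c d + Iof chi a b c d.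
Proof.
move=> [p1 p2] [c1 c2]; rewrite /Iof.
have -> : forall x y v w : C, x - y + (v - w) = (x + v) - (y + w) by move=> *; ring.
rewrite -!cintD //; try by apply: ccont_cintble; apply: ccontM => //; exact: ccontB.
by congr (_ - _); apply: eq_cint => x _; ring.
Qed.

(** The 4 is the 2 of [cmod_cint_bound] times the 2 from a difference of two values; [kA], bounded
    by 1, is also bounded by 1 / (1 - |z|). *)
Let Iof_le psi a b c d M : sepc psi -> a <= b -> c <= d ->
  (forall u t, a <= u <= b -> c <= t <= d -> cmod (psi u t) <= M) ->
  cmod (Iof psi a b c d) <= 4 * M / (1 - cmod z) * (b - a + (d - c)).
Proof.
move=> [p1 p2] ab cd HM.
have M0 : 0 <= M by apply: le_trans (HM a c _ _); rewrite ?cmod_ge0 ?lexx.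
have z1' : 0 < 1 - cmod z by rewrite subr_gt0.
have H2 u t u' t' : a <= u <= b -> c <= t <= d -> a <= u' <= b -> c <= t' <= d ->
    cmod (psi u t - psi u' t') <= 2 * M.
  move=> h1 h2 h3 h4; rewrite (le_trans (cmodD _ _)) // cmodN mulr_natl mulr2n.
  by apply: lerD; exact: HM.
rewrite /Iof (le_trans (cmodD _ _)) // cmodN addrC mulrDr; apply: lerD.
  rewrite (@le_trans _ _ (2 * (2 * M / (1 - cmod z)) * (b - a))) //; last first.
    by rewrite !mulrA -natrM.
  apply: cmod_cint_bound => //.
    by apply: ccont_cintble; apply: ccontM => //; exact: ccontB.
  move=> u hu; rewrite cmodM (@le_trans _ _ (2 * M * 1)) //.
    by rewrite ler_pM ?cmod_ge0 ?kA_le1 // H2 ?lexx ?cd.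
  by rewrite ler_wpM2l ?mulr_ge0 // invf_ge1 // lerBlDr lerDl cmod_ge0.
rewrite (@le_trans _ _ (2 * (2 * M / (1 - cmod z)) * (d - c))) //; last first.
  by rewrite !mulrA -natrM.
apply: cmod_cint_bound => //.
  by apply: ccont_cintble; apply: ccontM => //; exact: ccontB.
move=> t ht; rewrite cmodM ler_pM ?cmod_ge0 ?kB_le // H2 ?lexx ?ab //.
Qed.

Let is_derive_g u : is_derive u (1 : R) g (- 2 * u * g u ^+ 2).
Proof.
have h : is_derive u (1 : R) (fun x : R => 1 + x ^+ 2) (2 * u).
  by apply: is_derive_eq; rewrite add0r /GRing.scale /=; ring.
have H := is_deriveV (f := fun x : R => 1 + x ^+ 2) (lt0r_neq0 (one_sqr_gt0 u)) h.
apply: (is_derive_eq (f := g) H).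
by rewrite /g /GRing.scale /= -exprVn; ring.
Qed.

(** The constant cancels between opposite sides. For c1 (P - z), both pairs of sides give c1 (g b -
    g a) (expi d - expi c): on one the denominator of [kB] cancels, on the other [g * kA] is the
    derivative of [g]. *)
Let Iof_affine c0 c1 a b c d : a <= b -> c <= d ->
  Iof (fun u t => c0 + c1 * (P u t - z)) a b c d = 0.
Proof.
move=> ab cd; rewrite /Iof.
rewrite (@eq_cint _ _ _ (fun t => (c1 * (g b - g a)%:C%C) * ('i%C * expi t))); last first.
  move=> t _; rewrite /P /kB rmorphB /=; field; exact: dist_neq0.
rewrite (@eq_cint _ _ (fun u => _ * kA u)
    (fun u => (c1 * (expi d - expi c)) * ((- 2 * u * g u ^+ 2)%:C)%C)); last first.
  by move=> u _; rewrite /P /kA expr2 !rmorphM /=; ring.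
have cg2 : continuous (fun u : R => - 2 * u * g u ^+ 2).
  rewrite (_ : (fun u : R => _) = (fun u => (- 2 * u) * (g u * g u))); last first.
    by apply/funext => u; rewrite expr2.
  move=> u; apply: continuousM; first by apply: continuousM; [exact: cst_continuous|].
  by apply: continuousM; exact: cont_g.
rewrite cintZ //; last first.
  by apply: ccont_cintble; apply: ccontM; [exact: ccont_cst|exact: ccont_expi].
rewrite [X in _ - X]cintZ //; last exact: (ccont_cintble _ _ (ccontR _)).
have E := @FTC_cont _ (fun u => - 2 * u * g u ^+ 2) g a b ab cg2 is_derive_g.
by rewrite cintR cint_expi // E rmorphB /=; ring.
Qed.

Variable q : Cplx R -> Cplx R.
Hypothesis Hq : forall u : C, cmod u <= 1 -> derivable q u 1.

Let psi u t : C := q (P u t).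

Let sepc_psi : sepc psi.
Proof.
by split=> [u|t]; apply: (ccont_comp (D := [set u | cmod u <= 1])) => // x; exact: P_le1.
Qed.

Let Iof0 a b c d : a <= b -> c <= d -> Iof psi a b c d = 0.
Proof.
move=> ab cd; apply: goursat_rectangle => //.
- move=> {ab cd}{}a m {}b {}c {}d am mb cd; rewrite /Iof.
  rewrite (@cint_split _ _ a m b) //; last first.
    by apply: ccontM => //; apply: ccontB; apply: sepc_psi.2.
  rewrite (@eq_cint _ _ _ (fun t => (psi m t - psi a t) * kB t + (psi b t - psi m t) * kB t)); last first.
    by move=> t _; ring.
  rewrite cintD //; try by apply: ccont_cintble; apply: ccontM => //; apply: ccontB; apply: sepc_psi.1.
  ring.
- move=> {ab cd}{}a {}b {}c m {}d ab cm md; rewrite /Iof.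
  rewrite (@cint_split _ _ c m d) //; last first.
    by apply: ccontM => //; apply: ccontB; apply: sepc_psi.1.
  rewrite (@eq_cint _ _ (fun u => (psi u d - psi u c) * kA u)
     (fun t => (psi t m - psi t c) * kA t + (psi t d - psi t m) * kA t)); last first.
    by move=> t _; ring.
  rewrite cintD //; try by apply: ccont_cintble; apply: ccontM => //; apply: ccontB; apply: sepc_psi.2.
  ring.
move=> u0 t0 e _ _ _ _ e0.
have z1' : 0 < 1 - cmod z by rewrite subr_gt0.
(* The 8 is the constant 4 of [Iof_le] times the Lipschitz constant 2 of [P]. *)
pose e' := e * (1 - cmod z) / 8.
have e'0 : 0 < e' by rewrite divr_gt0 ?mulr_gt0.
have [h h0 Hh] := derivable_cder (Hq (P_le1 u0 t0)) e'0.
(* Both sides below h / 4 give 2 s < h, so the whole rectangle is mapped into the ball where the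
   expansion of [q] holds. *)
exists (h / 4); first by rewrite divr_gt0.
move=> {ab cd}{}a {}b {}c {}d au ub ct td bah dch.
have ab := le_trans au ub; have cd := le_trans ct td.
set dq := derive1 q (P u0 t0) in Hh.
pose c0 := q (P u0 t0) - dq * (P u0 t0 - z) : C.
pose rem u t : C := psi u t - (c0 + dq * (P u t - z)).
have sA : sepc (fun u t => c0 + dq * (P u t - z)).
  by split=> [u|t]; (apply: ccontD; first exact: ccont_cst);
    (apply: ccontM; first exact: ccont_cst); apply: ccontB => //; exact: ccont_cst.
have sR : sepc rem.
  by split=> [u|t]; apply: ccontB; [exact: sepc_psi.1|exact: sA.1|exact: sepc_psi.2|exact: sA.2].
have -> : Iof psi a b c d = Iof (fun u t => (c0 + dq * (P u t - z)) + rem u t) a b c d.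
  rewrite /Iof; congr (_ - _); apply: eq_cint => x _; rewrite /rem; ring.
rewrite IofD // Iof_affine // add0r.
set s := b - a + (d - c).
have := @Iof_le rem a b c d (e' * (2 * s)) sR ab cd.
rewrite (_ : 4 * (e' * (2 * s)) / (1 - cmod z) * (b - a + (d - c)) = e * s ^+ 2); last first.
  by rewrite /e' -/s; field; rewrite gt_eqF.
apply=> u t /andP[au' ub'] /andP[ct' td'].
have Pd : cmod (P u t - P u0 t0) <= 2 * s.
  rewrite (le_trans (P_lip _ _ _ _)) // ler_wpM2l // /s.
  by apply: lerD; rewrite ler_norml; apply/andP; split; lra.
have -> : rem u t = q (P u t) - q (P u0 t0) - dq * (P u t - P u0 t0).
  by rewrite /rem /psi /c0; ring.
apply: (@le_trans _ _ (e' * cmod (P u t - P u0 t0))); last by rewrite ler_wpM2l // ltW.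
apply: Hh; rewrite (le_lt_trans Pd) // /s; lra.
Qed.

(** The boundary integral over [0, U] x [0, 2 pi] vanishes, and the sides t = 0 and t = 2 pi cancel
    by periodicity. What remains equates the integral over the unit circle (u = 0) with one over a
    small curve around z (u = U), where [q] is nearly q z. As [g] never vanishes, the singularity z
    is not reached. *)
Lemma cauchy_formula_winding : cint `[0, 2 * pi] (fun t => q (expi t) * (expi t / (expi t - z))) =
  q z * cint `[0, 2 * pi] (fun t => expi t / (expi t - z)).
Proof.
have pi0 : 0 <= 2 * pi :> R by rewrite mulr_ge0 // pi_ge0.
have z1' : 0 < 1 - cmod z by rewrite subr_gt0.
suff H : cint `[0, 2 * pi] (fun t => q (expi t) * kB t) = q z * cint `[0, 2 * pi] kB.
  have i0 : 'i%C != 0 :> C by rewrite eq_complex /= oner_eq0 andbF.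
  have ck : ccont (fun t : R => expi t / (expi t - z)).
    apply: ccontM; first exact: ccont_expi.
    by apply: ccontV => //; apply: ccontB; [exact: ccont_expi|exact: ccont_cst].
  have cq : ccont (fun t : R => q (expi t) * (expi t / (expi t - z))).
    apply: ccontM => //; apply: (ccont_comp (D := [set u | cmod u <= 1])) => //; last exact: ccont_expi.
    by move=> x; exact: cmod_expi_le1.
  have E1 : 'i%C * cint `[0, 2 * pi] (fun t : R => expi t / (expi t - z)) = cint `[0, 2 * pi] kB.
    rewrite -cintZ //; last exact: ccont_cintble.
    by apply: eq_cint => t _; rewrite /kB mulrA.
  apply: (mulfI i0); rewrite mulrCA E1 -H -cintZ //; last exact: ccont_cintble.
  by apply: eq_cint => t _; rewrite /kB; ring.
have cqe : ccont (fun t : R => q (expi t)).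
  apply: (ccont_comp (D := [set u | cmod u <= 1])) => //; last exact: ccont_expi.
  by move=> x; exact: cmod_expi_le1.
have I1 : cintble `[0, 2 * pi] (fun t => q (expi t) * kB t).
  by apply: ccont_cintble; exact: ccontM.
have I2 : cintble `[0, 2 * pi] (fun t => q z * kB t).
  by apply: ccont_cintble; apply: ccontM => //; exact: ccont_cst.
rewrite -cintZ //; last exact: ccont_cintble.
apply/eqP; rewrite -subr_eq0 -cintB // -cmod_eq0; apply/negPn/negP => N0.
set N := cmod _ in N0.
have {}N0 : 0 < N by rewrite lt_def N0 cmod_ge0.
(* [K] exceeds the constant of the final bound N <= 2 (e / (1 - |z|)) 2 pi, which for e = N / K
   would then give N < N. *)
pose K := 2 * (2 / (1 - cmod z)) * (2 * pi) + 1.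
have K0 : 0 < K.
  by rewrite /K ltr_wpDl // !mulr_ge0 // ?invr_ge0 ?pi_ge0 // ltW.
pose e := N / K.
have e0 : 0 < e by rewrite divr_gt0.
have [h h0 Hh] := derivable_cont (Hq (ltW z1)) e0.
(* The curve [P U] stays within 2 g(U) of z, and 2 g(2 / h) < h. *)
pose U := 2 / h.
have U0 : 0 < U by rewrite divr_gt0.
have gU : g U * 2 < h.
  rewrite /g mulrC ltr_pdivrMr // -ltr_pdivrMl // mulrC -/U.
  by have := sqr_ge0 (U - 2^-1); rewrite !expr2; lra.
have PU t : cmod (q (P U t) - q z) <= e.
  apply/ltW/Hh; rewrite /P addrC addKr cmodM cmodR gtr0_norm // (le_lt_trans _ gU) //.
  rewrite ler_wpM2l ?(ltW (g_gt0 U)) // (le_trans (cmodD _ _)) // cmodN cmod_expi.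
  by rewrite lerD2l ltW.
have := @Iof0 0 U 0 (2 * pi) (ltW U0) pi0.
rewrite /Iof [X in _ - X](_ : _ = 0); last first.
  rewrite (@eq_cint _ _ _ (fun=> 0 * 0)).
    by rewrite cintZ ?mul0r //; apply: ccont_cintble; exact: ccont_cst.
  by move=> u _; rewrite /psi /P expi2pi expi0 subrr mul0r mulr0.
rewrite subr0 => E.
have : N <= 2 * (e / (1 - cmod z)) * (2 * pi - 0).
  have -> : N = cmod (cint `[0, 2 * pi] (fun t => (psi U t - q z) * kB t)).
    congr cmod; rewrite -[LHS]add0r -E -cintD //; last 2 first.
    - by apply: ccont_cintble; apply: ccontM => //; apply: ccontB; exact: sepc_psi.1.
    - exact: cintbleB.
    apply: eq_cint => t _.
    have e1 : psi 0 t = q (expi t).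
      by rewrite /psi /P /g expr0n addr0 invr1 mul1r addrC subrK.
    by rewrite -mulrBl -mulrDl e1 addrA subrK.
  apply: cmod_cint_bound => //.
    apply: ccont_cintble; apply: ccontM => //; apply: ccontB; last exact: ccont_cst.
    exact: sepc_psi.1.
  move=> t _; rewrite cmodM ler_pM ?cmod_ge0 ?kB_le //; exact: PU.
apply/negP; rewrite -ltNge subr0.
have -> : 2 * (e / (1 - cmod z)) * (2 * pi) = N * ((K - 1) / 2 / K).
  have -> : K - 1 = 2 * (2 / (1 - cmod z)) * (2 * pi) by rewrite addrK.
  by rewrite /e; field; rewrite !lt0r_neq0.
rewrite gtr_pMr // ltr_pdivrMr //; lra.
Qed.

End Cauchy.

(** * Mean value property, Cauchy and Poisson formulas on the closed disk *)

Section CauchyPoisson.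
Context {R : realType}.
Local Notation C := R[i].
Implicit Types (q : Cplx R -> Cplx R) (z : C).

Lemma mean_value q : (forall u : C, cmod u <= 1 -> derivable q u 1) ->
  cint `[0, 2 * pi] (fun t => q (expi t)) = (2 * pi)%:C%C * q 0.
Proof.
move=> Hq; have z0 : cmod (0 : C) < 1 by rewrite cmod0.
have := cauchy_formula_winding z0 Hq.
rewrite (@eq_cint _ _ (fun t => expi t / (expi t - 0)) (fun=> (1:R)%:C%C)); last first.
  by move=> t _; rewrite subr0 mulfV ?expi_neq0.
rewrite cintR Rint_cst ?mulr_ge0 ?pi_ge0 // mul1r subr0 [RHS]mulrC => <-.
by apply: eq_cint => t _; rewrite subr0 mulfV ?expi_neq0 // mulr1.
Qed.

Lemma conjcB z u : conjc (z - u) = conjc z - conjc u.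
Proof. exact: rmorphB. Qed.

Lemma conjcM z u : conjc (z * u) = conjc z * conjc u.
Proof. exact: rmorphM. Qed.

Lemma expi_conj (t : R) : ((expi t)^*)%C = (expi t)^-1 :> C.
Proof. by rewrite -[LHS]mul1r -(mulVf (expi_neq0 t)) -mulrA expiJ mulr1. Qed.

Lemma unit_sub_neq0 z t : cmod z < 1 -> expi t - z != 0.
Proof.
by move=> z1; rewrite -cmod_gt0 (lt_le_trans _ (cmodBD _ _)) // cmod_expi subr_gt0.
Qed.

Lemma one_sub_neq0 z u : cmod z < 1 -> cmod u <= 1 -> 1 - z * u != 0.
Proof.
move=> z1 u1; rewrite -cmod_gt0 (lt_le_trans _ (cmodBD _ _)) // cmod1 cmodM subr_gt0.
by rewrite (le_lt_trans _ z1) // ler_piMr ?cmod_ge0.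
Qed.

Lemma derivable_cauchy_kernel (z u : Cplx R) : cmod z < 1 -> cmod u <= 1 ->
  derivable (fun u : Cplx R => (1 - z * u)^-1 : Cplx R) u 1.
Proof.
move=> z1 u1; apply: derivableV; first exact: one_sub_neq0.
by apply: derivableB => //; exact: derivableM.
Qed.

Lemma cauchy_formula q z : cmod z < 1 -> (forall u : C, cmod u <= 1 -> derivable q u 1) ->
  cint `[0, 2 * pi] (fun t => q (expi t) * (expi t / (expi t - z))) = (2 * pi)%:C%C * q z.
Proof.
move=> z1 Hq; rewrite cauchy_formula_winding // mulrC; congr (_ * _).
have zJ : cmod (z^*)%C < 1 by rewrite cmodJ.
have cK : ccont (fun t : R => (1 - (z^*)%C * expi t)^-1).
  apply: ccontV; last by move=> t; apply: one_sub_neq0; rewrite ?cmod_expi.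
  apply: ccontB; first exact: ccont_cst.
  by apply: ccontM; [exact: ccont_cst|exact: ccont_expi].
(* The winding integral is the conjugate of the mean of 1 / (1 - z^* e). *)
have := @mean_value _ (fun u => derivable_cauchy_kernel (u := u) zJ).
rewrite mulr0 subr0 invr1 mulr1 => /(congr1 conjc).
rewrite -cintJ //; last exact: ccont_cintble.
rewrite conjc_real => <-; apply: eq_cint => t _.
rewrite conjc_inv conjcB conjcM conjc1 conjcK.
rewrite expi_conj; field.
by rewrite expi_neq0 (unit_sub_neq0 _ z1).
Qed.

Definition poisson z t : R := (1 - cmod z ^+ 2) / cmod (expi t - z) ^+ 2.

Lemma poissonE z t :
  (poisson z t)%:C%C = (1 - z * conjc z) / ((expi t - z) * conjc (expi t - z)).
Proof. by rewrite !mulcJ /poisson fmorph_div rmorphB rmorph1. Qed.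

(** On the circle the Poisson kernel is e / (e - z) + z' e / (1 - z' e), with z' the conjugate of z.
    The first term is Cauchy's kernel; the second times [q] is [q2], which is analytic on the closed
    disk and vanishes at 0, so its mean is zero. *)
Lemma poisson_formula q z : cmod z < 1 -> (forall u : C, cmod u <= 1 -> derivable q u 1) ->
  cint `[0, 2 * pi] (fun t => (poisson z t)%:C%C * q (expi t)) = (2 * pi)%:C%C * q z.
Proof.
move=> z1 Hq; have zJ : cmod (z^*)%C < 1 by rewrite cmodJ.
have cqe : ccont (fun t : R => q (expi t)).
  apply: (ccont_comp (D := [set u | cmod u <= 1])) => //; last exact: ccont_expi.
  by move=> x; exact: cmod_expi_le1.
have d0 t : expi t - z != 0 by exact: unit_sub_neq0.
have ce := @ccont_expi R.
have cz w : ccont (fun _ : R => w : C) by exact: ccont_cst.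
have k0 t : 1 - (z^*)%C * expi t != 0 by apply: one_sub_neq0; rewrite ?cmod_expi.
pose q2 u : Cplx R := q u * ((z^*)%C * u * (1 - (z^*)%C * u)^-1).
have H2 u : cmod u <= 1 -> derivable q2 u 1.
  move=> u1; apply: derivableM; first exact: Hq.
  apply: derivableM; last exact: derivable_cauchy_kernel.
  exact: derivableM.
have := mean_value H2; rewrite {2}/q2 !(mulr0, mul0r) => E2.
rewrite -cauchy_formula // -[RHS]addr0 -E2 -cintD //; last 2 first.
- apply: ccont_cintble; apply: ccontM => //; apply: ccontM => //.
  by apply: ccontV => //; exact: ccontB.
- apply: ccont_cintble; apply: ccontM => //; apply: ccontM.
    by apply: ccontM.
  by apply: ccontV => //; apply: ccontB => //; exact: ccontM.
apply: eq_cint => t _; rewrite mulrC -mulrDr; congr (_ * _).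
rewrite poissonE conjcB.
rewrite expi_conj; field.
by rewrite expi_neq0 d0 k0.
Qed.

End CauchyPoisson.

(** * Radial limits in L2 *)

Arguments expi : simpl never.
Arguments cmod : simpl never.

Section L2Contraction.
Context {R : realType}.
Local Notation C := R[i].
Local Notation mu := (@lebesgue_measure R).
Local Notation T := (`[0, 2 * pi]%classic : set R).

Lemma two_pi_ge0 : 0 <= 2 * pi :> R. Proof. by rewrite mulr_ge0 // pi_ge0. Qed.

Lemma conjcX (z : C) n : conjc (z ^+ n) = conjc z ^+ n.
Proof. exact: rmorphXn. Qed.

Lemma conjcD (z u : C) : conjc (z + u) = conjc z + conjc u.
Proof. exact: rmorphD. Qed.

Lemma geometric_le0 (x c r : R) n0 : 0 <= r -> r < 1 ->
  (forall n, (n0 <= n)%N -> x <= c * r ^+ n) -> x <= 0.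
Proof.
move=> r0 r1 H; rewrite leNgt; apply/negP => x0.
have : (c * r ^+ n) @[n --> \oo] --> c * 0.
  by apply: cvgMr; apply: cvg_expr; rewrite ger0_norm.
rewrite mulr0 => /cvgrPdist_lt/(_ _ x0)[N _ /(_ (maxn n0 N))] /=.
rewrite leq_maxr sub0r normrN => /(_ isT); apply/negP; rewrite -leNgt.
by rewrite (le_trans (H _ (leq_maxl _ N))) // ler_norm.
Qed.

Lemma ccont_bounded (phi : R -> C) : ccont phi ->
  exists2 M, 0 <= M & forall t, T t -> cmod (phi t) <= M.
Proof.
move=> /ccont_cmod cc; have [c _ H] := EVT_max two_pi_ge0 (continuous_subspaceT cc).
by exists (cmod (phi c)); [exact: cmod_ge0|move=> t /= /H].
Qed.

Lemma ccont_exp n : ccont (fun t : R => expi t ^+ n).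
Proof. exact/ccontX/ccont_expi. Qed.

Lemma ccont_expJ n : ccont (fun t : R => (conjc (expi t : C)) ^+ n).
Proof. exact/ccontX/ccontJ/ccont_expi. Qed.

Lemma derivable_exp k (u : Cplx R) : derivable (fun v : Cplx R => (v : C) ^+ k : Cplx R) u 1.
Proof.
elim: k => [|k IH]; first by under eq_fun do rewrite expr0; exact: derivable_cst.
have -> : (fun v : Cplx R => (v : C) ^+ k.+1 : Cplx R) =
    (fun v : Cplx R => v * (v : C) ^+ k : Cplx R).
  by apply/funext => v; rewrite exprS.
have I : derivable (fun v : Cplx R => v) u 1 by exact: derivable_id.
exact: (@derivableM _ _ (fun v : Cplx R => v) (fun v : Cplx R => (v : C) ^+ k : Cplx R) u 1 I IH).
Qed.

Lemma cint_expi_orth m n :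
  cint T (fun t => expi t ^+ m * (conjc (expi t)) ^+ n) = ((2 * pi) *+ (m == n))%:C%C :> C.
Proof.
have mono k : cint T (fun t => expi t ^+ k) = ((2 * pi) *+ (k == 0%N))%:C%C :> C.
  have E : cint T (fun t => expi t ^+ k) = (2 * pi)%:C%C * (0 ^+ k) :> C.
    have dk (u : C) : cmod u <= 1 -> derivable (fun v : Cplx R => (v : C) ^+ k : Cplx R) u 1.
      by move=> _; exact: derivable_exp.
    have E := mean_value dk; exact: E.
  by rewrite E expr0n; case: (k == 0%N) => /=; rewrite ?mulr1 ?mulr0.
have shift m' k : cint T (fun t => expi t ^+ (k + m') * (conjc (expi t)) ^+ m') =
    cint T (fun t => expi t ^+ k) :> C.
  by apply: eq_cint => t _; rewrite exprD -mulrA -exprMn expiJ expr1n mulr1.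
case: (leqP n m) => [nm|/ltnW mn].
  have -> : (m == n) = (m - n == 0)%N by rewrite subn_eq0 eqn_leq nm andbT.
  by rewrite -mono -(shift n) subnK.
have -> : (m == n) = (n - m == 0)%N by rewrite subn_eq0 eqn_leq mn.
rewrite -[RHS]conjc_real -mono -(shift m).
rewrite -cintJ //; last by apply: ccont_cintble; apply: ccontM; [exact: ccont_exp|exact: ccont_expJ].
apply: eq_cint => t _.
by rewrite conjcM !conjcX subnK // conjcK mulrC.
Qed.

Variable f : Cplx R -> Cplx R.
Hypothesis Hf : forall u : C, cmod u <= 1 -> derivable f u 1.
Variable rho : R.
Hypothesis rho0 : 0 <= rho.
Hypothesis rho1 : rho < 1.

Let rc : C := rho%:C%C.
Let tp : C := (2 * pi)%:C%C.
Let phi (t : R) : C := f (expi t).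
Let chi (t : R) : C := f (rc * expi t).
Let a n : C := cint T (fun t => phi t * conjc (expi t) ^+ n) / tp.

Let pi0 : tp != 0 :> C.
Proof. by rewrite /tp eq_complex /= eqxx andbT gt_eqF // mulr_gt0 ?pi_gt0. Qed.

Let cphi : ccont phi.
Proof.
apply: (ccont_comp (D := [set u | cmod u <= 1])) => //; last exact: ccont_expi.
by move=> x; exact: cmod_expi_le1.
Qed.

Let rcE t : cmod (rc * expi t) = rho.
Proof. by rewrite cmodM cmod_expi mulr1 cmodR ger0_norm. Qed.

Let cchi : ccont chi.
Proof.
apply: (ccont_comp (D := [set u | cmod u <= 1])) => //.
  by move=> x /=; rewrite rcE ltW.
by apply: ccontM; [exact: ccont_cst|exact: ccont_expi].
Qed.

Let p N t : C := \sum_(n < N) a n * rc ^+ n * expi t ^+ n.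

Let cp N : ccont (p N).
Proof.
elim: N => [|N IH]; first by rewrite /p; under eq_fun do rewrite big_ord0; exact: ccont_cst.
rewrite /p; under eq_fun do rewrite big_ord_recr /=.
by apply: ccontD => //; apply: ccontM; [exact: ccont_cst|exact: ccont_exp].
Qed.

(** [Tl N z] is Cauchy's integral with an extra factor e^(-N). Since e / (e - z) = 1 + z / (e - z),
    it equals 2 pi a_N + z Tl (N + 1): each step peels off one Taylor term, and the rest is z^N Tl N
    / (2 pi) with |z| = rho. *)
Let taylor_rest : exists2 K : R, 0 <= K &
  forall N t, cmod (chi t - p N t) <= K * rho ^+ N.
Proof.
pose Tl N z := cint T (fun s => phi s * conjc (expi s) ^+ N * (expi s / (expi s - z))).
have [M M0 HM] := ccont_bounded cphi.
have ck z N : cmod z < 1 -> ccont (fun s => phi s * conjc (expi s) ^+ N * (expi s / (expi s - z))).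
  move=> z1; apply: ccontM; first by apply: ccontM => //; exact: ccont_expJ.
  apply: ccontM; first exact: ccont_expi.
  apply: ccontV; last by move=> t; exact: unit_sub_neq0.
  by apply: ccontB; [exact: ccont_expi|exact: ccont_cst].
have rec z N : cmod z < 1 -> Tl N z = tp * a N + z * Tl N.+1 z.
  move=> z1; rewrite /a mulrCA mulfV // mulr1 /Tl -cintZ //; last exact/ccont_cintble/ck.
  rewrite -cintD //; last 2 first.
  - by apply: ccont_cintble; apply: ccontM => //; exact: ccont_expJ.
  - by apply: cintbleZ => //; exact/ccont_cintble/ck.
  apply: eq_cint => s _; rewrite exprS expi_conj; field.
  by rewrite expi_neq0 unit_sub_neq0.
have Kge0 : 0 <= M / (1 - rho) by rewrite divr_ge0 // subr_ge0 ltW.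
exists (2 * (M / (1 - rho))); first by rewrite mulr_ge0.
move=> N t; set z := rc * expi t.
have z1 : cmod z < 1 by rewrite rcE.
have -> : chi t - p N t = z ^+ N * (Tl N z / tp).
  elim: N => [|N IH].
    rewrite /p big_ord0 subr0 expr0 mul1r; apply: (mulIf pi0); rewrite divfK // mulrC.
    rewrite -[tp]/((2 * pi)%:C%C : C) -(cauchy_formula z1 Hf); apply: eq_cint => s _.
    by rewrite expr0 mulr1.
  rewrite /p big_ord_recr /= opprD addrA IH rec // /z !exprMn !exprS.
  by move: pi0; generalize tp => v v0; field.
rewrite cmodM cmodX rcE mulrC ler_wpM2r ?exprn_ge0 // cmodM cmodV cmodR.
rewrite ger0_norm ?two_pi_ge0 // ler_pdivrMr ?mulr_gt0 ?pi_gt0 //.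
rewrite -[X in _ <= _ * X]subr0 -mulrA mulrA; apply: cmod_cint_bound; first exact: two_pi_ge0.
  exact/ccont_cintble/ck.
move=> s sT; rewrite !cmodM cmodX cmodJ cmod_expi expr1n mulr1 mul1r cmodV.
rewrite ler_pM ?cmod_ge0 ?invr_ge0 ?cmod_ge0 ?HM //.
rewrite lef_pV2 ?posrE ?subr_gt0 ?cmod_gt0 ?unit_sub_neq0 //.
by rewrite -(rcE t) -(cmod_expi s) cmodBD.
Qed.

(** All partial sums past n have the same n-th coefficient, and they converge to [chi] uniformly at
    a geometric rate. *)
Let chi_coef n : cint T (fun t => chi t * conjc (expi t) ^+ n) = tp * (a n * rc ^+ n).
Proof.
have [K K0 HK] := taylor_rest.
have pc N : cint T (fun t => p N t * conjc (expi t) ^+ n) =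
    if (n < N)%N then tp * (a n * rc ^+ n) else 0.
  elim: N => [|N IH].
    rewrite ltn0 (@eq_cint _ _ _ (fun=> (0:R)%:C%C)) ?cintR ?Rint_cst ?two_pi_ge0 ?mul0r //.
    by move=> t _; rewrite /p big_ord0 mul0r.
  rewrite (@eq_cint _ _ _ (fun t => p N t * conjc (expi t) ^+ n +
      a N * rc ^+ N * (expi t ^+ N * conjc (expi t) ^+ n))); last first.
    by move=> t _; rewrite /p big_ord_recr /= mulrDl !mulrA.
  have cc : cintble T (fun t => expi t ^+ N * conjc (expi t) ^+ n : C).
    by apply: ccont_cintble; apply: ccontM; [exact: ccont_exp|exact: ccont_expJ].
  rewrite cintD //; last 2 first.
  - by apply: ccont_cintble; apply: ccontM => //; exact: ccont_expJ.
  - exact: cintbleZ.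
  rewrite cintZ // IH cint_expi_orth ltnS; case: ltngtP => [h|h|<-].
  - by rewrite mulr0n mulr0 addr0.
  - by rewrite mulr0n mulr0 addr0.
  - by rewrite mulr1n add0r mulrC.
apply/eqP; rewrite -subr_eq0 -cmod_eq0 eq_le cmod_ge0 andbT.
apply: (@geometric_le0 _ (2 * K * (2 * pi)) rho n.+1) => // N nN.
have := pc N; rewrite nN => <-; rewrite -cintB //; last 2 first.
- by apply: ccont_cintble; apply: ccontM => //; exact: ccont_expJ.
- by apply: ccont_cintble; apply: ccontM => //; exact: ccont_expJ.
rewrite mulrAC -[2 * K * _]mulrA -[X in _ <= _ * X]subr0; apply: cmod_cint_bound.
- exact: two_pi_ge0.
- apply: cintbleB => //; apply: ccont_cintble; apply: ccontM => //; exact: ccont_expJ.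
by move=> t _; rewrite -mulrBl cmodM cmodX cmodJ cmod_expi expr1n mulr1.
Qed.

(** Against a partial sum of [chi] the pairing is, by [chi_coef], a finite sum of nonnegative terms;
    the uniform rest then tends to zero. *)
Let re_ge0 : 0 <= complex.Re (cint T (fun t => (phi t - chi t) * conjc (chi t))).
Proof.
have [K K0 HK] := taylor_rest.
have cd : ccont (fun t => phi t - chi t) by exact: ccontB.
have pN N : 0 <= complex.Re (cint T (fun t => (phi t - chi t) * conjc (p N t))).
  elim: N => [|N IH].
    rewrite (@eq_cint _ _ _ (fun=> (0:R)%:C%C)) ?cintR ?Rint_cst ?two_pi_ge0 ?mul0r //.
    by move=> t _; rewrite /p big_ord0 conjc0 mulr0.
  have cN : cintble T (fun t => phi t * conjc (expi t) ^+ N).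
    by apply: ccont_cintble; apply: ccontM => //; exact: ccont_expJ.
  have cN' : cintble T (fun t => chi t * conjc (expi t) ^+ N).
    by apply: ccont_cintble; apply: ccontM => //; exact: ccont_expJ.
  rewrite (@eq_cint _ _ _ (fun t => (phi t - chi t) * conjc (p N t) +
      conjc (a N * rc ^+ N) * (phi t * conjc (expi t) ^+ N - chi t * conjc (expi t) ^+ N))); last first.
    move=> t _; rewrite /p big_ord_recr /= conjcD !conjcM (conjcX (expi t)).
    by move: (conjc (\sum_(i < N) _)) (conjc (rc ^+ N)) => ? ?; ring.
  rewrite cintD //; last 2 first.
  - by apply: ccont_cintble; apply: ccontM => //; exact: ccontJ.
  - by apply: cintbleZ => //; exact: cintbleB.
  rewrite ReD addr_ge0 // cintZ //; last exact: cintbleB.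
  rewrite cintB // chi_coef.
  have -> : cint T (fun t => phi t * conjc (expi t) ^+ N) = tp * a N.
    by rewrite /a mulrCA mulfV // mulr1.
  have -> : conjc (a N * rc ^+ N) * (tp * a N - tp * (a N * rc ^+ N)) =
      ((2 * pi) * (rho ^+ N * (1 - rho ^+ N)) * cmod (a N) ^+ 2)%:C%C.
    have -> : rc ^+ N = (rho ^+ N)%:C%C by rewrite /rc -rmorphXn.
    rewrite cmod_sqr /tp; move: (a N) (rho ^+ N) => [x y] r.
    by apply: complex_eqP => /=; ring.
  rewrite /= !mulr_ge0 ?two_pi_ge0 ?exprn_ge0 ?cmod_ge0 ?pi_ge0 //.
  by rewrite subr_ge0 exprn_ile1 // ltW.
have [M M0 HM] := ccont_bounded cd.
rewrite -oppr_le0.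
apply: (@geometric_le0 _ (2 * (M * K) * (2 * pi)) rho 0%N) => // N _.
rewrite (@eq_cint _ _ _ (fun t => (phi t - chi t) * conjc (p N t) +
   (phi t - chi t) * conjc (chi t - p N t))); last first.
  by move=> t _; rewrite conjcB; move: (conjc (p N t)) => ?; ring.
have c1 : cintble T (fun t => (phi t - chi t) * conjc (p N t)).
  by apply: ccont_cintble; apply: ccontM => //; exact: ccontJ.
have c2 : cintble T (fun t => (phi t - chi t) * conjc (chi t - p N t)).
  by apply: ccont_cintble; apply: ccontM => //; apply: ccontJ; exact: ccontB.
rewrite cintD // ReD opprD ler_wnDl // ?oppr_le0 //.
rewrite (le_trans (ler_norm _)) // normrN (le_trans (Re_le_cmod _)) //.
rewrite mulrAC -[2 * _ * _]mulrA -[X in _ <= _ * X]subr0; apply: cmod_cint_bound => //.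
  exact: two_pi_ge0.
move=> t tT; rewrite cmodM cmodJ -mulrA ler_pM ?cmod_ge0 //; exact: HM.
Qed.

(* The difference of the two sides is twice the real part of
   \int (f - f_rho) (f_rho)^* = 2 pi \sum (rho^n - rho^(2n)) |a_n|^2 >= 0. *)
Lemma L2_contraction :
  \int[mu]_(t in T) (cmod (f (expi t) - f (rho%:C%C * expi t)) ^+ 2) <=
  \int[mu]_(t in T) (cmod (f (expi t)) ^+ 2) -
  \int[mu]_(t in T) (cmod (f (rho%:C%C * expi t)) ^+ 2).
Proof.
have id_ t : cmod (phi t - chi t) ^+ 2 = cmod (phi t) ^+ 2 - cmod (chi t) ^+ 2 -
    2 * complex.Re ((phi t - chi t) * conjc (chi t)).
  by rewrite !cmod_sqr; case: (phi t) => x y; case: (chi t) => v w /=; ring.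
have ic (psi : R -> C) : ccont psi -> mu.-integrable T (fun t => (cmod (psi t) ^+ 2)%:E).
  by move=> h; apply: continuous_integrable; exact: ccont_sqr.
have [i3 _] : cintble T (fun t => (phi t - chi t) * conjc (chi t)).
  by apply: ccont_cintble; apply: ccontM; [exact: ccontB|exact: ccontJ].
rewrite -/(phi _); under eq_Rintegral do rewrite -/(phi _) -/(chi _) id_.
rewrite RintegralB //; last 2 first.
- by apply: (@integrableB _ _ _ mu T _ (EFin \o (fun t => cmod (phi t) ^+ 2)) (EFin \o (fun t => cmod (chi t) ^+ 2))) => //; exact: ic.
- exact: integrableZE.
rewrite RintegralB ?ic // RintegralZl // lerBlDr lerDl mulr_ge0 //.
Qed.

End L2Contraction.

Section FatouCorollary.
Context {R : realType}.
Local Notation mu := (@lebesgue_measure R).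
Variables (D : set R) (mD : measurable D).

Lemma fatou_le (g : nat -> R -> R) (h : R -> R) (c : R) :
  (forall n, measurable_fun D (g n)) -> measurable_fun D h ->
  (forall n x, D x -> 0 <= g n x) -> (forall x, D x -> 0 <= h x) ->
  {ae mu, forall x, D x -> g n x @[n --> \oo] --> h x} ->
  (\forall n \near \oo, (\int[mu]_(x in D) (g n x)%:E <= c%:E)%E) ->
  (\int[mu]_(x in D) (h x)%:E <= c%:E)%E.
Proof.
move=> mg mh g0 h0 gh gc.
have mg' n : measurable_fun D (EFin \o g n) by exact/measurable_EFinP.
have mh' : measurable_fun D (EFin \o h) by exact/measurable_EFinP.
have mli : measurable_fun D (fun x => limn_einf (fun n => (g n x)%:E)).
  rewrite (_ : (fun x => _) = -%E \o (fun x => limn_esup (fun n => (- g n x)%:E))) //.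
  apply: measurableT_comp => //.
  apply: (measurable_fun_limn_esup (f := fun n x => (- g n x)%:E)) => n.
  by apply/measurable_EFinP; exact: measurable_funN.
have gE0 n x : D x -> (0 <= (g n x)%:E)%E by move=> /g0 ?; rewrite lee_fin.
apply: (@le_trans _ _ (\int[mu]_(x in D) limn_einf (fun n => (g n x)%:E))%E).
  apply: ae_ge0_le_integral => //.
  - move=> x Dx; rewrite limn_einf_lim; apply: lime_ge; first exact: is_cvg_einfs.
    by apply: nearW => n; apply: le_ereal_inf_tmp => _ [m _ <-]; exact: gE0.
  - case: gh => A [mA A0 sA]; exists A; split => //.
    apply: subset_trans sA => x; apply: contra_not => H Dx.
    have /cvg_limn_einf_sup[-> _] // : (fun n => (g n x)%:E) @ \oo --> (h x)%:E.
    by apply: cvg_EFin; [exact: nearW|exact: H].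
apply: (le_trans (@fatou _ _ _ mu D mD (fun n x => (g n x)%:E) mg' gE0)).
rewrite limn_einf_lim; apply: lime_le; first exact: is_cvg_einfs.
case: gc => N _ HN; exists N => // n /= Nn.
by apply: (le_trans _ (HN n Nn)); apply: ereal_inf_lbound; exists n => /=.
Qed.

End FatouCorollary.

(** * Cauchy property of the dilations in L2 *)

Section RadialL2.
Context {R : realType}.
Local Notation C := R[i].
Local Notation mu := (@lebesgue_measure R).
Local Notation T := (`[0, 2 * pi]%classic : set R).
Variable f : Cplx R -> Cplx R.
Hypothesis Hf : holomorphic f.

Definition radial (r t : R) : C := f (r%:C%C * expi t).

Lemma radial_disk r t : 0 <= r -> r < 1 -> @disk R (r%:C%C * expi t).
Proof. by move=> r0 r1; rewrite /disk /= cmodM cmod_expi mulr1 cmodR ger0_norm. Qed.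

Lemma ccont_radial r : 0 <= r -> r < 1 -> ccont (radial r).
Proof.
move=> r0 r1; apply: (ccont_comp (D := @disk R)) => //.
  by move=> x; exact: radial_disk.
by apply: ccontM; [exact: ccont_cst|exact: ccont_expi].
Qed.

Lemma derivable_dilation r (u : C) : 0 <= r -> r < 1 -> cmod u <= 1 ->
  derivable (fun v : Cplx R => f (r%:C%C * v) : Cplx R) u 1.
Proof.
move=> r0 r1 u1; apply: derivable_scale; apply: Hf.
rewrite /disk /= cmodM cmodR ger0_norm //.
by rewrite (le_lt_trans _ r1) // ler_piMr.
Qed.

Let N r := \int[mu]_(t in T) (cmod (radial r t) ^+ 2).

(** This is [L2_contraction] for the dilation f(s z), which is differentiable on the closed disk,
    with ratio r / s. *)
Lemma radial_increment r s : 0 <= r -> r <= s -> s < 1 ->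
  \int[mu]_(t in T) (cmod (radial s t - radial r t) ^+ 2) <= N s - N r.
Proof.
move=> r0; rewrite le_eqVlt => /predU1P[-> _|rs s1].
  rewrite subrr; under eq_Rintegral do rewrite subrr cmod0 expr0n.
  by rewrite Rint_cst ?two_pi_ge0 // mul0r.
have s0 : 0 < s by exact: le_lt_trans rs.
have rs0 : 0 <= r / s by rewrite divr_ge0 // ltW.
have rs1 : r / s < 1 by rewrite ltr_pdivrMr // mul1r.
have H := L2_contraction (fun u => @derivable_dilation s u (ltW s0) s1) rs0 rs1.
have E t : f (s%:C%C * ((r / s)%:C%C * expi t)) = radial r t.
  by rewrite /radial mulrA -rmorphM /= [s * _]mulrC divfK // gt_eqF.
rewrite (@eq_Rintegral _ _ _ mu T (fun t => cmod (f (s%:C%C * expi t) -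
    f (s%:C%C * ((r / s)%:C%C * expi t))) ^+ 2)); last by move=> t _; rewrite E.
rewrite [X in _ <= _ - X](@eq_Rintegral _ _ _ mu T (fun t => cmod
    (f (s%:C%C * ((r / s)%:C%C * expi t))) ^+ 2)); last by move=> t _; rewrite E.
exact: H.
Qed.

Variable M : R.
Hypothesis HM : forall r, 0 <= r -> r < 1 -> N r <= M.

(** By [radial_increment] the squared norms [N r] increase with r. They are bounded, so beyond a
    radius where [N] is within e of its supremum all increments are at most e. *)
Lemma radial_cauchy e : 0 < e -> exists r0, [/\ 0 <= r0, r0 < 1 &
  forall r s, r0 <= r -> r <= s -> s < 1 ->
    \int[mu]_(t in T) (cmod (radial s t - radial r t) ^+ 2) <= e].
Proof.
move=> e0; pose A := [set N r | r in [set r | 0 <= r < 1]].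
have supA : has_sup A.
  split; first by exists (N 0), 0 => //=; rewrite lexx ltr01.
  by exists M => _ [r /= /andP[r0 r1] <-]; exact: HM.
have [_ [r0 /= /andP[r00 r01] <-] Hr0] := sup_adherent e0 supA.
exists r0; split=> // r s r0r rs s1.
have mono x y : 0 <= x -> x <= y -> y < 1 -> N x <= N y.
  move=> x0 xy y1; rewrite -subr_ge0 (le_trans _ (radial_increment x0 xy y1)) //.
  by apply: Rintegral_ge0 => t _; rewrite exprn_ge0 // cmod_ge0.
have r0' := le_trans r00 r0r.
rewrite (le_trans (radial_increment r0' rs s1)) //.
have h1 : N s <= sup A.
  by apply: ub_le_sup; [exact: supA.2|exists s => //=; rewrite s1 (le_trans r0' rs)].
have h2 := mono _ _ r00 r0r (le_lt_trans rs s1).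
by move: h1 h2 Hr0; lra.
Qed.

End RadialL2.

Definition cmeas {R : realType} (D : set R) (phi : R -> R[i]) :=
  measurable_fun D (fun t => complex.Re (phi t)) /\
  measurable_fun D (fun t => complex.Im (phi t)).

Section CMeas.
Context {R : realType}.
Local Notation C := R[i].
Implicit Types (D : set R) (phi psi : R -> C).

Lemma ccont_cmeas D phi : measurable D -> ccont phi -> cmeas D phi.
Proof.
by move=> mD [a b]; split; apply: measurable_funS (measurableT) (@subsetT _ _) _;
  exact: continuous_measurable_fun.
Qed.

Lemma cmeasD D phi psi : cmeas D phi -> cmeas D psi -> cmeas D (fun t => phi t + psi t).
Proof.
move=> [a b] [c d]; split.
  by under eq_fun do rewrite ReD; exact: measurable_funD.
by under eq_fun do rewrite ImD; exact: measurable_funD.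
Qed.

Lemma cmeasN D phi : cmeas D phi -> cmeas D (fun t => - phi t).
Proof.
move=> [a b]; split.
  by under eq_fun do rewrite ReN; exact: measurable_funN.
by under eq_fun do rewrite ImN; exact: measurable_funN.
Qed.

Lemma cmeasB D phi psi : cmeas D phi -> cmeas D psi -> cmeas D (fun t => phi t - psi t).
Proof. by move=> a b; apply: cmeasD => //; exact: cmeasN. Qed.

Lemma cmeasM D phi psi : cmeas D phi -> cmeas D psi -> cmeas D (fun t => phi t * psi t).
Proof.
move=> [a b] [c d]; split.
  by under eq_fun do rewrite ReM; apply: measurable_funB; exact: measurable_funM.
by under eq_fun do rewrite ImM; apply: measurable_funD; exact: measurable_funM.
Qed.

Lemma cmeas_sqr D phi : cmeas D phi -> measurable_fun D (fun t => cmod (phi t) ^+ 2).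
Proof.
move=> [a b]; under eq_fun do rewrite cmod_sqr.
by apply: measurable_funD; exact: measurable_funX.
Qed.

Lemma cmod_sqr_half_add (a b : C) : cmod (a + b) ^+ 2 <= 2 * (cmod a ^+ 2 + cmod b ^+ 2).
Proof.
have h := cmodD a b; have x0 := cmod_ge0 a; have y0 := cmod_ge0 b; have z0 := cmod_ge0 (a + b).
apply: (@le_trans _ _ ((cmod a + cmod b) ^+ 2)); first by rewrite ler_pXn2r ?nnegrE ?addr_ge0.
by have := sqr_ge0 (cmod a - cmod b); rewrite !expr2; lra.
Qed.

End CMeas.

Section RadialLimit.
Context {R : realType}.
Local Notation C := R[i].
Local Notation mu := (@lebesgue_measure R).
Local Notation T := (`[0, 2 * pi]%classic : set R).
Variable f : Cplx R -> Cplx R.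
Hypothesis Hf : holomorphic f.
Variable M : R.
Hypothesis HM : forall r, 0 <= r -> r < 1 ->
  \int[mu]_(t in T) (cmod (radial f r t) ^+ 2) <= M.

Lemma EFin_Rint_cont (g : R -> R) : continuous g ->
  (\int[mu]_(t in T) (g t)%:E)%E = (\int[mu]_(t in T) g t)%:E.
Proof.
by move=> cg; rewrite /Rintegral fineK //; apply: integrable_fin_num => //; exact: continuous_integrable.
Qed.

(* Along radii [rho j] with L2 increments at most [2^-j] the radial functions
   converge a.e. (the sum of the moduli of the increments is integrable);
   Fatou's lemma turns the a.e. limit into an L2 limit. *)
Lemma radial_limit : exists F : R -> C, cmeas T F /\
  forall e, 0 < e -> exists r0, [/\ 0 <= r0, r0 < 1 & forall r, r0 <= r -> r < 1 ->
    (\int[mu]_(t in T) (cmod (F t - radial f r t) ^+ 2)%:E <= e%:E)%E].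
Proof.
have p4 j : 0 < (4 ^+ j)^-1 :> R by rewrite invr_gt0 exprn_gt0.
have p2 j : 0 < (2 ^+ j)^-1 :> R by rewrite invr_gt0 exprn_gt0.
have [rr Hrr] := choice (fun j => radial_cauchy Hf HM (p4 j)).
(* The second entry forces the radii [rho j] to tend to 1. *)
pose m j := Num.max (rr j) (1 - j.+1%:R^-1).
pose rho := fix rho j := if j is j'.+1 then Num.max (rho j') (m j) else m 0%N.
have m0 j : 0 <= m j by have [h _ _] := Hrr j; rewrite /m le_max h.
have m1 j : m j < 1.
  by have [_ h _] := Hrr j; rewrite /m gt_max h /= gtrBl invr_gt0 ltr0n.
have rho0 j : 0 <= rho j by elim: j => [|j IH] /=; [exact: m0|rewrite le_max IH].
have rho1 j : rho j < 1 by elim: j => [|j IH] /=; [exact: m1|rewrite gt_max IH m1].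
have mrho j : m j <= rho j by case: j => [|j] //=; rewrite le_max lexx orbT.
have rhoS j : rho j <= rho j.+1 by rewrite /= le_max lexx.
have rr_rho j : rr j <= rho j by rewrite (le_trans _ (mrho j)) // /m le_max lexx.
have rho_ge j : 1 - j.+1%:R^-1 <= rho j by rewrite (le_trans _ (mrho j)) // /m le_max lexx orbT.
pose G j := radial f (rho j).
have cG j : ccont (G j) by exact: ccont_radial.
pose D j t := cmod (G j.+1 t - G j t).
have cD j : continuous (D j) by apply: ccont_cmod; exact: ccontB.
have cD2 j : continuous (fun t => D j t ^+ 2) by apply: ccont_sqr; exact: ccontB.
have D0 j t : 0 <= D j t by exact: cmod_ge0.
have D2le j : \int[mu]_(t in T) (D j t ^+ 2) <= (4 ^+ j)^-1.
  by have [_ _] := Hrr j; apply.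
(* From D <= 2^(-j) / 2 + (2^j / 2) D^2: the first term integrates to pi 2^(-j), the second to at
   most 2^(-j) / 2 by the bound 4^(-j) on the squared increment. *)
pose c : R := (2 * pi + 1) / 2.
have Dle j : (\int[mu]_(t in T) (D j t)%:E <= (c * (2 ^+ j)^-1)%:E)%E.
  have cc : continuous (fun t => (2 ^+ j)^-1 / 2 + 2 ^+ j / 2 * D j t ^+ 2).
    move=> t; apply: cvgD; first exact: cvg_cst.
    by apply: cvgM; [exact: cvg_cst|exact: cD2].
  rewrite EFin_Rint_cont // lee_fin.
  apply: (@le_trans _ _ (\int[mu]_(t in T) ((2 ^+ j)^-1 / 2 + 2 ^+ j / 2 * D j t ^+ 2))).
    apply: le_Rintegral => //; try exact: continuous_integrable.
    move=> t _; set x := D j t; set y : R := 2 ^+ j.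
    have y0 : 0 < y by rewrite /y exprn_gt0.
    rewrite -subr_ge0 (_ : _ - _ = y / 2 * (x - y^-1) ^+ 2); last by field; rewrite gt_eqF.
    by rewrite mulr_ge0 ?sqr_ge0 // divr_ge0 // ltW.
  rewrite RintegralD //; last 2 first.
  - exact/continuous_integrable/cst_continuous.
  - by apply: integrableZE => //; exact: continuous_integrable.
  rewrite Rint_cst ?two_pi_ge0 // subr0.
  rewrite RintegralZl //; last exact: (continuous_integrable _ _ (cD2 j)).
  apply: (@le_trans _ _ ((2 ^+ j)^-1 / 2 * (2 * pi) + 2 ^+ j / 2 * (4 ^+ j)^-1)).
    by rewrite lerD2l ler_wpM2l // divr_ge0 // exprn_ge0.
  rewrite (_ : 4 ^+ j = 2 ^+ j * 2 ^+ j); last by rewrite -exprMn -natrM.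
  rewrite /c le_eqVlt; apply/orP; left; apply/eqP; field.
  by rewrite expf_neq0.
pose h t : \bar R := (\sum_(0 <= n <oo) (D n t)%:E)%E.
have mD n : measurable_fun T (fun t => (D n t)%:E).
  apply/measurable_EFinP; apply: measurable_funS measurableT (@subsetT _ _) _.
  exact: continuous_measurable_fun.
have DE0 n t : (0 <= (D n t)%:E)%E by rewrite lee_fin.
have mh : measurable_fun T h.
  by apply: ge0_emeasurable_sum => // n t _ _; exact: DE0.
have c0 : 0 <= c by rewrite /c divr_ge0 // addr_ge0 // two_pi_ge0.
have hle : (\int[mu]_(t in T) h t <= (2 * c)%:E)%E.
  rewrite /h integral_nneseries //.
  apply: lime_le.
    by apply: is_cvg_nneseries => n _ _; apply: integral_ge0.
  apply: nearW => n.
  apply: (@le_trans _ _ (2 * c * (1 - (2 ^+ n)^-1))%:E); last first.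
    by rewrite lee_fin mulrBr mulr1 gerBl; apply: mulr_ge0; [exact: mulr_ge0|exact: ltW].
  elim: n => [|n IH]; first by rewrite big_geq // expr0 invr1 subrr mulr0.
  rewrite big_nat_recr //= (le_trans (leeD IH (Dle n))) // -EFinD lee_fin.
  rewrite exprS le_eqVlt; apply/orP; left; apply/eqP; field.
  by rewrite expf_neq0.
have ih : mu.-integrable T h.
  apply/integrableP; split => //; under eq_integral do rewrite gee0_abs ?nneseries_ge0 //.
  by rewrite (le_lt_trans hle) // ltry.
have [A [mA A0 sA]] := @integrable_ae _ _ _ mu T (measurable_itv _) h ih.
have bddD t : T t -> ~ A t -> cvgn (series (D^~ t)).
  move=> Tt At; apply: nondecreasing_is_cvgn.
    by apply/nondecreasing_seqP => n; rewrite /series /= big_nat_recr //= lerDl.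
  exists (fine (h t)) => _ [n _ <-]; rewrite -lee_fin fineK.
    rewrite /series /= -sumEFin; apply: nneseries_lim_ge => k _ _; exact: DE0.
  by apply: contrapT => hh; apply: At; apply: sA => /= /(_ Tt).
have cvgRe t : T t -> ~ A t -> cvgn (fun n => complex.Re (G n t)).
  move=> Tt At; pose u n := complex.Re (G n.+1 t) - complex.Re (G n t).
  have cu : cvgn (series u).
    have uD n : `|u n| <= D n t by rewrite /u -ReB Re_le_cmod.
    apply: normed_cvg; exact: (@series_le_cvg _ (fun n => `|u n|) _ (fun n => normr_ge0 _)
      (fun n => D0 n t) uD (bddD t Tt At)).
  have -> : (fun n => complex.Re (G n t)) = (fun n => complex.Re (G 0%N t) + series u n).
    by apply/funext => n; exact: (eq_sum_telescope (fun n => complex.Re (G n t))).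
  by apply: is_cvgD => //; exact: is_cvg_cst.
have cvgIm t : T t -> ~ A t -> cvgn (fun n => complex.Im (G n t)).
  move=> Tt At; pose u n := complex.Im (G n.+1 t) - complex.Im (G n t).
  have cu : cvgn (series u).
    have uD n : `|u n| <= D n t by rewrite /u -ImB Im_le_cmod.
    apply: normed_cvg; exact: (@series_le_cvg _ (fun n => `|u n|) _ (fun n => normr_ge0 _)
      (fun n => D0 n t) uD (bddD t Tt At)).
  have -> : (fun n => complex.Im (G n t)) = (fun n => complex.Im (G 0%N t) + series u n).
    by apply/funext => n; exact: (eq_sum_telescope (fun n => complex.Im (G n t))).
  by apply: is_cvgD => //; exact: is_cvg_cst.
(* The upper limit is defined at every point and measurable in t, and it agrees with the limit
   wherever that exists; so [F] is measurable without removing the exceptional null set. *)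
pose lm (v : nat -> R) := fine (limn_esup (fun n => (v n)%:E)).
have lmE (v : nat -> R) : cvgn v -> v @ \oo --> lm v.
  move=> cv; suff -> : lm v = limn v by [].
  rewrite /lm; have /cvg_limn_einf_sup[_ ->] // : (fun n => (v n)%:E) @ \oo --> (limn v)%:E.
  by apply: cvg_EFin; [exact: nearW|exact: cv].
have mlm (v : nat -> R -> R) : (forall n, continuous (v n)) -> measurable_fun T (fun t => lm (v^~ t)).
  move=> cv; apply: measurableT_comp => //.
  apply: (measurable_fun_limn_esup (f := fun n t => (v n t)%:E)) => n.
  apply/measurable_EFinP; apply: measurable_funS measurableT (@subsetT _ _) _.
  exact: continuous_measurable_fun.
pose F t : C := (lm (fun n => complex.Re (G n t)) +i* lm (fun n => complex.Im (G n t)))%C.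
have mF : cmeas T F.
  by split; rewrite /F /=; apply: mlm => n; have [] := cG n.
exists F; split => // e e0.
have [r0 [r00 r01 Hr0]] := radial_cauchy Hf HM e0.
exists r0; split => // r r0r r1.
have cr : ccont (radial f r) by apply: ccont_radial => //; exact: le_trans r0r.
apply: (@fatou_le _ _ _ (fun n t => cmod (G n t - radial f r t) ^+ 2)) => //.
- move=> n; apply: measurable_funS measurableT (@subsetT _ _) _.
  by apply: continuous_measurable_fun; apply: ccont_sqr; exact: ccontB.
- by apply: cmeas_sqr; apply: cmeasB => //; exact: ccont_cmeas.
- by move=> n t _; rewrite exprn_ge0 ?cmod_ge0.
- by move=> t _; rewrite exprn_ge0 ?cmod_ge0.
- exists A; split => // t H; apply: contrapT => At; apply: H => Tt.
  have h1 := lmE _ (cvgRe t Tt At); have h2 := lmE _ (cvgIm t Tt At).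
  rewrite cmod_sqr ReB ImB; under eq_fun do rewrite cmod_sqr ReB ImB !expr2.
  rewrite !expr2; apply: cvgD; apply: cvgM; apply: cvgB => //; exact: cvg_cst.
pose n0 := Num.bound (1 - r)^-1.
exists n0 => // n /= n0n.
have rn : r <= rho n.
  apply: le_trans (rho_ge n); rewrite lerBrDr -lerBrDl.
  rewrite invf_ple ?posrE ?subr_gt0 // ?ltr0n //.
  rewrite (le_trans (ltW (archi_boundP _))) ?invr_ge0 ?subr_ge0 ?(ltW r1) // ler_nat.
  exact: leqW.
rewrite EFin_Rint_cont; first by rewrite lee_fin; apply: Hr0.
by apply: ccont_sqr; exact: ccontB.
Qed.

End RadialLimit.

(** * Square-integrable functions and weak limits *)

Section SquareIntegrable.
Context {R : realType}.
Local Notation C := R[i].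
Local Notation mu := (@lebesgue_measure R).
Local Notation T := (`[0, 2 * pi]%classic : set R).
Implicit Types (A B F : R -> C).

Definition L2 F := cmeas T F /\ (\int[mu]_(t in T) (cmod (F t) ^+ 2)%:E < +oo)%E.

Definition n2 F := \int[mu]_(t in T) (cmod (F t) ^+ 2).

Lemma ge0_integrable (g : R -> R) : measurable_fun T g -> (forall t, 0 <= g t) ->
  (\int[mu]_(t in T) (g t)%:E < +oo)%E -> mu.-integrable T (fun t => (g t)%:E).
Proof.
move=> mg g0 gi; apply/integrableP; split; first exact/measurable_EFinP.
by under eq_integral do rewrite gee0_abs ?lee_fin //.
Qed.

Lemma le_integrableE (g h : R -> R) : measurable_fun T g ->
  mu.-integrable T (fun t => (h t)%:E) -> (forall t, `|g t| <= h t) ->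
  mu.-integrable T (fun t => (g t)%:E).
Proof.
move=> mg ih gh; apply: (le_integrable _ _ _ ih) => //; first exact/measurable_EFinP.
by move=> t _; rewrite lee_fin (le_trans (gh t)) // ler_norm.
Qed.

Lemma integrableZrE (g : R -> R) c : mu.-integrable T (fun t => (g t)%:E) ->
  mu.-integrable T (fun t => (g t * c)%:E).
Proof.
move=> ig; rewrite (_ : (fun t => _) = (fun t => (c * g t)%:E)); first exact: integrableZE.
by apply/funext => t; rewrite mulrC.
Qed.

Lemma L2_integrable F : L2 F -> mu.-integrable T (fun t => (cmod (F t) ^+ 2)%:E).
Proof.
move=> [mF iF]; apply: ge0_integrable => //; first exact: cmeas_sqr.
by move=> t; rewrite exprn_ge0 ?cmod_ge0.
Qed.

Lemma n2_fin F : L2 F -> (\int[mu]_(t in T) (cmod (F t) ^+ 2)%:E)%E = (n2 F)%:E.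
Proof. by move=> /L2_integrable h; rewrite /n2 /Rintegral fineK //; exact: integrable_fin_num. Qed.

Lemma n2_ge0 F : 0 <= n2 F.
Proof. by apply: Rintegral_ge0 => t _; rewrite exprn_ge0 ?cmod_ge0. Qed.

Lemma ccont_L2 F : ccont F -> L2 F.
Proof.
move=> cF; split; first exact: ccont_cmeas.
by rewrite EFin_Rint_cont ?ltry //; exact: ccont_sqr.
Qed.

Lemma L2D A B : L2 A -> L2 B -> L2 (fun t => A t + B t).
Proof.
move=> a b; have mAB : cmeas T (fun t => A t + B t) by apply: cmeasD; [exact: a.1|exact: b.1].
split => //; apply: integrable_lty => //.
apply: (@le_integrableE _ (fun t => 2 * (cmod (A t) ^+ 2 + cmod (B t) ^+ 2))).
- exact: cmeas_sqr.
- apply: integrableZE => //; apply: (@integrableD _ _ _ mu T _ (fun t => (cmod (A t) ^+ 2)%:E)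
    (fun t => (cmod (B t) ^+ 2)%:E)) => //; exact: L2_integrable.
- by move=> t; rewrite ger0_norm ?exprn_ge0 ?cmod_ge0 // cmod_sqr_half_add.
Qed.

Lemma L2M_bounded A B K : L2 A -> cmeas T B -> (forall t, cmod (B t) <= K) ->
  L2 (fun t => B t * A t).
Proof.
move=> a mB BK; have mAB : cmeas T (fun t => B t * A t) by apply: cmeasM => //; exact: a.1.
split => //; apply: integrable_lty => //.
apply: (@le_integrableE _ (fun t => K ^+ 2 * cmod (A t) ^+ 2)).
- exact: cmeas_sqr.
- by apply: integrableZE => //; exact: L2_integrable.
- move=> t; rewrite ger0_norm ?exprn_ge0 ?cmod_ge0 // cmodM exprMn.
  by rewrite ler_wpM2r ?exprn_ge0 ?cmod_ge0 // ler_pXn2r ?nnegrE ?cmod_ge0 // (le_trans _ (BK t)) // cmod_ge0.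
Qed.

Lemma L2B A B : L2 A -> L2 B -> L2 (fun t => A t - B t).
Proof.
move=> a b; apply: L2D => //; under eq_fun do rewrite -mulN1r.
have mc : cmeas T (fun=> - 1 : C) by apply: ccont_cmeas => //; exact: ccont_cst.
by apply: (L2M_bounded (K := 1) b mc) => t; rewrite cmodN cmod1.
Qed.

Lemma young (x y eta : R) : 0 < eta -> 2 * (x * y) <= x ^+ 2 / eta + eta * y ^+ 2.
Proof.
move=> e0; rewrite -subr_ge0 (_ : _ - _ = (x - eta * y) ^+ 2 / eta); last by field; rewrite gt_eqF.
by rewrite divr_ge0 ?sqr_ge0 // ltW.
Qed.

Lemma L2_integrable_young A B eta : L2 A -> L2 B ->
  mu.-integrable T (fun t => (cmod (A t) ^+ 2 / eta + eta * cmod (B t) ^+ 2)%:E).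
Proof.
move=> a b; apply: (@integrableD _ _ _ mu T _ (fun t => (cmod (A t) ^+ 2 / eta)%:E)
   (fun t => (eta * cmod (B t) ^+ 2)%:E)) => //.
  by apply: integrableZrE; exact: L2_integrable.
by apply: integrableZE => //; exact: L2_integrable.
Qed.

Lemma L2_cintbleM A B : L2 A -> L2 B -> cintble T (fun t => A t * B t).
Proof.
move=> a b; have [m1 m2] : cmeas T (fun t => A t * B t) by apply: cmeasM; [exact: a.1|exact: b.1].
have H t : cmod (A t * B t) <= cmod (A t) ^+ 2 / 1 + 1 * cmod (B t) ^+ 2.
  rewrite cmodM (le_trans _ (young _ _ ltr01)) // ler_peMl ?mulr_ge0 ?cmod_ge0 //.
  by rewrite ler1n.
split; apply: (le_integrableE _ (L2_integrable_young 1 a b)) => // t.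
  exact: le_trans (Re_le_cmod _) (H t).
exact: le_trans (Im_le_cmod _) (H t).
Qed.

(** Young's inequality with a free weight stands in for Cauchy-Schwarz: when n2 A is at most eta^2,
    both terms are of order eta. *)
Lemma cint_L2_le A B eta : L2 A -> L2 B -> 0 < eta ->
  cmod (cint T (fun t => A t * B t)) <= n2 A / eta + eta * n2 B.
Proof.
move=> a b e0; have iA := L2_integrable a; have iB := L2_integrable b.
have -> : n2 A / eta + eta * n2 B =
    2 * \int[mu]_(t in T) (2^-1 * (cmod (A t) ^+ 2 / eta + eta * cmod (B t) ^+ 2)).
  rewrite RintegralZl //; last exact: L2_integrable_young.
  rewrite mulVKf // RintegralD //; last 2 first.
  - exact: integrableZrE.
  - exact: integrableZE.
  by rewrite RintegralZl // RintegralZr.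
apply: cmod_cint_le => //; first exact: L2_cintbleM.
  by apply: integrableZE => //; exact: L2_integrable_young.
by move=> t _; rewrite cmodM ler_pdivlMl // young.
Qed.

Lemma cint_L2_limit A B (c : C) : L2 A -> L2 B ->
  (forall e, 0 < e -> exists A', [/\ L2 A',
     (\int[mu]_(t in T) (cmod (A t - A' t) ^+ 2)%:E <= e%:E)%E
     & cmod (cint T (fun t => A' t * B t) - c) <= e]) ->
  cint T (fun t => A t * B t) = c.
Proof.
move=> a b H; apply/eqP; rewrite -subr_eq0 -cmod_eq0 eq_le cmod_ge0 andbT.
(* With n2 (A - A') <= eta^2 the error is at most eta + eta n2 B + eta^2, and eta^2 <= eta since eta
   <= 1; hence the total eta K. *)
apply/ler_addgt0Pr => x x0; rewrite add0r; pose K := 1 + (1 + n2 B).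
have K0 : 0 < K by rewrite /K addr_gt0 // ltr_wpDr ?n2_ge0.
pose eta := Num.min 1 (x / K).
have e0 : 0 < eta by rewrite lt_min ltr01 divr_gt0.
have e2 : 0 < eta ^+ 2 by rewrite exprn_gt0.
have [A' [a' dA cA]] := H _ e2.
rewrite n2_fin in dA; last exact: L2B.
rewrite lee_fin expr2 in dA.
have -> : cint T (fun t => A t * B t) - c =
    cint T (fun t => (A t - A' t) * B t) + (cint T (fun t => A' t * B t) - c).
  rewrite addrA -cintD //; last 2 first.
  - by apply: L2_cintbleM => //; exact: L2B.
  - exact: L2_cintbleM.
  by congr (_ - _); apply: eq_cint => t _; rewrite -mulrDl subrK.
apply: (@le_trans _ _ (eta + eta * n2 B + eta)).
  rewrite (le_trans (cmodD _ _)) //; apply: lerD.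
    rewrite (le_trans (cint_L2_le (L2B a a') b e0)) // lerD2r ler_pdivrMr //.
  by rewrite (le_trans cA) // expr2 ler_piMl ?(ltW e0) // ge_min lexx.
have -> : eta + eta * n2 B + eta = eta * K by rewrite /K; ring.
by rewrite -ler_pdivlMr // ge_min lexx orbT.
Qed.

End SquareIntegrable.

(** * Poisson representation and products of boundary functions *)

Section RadialRepresentation.
Context {R : realType}.
Local Notation C := R[i].
Local Notation mu := (@lebesgue_measure R).
Local Notation T := (`[0, 2 * pi]%classic : set R).
Implicit Types (f h : Cplx R -> Cplx R) (F H : R -> C).

(** The boundary function as a measurable representative of an L2 limit, independent of the
    pointwise choice made in [bval]. *)
Definition radial_L2_limit f F := cmeas T F /\
  forall e, 0 < e -> exists r0, [/\ 0 <= r0, r0 < 1 & forall r, r0 <= r -> r < 1 ->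
    (\int[mu]_(t in T) (cmod (F t - radial f r t) ^+ 2)%:E <= e%:E)%E].

Lemma radial_L2_limit_L2 f F : holomorphic f -> radial_L2_limit f F -> L2 F.
Proof.
move=> Hf [mF /(_ 1 ltr01)[r [r0 r1 Hr]]].
have cr : ccont (radial f r) by exact: ccont_radial.
have h : L2 (fun t => F t - radial f r t).
  split; first by apply: cmeasB => //; exact: ccont_cmeas.
  by rewrite (le_lt_trans (Hr r _ _)) // ltry.
have := L2D h (ccont_L2 cr).
by under eq_fun do rewrite subrK.
Qed.

Lemma ccont_poisson (z : C) : cmod z < 1 -> ccont (fun t => (poisson z t)%:C%C).
Proof.
move=> z1; under eq_fun do rewrite poissonE.
have cd : ccont (fun t => expi t - z) by apply: ccontB; [exact: ccont_expi|exact: ccont_cst].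
apply: ccontM; first exact: ccont_cst.
apply: ccontV; first by apply: ccontM => //; exact: ccontJ.
by move=> t; rewrite mulf_neq0 ?conjc_eq0 // unit_sub_neq0.
Qed.

(** The dilations satisfy Poisson's formula on the closed disk; their boundary values converge in
    L2, and f (r z) tends to f z. *)
Lemma poisson_representation f F (z : C) : holomorphic f -> radial_L2_limit f F ->
  cmod z < 1 -> cint T (fun t => F t * (poisson z t)%:C%C) = (2 * pi)%:C%C * f z.
Proof.
move=> Hf lF z1; have LF := radial_L2_limit_L2 Hf lF.
apply: cint_L2_limit => //; first exact/ccont_L2/ccont_poisson.
move=> e e0; have [r0 [r00 r01 Hr]] := lF.2 e e0.
have pi0 : 0 < 2 * pi :> R by rewrite mulr_gt0 // pi_gt0.
have [d d0 Hd] := derivable_cont (Hf z z1) (divr_gt0 e0 pi0).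
pose r := Num.max r0 (1 - d / 2).
have r1 : r < 1 by rewrite gt_max r01 /= gtrBl divr_gt0.
have rr0 : r0 <= r by rewrite le_max lexx.
have rd : 1 - d / 2 <= r by rewrite le_max lexx orbT.
have r0' := le_trans r00 rr0.
exists (radial f r); split; [exact/ccont_L2/ccont_radial|exact: Hr|].
have := poisson_formula z1 (fun u => @derivable_dilation _ f Hf r u r0' r1).
rewrite (@eq_cint _ _ _ (fun t => radial f r t * (poisson z t)%:C%C)); last first.
  by move=> t _; rewrite mulrC.
move=> ->; rewrite -mulrBr cmodM cmodR gtr0_norm // mulrC -ler_pdivlMr // ltW //.
apply: Hd; rewrite (_ : _ - z = - (1 - r)%:C%C * z); last first.
  by rewrite rmorphB rmorph1; ring.
rewrite cmodM cmodN cmodR ger0_norm ?subr_ge0 ?(ltW r1) //.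
rewrite (@le_lt_trans _ _ (1 - r)) // ?ler_piMr ?subr_ge0 ?(ltW r1) ?(ltW z1) //; lra.
Qed.

(** For two dilations the integrand is the boundary value of u f(r u) h(s u), which vanishes at 0.
    The limits r -> 1 and s -> 1 are taken one at a time, so that the other factor is a fixed L2
    function. *)
Lemma cint_product_zero f h F H : holomorphic f -> holomorphic h ->
  radial_L2_limit f F -> radial_L2_limit h H ->
  cint T (fun t => expi t * F t * H t) = 0.
Proof.
move=> Hf Hh lF lH; have LF := radial_L2_limit_L2 Hf lF; have LH := radial_L2_limit_L2 Hh lH.
have me : cmeas T (@expi R) by apply: ccont_cmeas => //; exact: ccont_expi.
have eF : L2 (fun t => expi t * F t).
  by apply: (@L2M_bounded _ _ _ 1) => // t; exact: cmod_expi_le1.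
have fh r s : 0 <= r -> r < 1 -> 0 <= s -> s < 1 ->
    cint T (fun t => radial f r t * (expi t * radial h s t)) = 0.
  move=> r0 r1 s0 s1.
  pose q (u : Cplx R) : Cplx R := f (r%:C%C * u) * (u * h (s%:C%C * u)).
  have Hq (u : C) : cmod u <= 1 -> derivable q u 1.
    move=> u1; apply: derivableM; first exact: derivable_dilation.
    by apply: derivableM; [exact: derivable_id|exact: derivable_dilation].
  have := mean_value Hq; rewrite {2}/q mul0r mulr0 mulr0; apply.
have Fh s : 0 <= s -> s < 1 -> cint T (fun t => F t * (expi t * radial h s t)) = 0.
  move=> s0 s1; have ch : ccont (radial h s) by exact: ccont_radial.
  apply: cint_L2_limit => //; first by apply: ccont_L2; apply: ccontM => //; exact: ccont_expi.
  move=> e e0; have [r [r0 r1 Hr]] := lF.2 e e0.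
  exists (radial f r); split; [exact/ccont_L2/ccont_radial|exact: Hr|].
  by rewrite fh // subrr cmod0 ltW.
rewrite (@eq_cint _ _ _ (fun t => H t * (expi t * F t))); last by move=> t _; rewrite mulrC.
apply: cint_L2_limit => // e e0; have [s [s0 s1 Hs]] := lH.2 e e0.
exists (radial h s); split; [exact/ccont_L2/ccont_radial|exact: Hs|].
rewrite (@eq_cint _ _ _ (fun t => F t * (expi t * radial h s t))); last by move=> t _; ring.
by rewrite Fh // subrr cmod0 ltW.
Qed.

End RadialRepresentation.

(** * Nontangential limits *)

Section ExpiInjective.
Context {R : realType}.
Local Notation C := R[i].

Lemma expi_sub_conj (t x : R) : expi t * conjc (expi x) = expi (t - x) :> C.
Proof. by apply: complex_eqP; rewrite /expi /= ?cosB ?sinB; ring. Qed.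

Lemma cmod_expi_sub (t x : R) : cmod (expi t - expi x) = cmod (expi (t - x) - 1).
Proof.
rewrite -expi_sub_conj -(expiJ x) -mulrBl cmodM cmodJ cmod_expi mulr1 //.
Qed.

(** The chord dominates |sin (t - x)|, and on [0, 1] the derivative of sin is at least cos 1. *)
Lemma expi_near_lower (t x : R) : `|t - x| <= 1 -> cos 1 * `|t - x| <= cmod (expi t - expi x).
Proof.
rewrite cmod_expi_sub; set y := t - x => y1.
apply: (@le_trans _ _ `|sin y|); last first.
  by rewrite (le_trans _ (Im_le_cmod _)) // ImB /= subr0.
have H (u : R) : 0 <= u -> u <= 1 -> cos 1 * u <= sin u.
  move=> u0 u1; have cs : {within `[0, u], continuous (@sin R)}.
    by apply: continuous_subspaceT; exact: continuous_sin.
  have [c /[!in_itv] /= /andP[c0 cu]] := @MVT_segment _ (@sin R) (@cos R) 0 u u0 (fun z _ => is_derive_sin z) cs.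
  rewrite sin0 !subr0 => ->; rewrite ler_wpM2r //.
  have c1 := le_trans cu u1; have := @pi_ge2 R => p2.
  have [->//|c1'] := eqVneq c 1.
  by rewrite ltW // ltr_cos ?in_itv /= ?c0 ?ler01 ?lt_neqAle ?c1' //=; lra.
have [y0|/ltW y0] := leP 0 y.
  by rewrite ger0_norm // in y1 *; rewrite (le_trans (H _ y0 y1)) // ler_norm.
rewrite ler0_norm // in y1 *; rewrite -normrN -sinN (le_trans (H _ _ y1)) ?oppr_ge0 //.
exact: ler_norm.
Qed.

(** Real parts give 1 - cos y = 2 sin (y / 2)^2 = 0 for y = t - x, while sin has no zero in ]0,
    pi[. *)
Lemma expi_inj (t x : R) : `|t - x| < 2 * pi -> expi t = expi x :> C -> t = x.
Proof.
move=> tx E; apply/eqP; rewrite -subr_eq0; apply/negPn/negP => y0.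
have : cmod (expi (t - x) - 1 : C) = 0 by rewrite -cmod_expi_sub E subrr cmod0.
move/eqP; rewrite cmod_eq0 subr_eq0 => /eqP/(congr1 (@complex.Re R)) /=.
set y := t - x in y0 tx *.
rewrite -[y](@divfK _ 2) // mulr_natr cos_mulr2n.
have -> : cos (y / 2) ^+ 2 *+ 2 - 1 = 1 - sin (y / 2) ^+ 2 *+ 2.
  by rewrite sin2cos2; ring.
move/eqP; rewrite -subr_eq0 addrC addKr oppr_eq0 mulrn_eq0 /= sqrf_eq0; apply/negP.
have H (u : R) : 0 < u -> u < 2 * pi -> sin (u / 2) != 0.
  by move=> u0 u1; rewrite gt_eqF // sin_gt0_pi // divr_gt0 //= ltr_pdivrMr // mulrC.
have [ypos|yneg] := ltP 0 y; first by apply: H => //; rewrite gtr0_norm in tx.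
have {}yneg : y < 0 by rewrite lt_neqAle y0.
rewrite -oppr_eq0 -sinN -mulNr; apply: H; rewrite ?oppr_gt0 //.
by rewrite ltr0_norm in tx.
Qed.

End ExpiInjective.

(** * Poisson kernel estimates in a Stolz angle *)

Section FatouKernel.
Context {R : realType}.
Local Notation C := R[i].
Local Notation mu := (@lebesgue_measure R).
Local Notation T := (`[0, 2 * pi]%classic : set R).
Variables (x0 : R).
(** The point where the circle is cut is excluded, so that small intervals around [x0] lie in
    [0, 2 pi]; this costs only a null set. *)
Hypotheses (x0_gt0 : 0 < x0) (x0_lt : x0 < 2 * pi).

Let e0 : C := expi x0.

Lemma expi_far_lower eta : 0 < eta -> exists2 m, 0 < m &
  forall t, T t -> eta <= `|t - x0| -> m <= cmod (expi t - e0).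
Proof.
move=> eta0; have xgt := x0_gt0; have xlt := x0_lt; pose g t := cmod (expi t - e0).
have cg : continuous g.
  by apply: ccont_cmod; apply: ccontB; [exact: ccont_expi|exact: ccont_cst].
have gp t : T t -> t != x0 -> 0 < g t.
  rewrite /= in_itv /= => /andP[t0 t1] tx; rewrite /g cmod_gt0 subr_eq0.
  apply: contra tx => /eqP E; apply/eqP; apply: expi_inj E.
  by rewrite ltr_norml; apply/andP; split; lra.
have L : exists2 m, 0 < m & forall t, 0 <= t -> t <= x0 - eta -> m <= g t.
  have [h|h] := leP 0 (x0 - eta); last by exists 1 => // t *; exfalso; lra.
  have [c /[!in_itv]/= /andP[c0 c1] Hc] := EVT_min h (continuous_subspaceT cg).
  exists (g c); last by move=> t t0 t1; apply: Hc; rewrite in_itv /= t0.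
  apply: gp; first by rewrite /= in_itv /= c0; lra.
  by apply: contraTneq c1 => ->; rewrite -ltNge; lra.
have U : exists2 m, 0 < m & forall t, x0 + eta <= t -> t <= 2 * pi -> m <= g t.
  have [h|h] := leP (x0 + eta) (2 * pi); last by exists 1 => // t *; exfalso; lra.
  have [c /[!in_itv]/= /andP[c0 c1] Hc] := EVT_min h (continuous_subspaceT cg).
  exists (g c); last by move=> t t0 t1; apply: Hc; rewrite in_itv /= t0.
  apply: gp; first by rewrite /= in_itv /= c1 andbT; lra.
  by apply: contraTneq c0 => ->; rewrite -ltNge; lra.
case: L => m1 m10 H1; case: U => m2 m20 H2.
exists (Num.min m1 m2); first by rewrite lt_min m10.
move=> t; rewrite /= in_itv /= => /andP[t0 t1]; rewrite ler_normr ge_min => /orP[h|h].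
  by apply/orP; right; apply: H2 => //; lra.
by apply/orP; left; apply: H1 => //; lra.
Qed.

Variable M : R.
Hypothesis M1 : 1 < M.

Section Bounds.
Variable z : C.
Hypothesis zS : stolz e0 M z.

Let d := 1 - cmod z.

Lemma stolz_gap_gt0 : 0 < 1 - cmod z.
Proof. by rewrite subr_gt0; exact: zS.1. Qed.

Lemma stolz_poisson_ge0 t : 0 <= poisson z t.
Proof.
rewrite /poisson divr_ge0 ?exprn_ge0 ?cmod_ge0 // subr_ge0 exprn_ile1 ?cmod_ge0 //.
by rewrite ltW //; exact: zS.1.
Qed.

Let poisson_le_sqr t k : 0 < k -> k <= cmod (expi t - z) -> poisson z t <= 2 * d / k ^+ 2.
Proof.
move=> k0 H; have d0 := stolz_gap_gt0; have c0 := cmod_ge0 z.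
have kpos : 0 < k ^+ 2 by rewrite exprn_gt0.
rewrite /poisson ler_pM //.
- by rewrite subr_ge0 exprn_ile1 // ltW // -subr_gt0.
- by rewrite invr_ge0 exprn_ge0 ?cmod_ge0.
- by move: d0; rewrite /d expr2; nra.
- rewrite lef_pV2 ?posrE ?exprn_gt0 ?(lt_le_trans k0 H) //.
  by rewrite ler_pXn2r ?nnegrE ?cmod_ge0 // ltW.
Qed.

Lemma stolz_poisson_le t : poisson z t <= 2 / (1 - cmod z).
Proof.
have d0 := stolz_gap_gt0; apply: (le_trans (@poisson_le_sqr t d d0 _)).
  by rewrite /d -(cmod_expi t) cmodBD.
by rewrite expr2 invfM -/d mulrA mulfK // gt_eqF.
Qed.

(** In a Stolz angle |e - e0| <= |e - z| + M (1 - |z|) <= (1 + M) |e - z|, so the distance to z may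
    be replaced by the distance to the vertex. *)
Lemma stolz_poisson_far t k : 0 < k -> k <= cmod (expi t - e0) ->
  poisson z t <= 2 * (1 - cmod z) * (1 + M) ^+ 2 / k ^+ 2.
Proof.
move=> k0 H; have M1' := M1; have M0 : 0 < 1 + M by lra.
have d0 := stolz_gap_gt0.
have le1 : k / (1 + M) <= cmod (expi t - z).
  rewrite ler_pdivrMr // (le_trans H) // (le_trans (cmod_triangle _ z _)) //.
  rewrite mulrDr mulr1 lerD2l (le_trans (ltW zS.2)) // mulrC ler_wpM2r //; first by lra.
  by rewrite -(cmod_expi t) cmodBD.
apply: (le_trans (poisson_le_sqr _ le1)); first by rewrite divr_gt0.
rewrite -/d le_eqVlt; apply/orP; left; apply/eqP; field.
by rewrite !gt_eqF.
Qed.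

End Bounds.

Variable u : R -> R.
Hypothesis iu : mu.-integrable T (fun t => (u t)%:E).

Let v t := `|u t - u x0|.

Let iv : mu.-integrable T (fun t => (v t)%:E).
Proof.
have H : mu.-integrable T (fun t => (u t - u x0)%:E).
  apply: (@integrableB _ _ _ mu T _ (fun t => (u t)%:E) (fun=> (u x0)%:E)) => //.
  exact/continuous_integrable/cst_continuous.
exact: (integrable_norm H).
Qed.

Let mv : measurable_fun T v.
Proof. by have /integrableP[/measurable_EFinP ? _] := iv. Qed.

Hypothesis Leb : lebesgue_pt (u \_ T) x0.

Lemma lebesgue_pt_small eps : 0 < eps -> exists2 eta, 0 < eta & forall s, 0 < s -> s < eta ->
  ball x0 s `<=` T /\ (\int[mu]_(t in ball x0 s) (v t)%:E <= (2 * s * eps)%:E)%E.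
Proof.
move=> eps0; have eps0' : (0 < eps%:E)%E by rewrite lte_fin.
have /fine_cvgP[_ /cvgrPdist_lt/(_ _ eps0)] := Leb.
have /fine_cvgP[fin _] := Leb.
move=> H; have {fin}H := @filterI _ _ (@at_right_proper_filter R 0) _ _ fin H.
have {H} : nbhs (0 : R) [set s | 0 < s -> (davg (u \_ T) x0 s \is a fin_num /\
    `|0 - fine (davg (u \_ T) x0 s)| < eps)] := H.
move=> /nbhs_ballP[e /= e0' He].
pose eta := Num.min e (Num.min x0 (2 * pi - x0)).
exists eta; first by rewrite !lt_min e0' x0_gt0 subr_gt0.
move=> s s0; rewrite !lt_min => /and3P[se sx0 sx1].
have sub : ball x0 s `<=` T.
  move=> t; rewrite /ball /= in_itv /= ltr_norml => /andP[h1 h2]; apply/andP; split; lra.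
split => //; have [] := He s _ s0.
  by rewrite /ball /= sub0r normrN gtr0_norm.
rewrite sub0r normrN => fin h.
have xT : T x0 by rewrite /= in_itv /= !ltW.
have E : davg (u \_ T) x0 s = ((2 * s)^-1%:E * \int[mu]_(t in ball x0 s) (v t)%:E)%E.
  rewrite /davg /iavg lebesgue_measure_ball ?ltW //.
  have -> : s *+ 2 = 2 * s by rewrite mulr_natl.
  rewrite inver.
  rewrite gt_eqF ?mulr_gt0 //.
  congr (_ * _)%E. apply: eq_integral => t tb.
  rewrite /= /v !patchE (mem_set xT) ifT //.
  by apply/mem_set/sub; move: tb; rewrite inE.
have : (davg (u \_ T) x0 s <= eps%:E)%E.
  rewrite -(fineK fin) lee_fin; apply/ltW/(le_lt_trans _ h); exact: ler_norm.
by rewrite E lee_pdivrMl ?mulr_gt0 // -EFinM.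
Qed.

End FatouKernel.

Section FatouTheorem.
Context {R : realType}.
Local Notation C := R[i].
Local Notation mu := (@lebesgue_measure R).
Local Notation T := (`[0, 2 * pi]%classic : set R).

(* In a Stolz angle the Poisson kernel is at most a constant times
   [min (1/d, d / |t - x0|^2)], [d = 1 - |z|]; summing over dyadic annuli
   around the Lebesgue point [x0] gives the estimate. *)
Lemma fatou_kernel (x0 M : R) (u : R -> R) eps : 0 < x0 -> x0 < 2 * pi -> 1 < M ->
  mu.-integrable T (fun t => (u t)%:E) -> lebesgue_pt (u \_ T) x0 -> 0 < eps ->
  exists2 delta, 0 < delta & forall z : C, stolz (expi x0) M z -> cmod (z - expi x0) < delta ->
    (\int[mu]_(t in T) (poisson z t * `|u t - u x0|)%:E <= eps%:E)%E.
Proof.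
move=> x0_gt0 x0_lt M1 iu Leb eps0.
pose v t := `|u t - u x0|.
have iv : mu.-integrable T (fun t => (v t)%:E).
  have H : mu.-integrable T (fun t => (u t - u x0)%:E).
    apply: (@integrableB _ _ _ mu T _ (fun t => (u t)%:E) (fun=> (u x0)%:E)) => //.
    exact/continuous_integrable/cst_continuous.
  exact: (integrable_norm H).
have mv : measurable_fun T v by have /integrableP[/measurable_EFinP ? _] := iv.
have v0 t : 0 <= v t by exact: normr_ge0.
have k0 : 0 < cos (1 : R) := cos1_gt0 R.
pose A := (1 + M) ^+ 2 / cos 1 ^+ 2.
have A0 : 0 <= A by rewrite divr_ge0 // sqr_ge0.
(* The innermost interval contributes 4 ep, and the annulus from 2^k d to 2^(k+1) d contributes 8 A
   ep / 2^k; the annuli sum to at most 16 A ep. The other half of [eps] is for the part away from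
   [x0]. *)
pose ep := eps / 2 / (4 + 16 * A).
have A1 : 0 < 4 + 16 * A by lra.
have ep0 : 0 < ep by rewrite !divr_gt0.
have [eta0 eta00 Heta] := lebesgue_pt_small x0_gt0 x0_lt Leb ep0.
(* The cap 1 is the range of validity of [expi_near_lower]. *)
pose eta := Num.min eta0 1.
have eta_gt0 : 0 < eta by rewrite lt_min eta00 ltr01.
have eta_le0 : eta <= eta0 by rewrite ge_min lexx.
have [m m0 Hm] := expi_far_lower x0_gt0 x0_lt (divr_gt0 eta_gt0 (ltr0Sn _ 1)).
pose V := \int[mu]_(t in T) v t.
have V0 : 0 <= V by apply: Rintegral_ge0.
have VE : (\int[mu]_(t in T) (v t)%:E)%E = V%:E.
  by rewrite /V /Rintegral fineK //; exact: integrable_fin_num.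
pose B := 2 * (1 + M) ^+ 2 / m ^+ 2.
have B0 : 0 <= B.
  by rewrite /B divr_ge0 ?sqr_ge0 // mulr_ge0 ?sqr_ge0.
have BV : 0 <= B * V by exact: mulr_ge0.
exists (Num.min eta (eps / 2 / (B * V + 1))).
  by rewrite lt_min eta_gt0; apply: divr_gt0; [exact: divr_gt0|exact: ltr_wpDl].
move=> z zS; rewrite lt_min => /andP[zeta zsmall].
have d0 := stolz_gap_gt0 zS; set d := 1 - cmod z in d0.
have dz : d <= cmod (z - expi x0).
  by rewrite cmodB /d -(cmod_expi x0) cmodBD.
pose w t := (poisson z t * v t)%:E.
have P0 t : 0 <= poisson z t := stolz_poisson_ge0 zS t.
have w0 t : (0 <= w t)%E by rewrite lee_fin mulr_ge0.
have mP : measurable_fun T (poisson z).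
  by have [] := ccont_cmeas (measurable_itv `[0, 2 * pi]) (ccont_poisson zS.1).
have mw : measurable_fun T w by apply/measurable_EFinP; exact: measurable_funM.
have mvE : measurable_fun T (fun t => (v t)%:E) by exact/measurable_EFinP.
have est S c K : measurable S -> S `<=` T -> 0 <= c -> (forall t, S t -> poisson z t <= c) ->
    (\int[mu]_(t in S) (v t)%:E <= K%:E)%E -> (\int[mu]_(t in S) w t <= (c * K)%:E)%E.
  move=> mS ST c0 Pc vK.
  apply: (@le_trans _ _ (\int[mu]_(t in S) (c%:E * (v t)%:E))%E).
    apply: ge0_le_integral => //.
    - exact: measurable_funS (measurable_itv _) ST mw.
    - by apply: measurable_funeM; exact: measurable_funS (measurable_itv _) ST mvE.
    - by move=> t St; rewrite /w -EFinM lee_fin ler_wpM2r // Pc.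
  rewrite ge0_integralZl_EFin //; last 2 first.
  - by move=> t _; rewrite lee_fin.
  - exact: measurable_funS (measurable_itv _) ST mvE.
  by rewrite EFinM lee_wpmul2l // lee_fin.
pose J k := ball x0 (2 ^+ k * d).
have mJ k : measurable (J k) by exact: measurable_ball.
have ballE s t : ball x0 s t <-> `|t - x0| < s by rewrite /ball /= distrC.
have Jle k : 2 ^+ k * d < eta ->
    (\int[mu]_(t in J k) w t <= (ep * (4 + 16 * A * (1 - (2 ^+ k)^-1)))%:E)%E.
  elim: k => [|k IH] kd.
    rewrite expr0 mul1r in kd.
    rewrite /J expr0 mul1r invr1 subrr mulr0 addr0.
    have [sub vle] := Heta d d0 (lt_le_trans kd eta_le0).
    have := est (ball x0 d) (2 / d) (2 * d * ep) (measurable_ball _ _) sub.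
    rewrite (_ : 2 / d * (2 * d * ep) = ep * 4); last by field; rewrite gt_eqF.
    apply => //; first by rewrite divr_ge0 // ltW.
    by move=> t _; exact: stolz_poisson_le zS t.
  pose s := 2 ^+ k * d.
  have s0 : 0 < s by rewrite mulr_gt0 // exprn_gt0.
  have s2 : 2 ^+ k.+1 * d = 2 * s by rewrite exprS /s mulrA.
  rewrite s2 in kd.
  have s_eta : s < eta by rewrite (le_lt_trans _ kd) // mulr_natl mulr2n lerDl ltW.
  have [sub vle] := Heta (2 * s) (mulr_gt0 (ltr0Sn _ 1) s0) (lt_le_trans kd eta_le0).
  have JS : J k `<=` J k.+1.
    move=> t; rewrite /J s2 -/s !ballE => /lt_le_trans; apply.
    by rewrite mulr_natl mulr2n lerDl ltW.
  have JT : J k.+1 `<=` T by rewrite /J s2.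
  have mD1 : measurable (J k.+1 `\` J k) by exact: measurableD.
  rewrite -(setDUK JS) ge0_integral_setU //; last 2 first.
  - by rewrite setDUK //; exact: measurable_funS (measurable_itv _) JT mw.
  - by rewrite disj_set2E setDIK.
  have -> : ep * (4 + 16 * A * (1 - (2 ^+ k.+1)^-1)) =
      ep * (4 + 16 * A * (1 - (2 ^+ k)^-1)) + 2 * d * (1 + M) ^+ 2 / (cos 1 * s) ^+ 2 * (2 * (2 * s) * ep).
    rewrite /A /s [2 ^+ k.+1]exprS; field.
    by rewrite (gt_eqF k0) (gt_eqF d0) expf_neq0.
  rewrite EFinD; apply: leeD; first by apply: IH; rewrite -/s.
  apply: est => //.
  - by apply: subset_trans JT => t [].
  - by rewrite divr_ge0 ?sqr_ge0 // mulr_ge0 ?sqr_ge0 // mulr_ge0 // ltW.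
  - move=> t [Jt nJt].
    have ts : s <= `|t - x0|.
      by rewrite leNgt; apply/negP => h; apply: nJt; rewrite /J -/s ballE.
    have t2s : `|t - x0| < 2 * s by move: Jt; rewrite /J s2 ballE.
    apply: (stolz_poisson_far M1 zS); first by rewrite mulr_gt0.
    apply: (@le_trans _ _ (cos 1 * `|t - x0|)); first by rewrite ler_wpM2l // ltW.
    apply: expi_near_lower; rewrite (le_trans (ltW (lt_trans t2s kd))) //.
    by rewrite ge_min lexx orbT.
  - apply: le_trans vle; rewrite /J s2; apply: ge0_subset_integral => //.
    + by apply: measurableD; exact: measurable_ball.
    + exact: measurable_ball.
    + exact: measurable_funS (measurable_itv _) sub mvE.
    + by move=> t _; rewrite lee_fin.
    + exact: mJ.
have deta : d < eta by exact: le_lt_trans zeta.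
(* The last dyadic interval below [eta]: outside it the distance to [x0] is at least eta / 2, the
   threshold for which [m] was chosen. *)
have [k [kd k2]] : exists k, 2 ^+ k * d < eta /\ eta <= 2 * (2 ^+ k * d).
  have ex : exists k, eta <= 2 ^+ k.+1 * d.
    exists (Num.bound (eta / d)); rewrite -ler_pdivrMr //; apply/ltW/upper_nthrootP.
    exact: leqnSn.
  case: (ex_minnP ex) => k Hk Hmin; exists k; split; last by rewrite mulrA -exprS.
  case: k Hk Hmin => [|k] Hk Hmin; first by rewrite expr0 mul1r.
  by rewrite ltNge; apply/negP => /Hmin; rewrite ltnn.
have JkT : J k `<=` T.
  by have [] := Heta _ (mulr_gt0 (exprn_gt0 k (ltr0Sn _ 1)) d0) (lt_le_trans kd eta_le0).
have mTJ : measurable (T `\` J k) by exact: measurableD.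
rewrite -(setDUK JkT) ge0_integral_setU //; last 4 first.
- exact: mJ.
- by rewrite setDUK //; exact: mw.
- by move=> t _; exact: w0.
- by rewrite disj_set2E setDIK.
rewrite [eps]splitr EFinD; apply: leeD.
  apply: le_trans (Jle k kd) _; rewrite lee_fin.
  rewrite (_ : eps / 2 = ep * (4 + 16 * A)); last by rewrite /ep; field; rewrite gt_eqF.
  rewrite ler_wpM2l ?(ltW ep0) // lerD2l mulrBr mulr1 gerBl.
  by apply: mulr_ge0; [exact: mulr_ge0|rewrite invr_ge0 exprn_ge0].
apply: (@le_trans _ _ ((B * d) * V)%:E).
  apply: est => //.
  - by rewrite mulr_ge0 // ltW.
  - move=> t [Tt nJt]; rewrite (_ : B * d = 2 * (1 - cmod z) * (1 + M) ^+ 2 / m ^+ 2); last first.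
      by rewrite /B -/d; field; rewrite gt_eqF.
    apply: (stolz_poisson_far M1 zS) => //; apply: Hm => //.
    have : 2 ^+ k * d <= `|t - x0|.
      by rewrite leNgt; apply/negP => h; apply: nJt; rewrite /J ballE.
    by lra.
  - by rewrite -VE; apply: ge0_subset_integral => // t _; rewrite lee_fin.
have dsmall : d < eps / 2 / (B * V + 1) by exact: le_lt_trans zsmall.
have BV1 : 0 < B * V + 1 by rewrite ltr_wpDl.
rewrite lee_fin mulrAC (le_trans _ (_ : (B * V + 1) * d <= _)) //.
  by rewrite ler_wpM2r ?(ltW d0) // lerDl.
by rewrite mulrC -ler_pdivlMr // ltW.
Qed.

End FatouTheorem.

(** * Fatou's theorem on nontangential limits *)

Section NontangentialLimit.
Context {R : realType}.
Local Notation C := R[i].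
Local Notation mu := (@lebesgue_measure R).
Local Notation T := (`[0, 2 * pi]%classic : set R).

Lemma ae_imply2 (P Q S : R -> Prop) : (forall x, P x -> Q x -> S x) ->
  {ae mu, forall x, P x} -> {ae mu, forall x, Q x} -> {ae mu, forall x, S x}.
Proof.
move=> H [A [mA A0 sA]] [B [mB B0 sB]]; exists (A `|` B); split.
- exact: measurableU.
- by rewrite -A0; exact: measureU0.
- move=> x /= nS; apply: contrapT => /not_orP[nA nB]; apply: nS; apply: H.
    by apply: contrapT => h; apply: nA; exact: sA.
  by apply: contrapT => h; apply: nB; exact: sB.
Qed.

Lemma ae_imply (P S : R -> Prop) : (forall x, P x -> S x) ->
  {ae mu, forall x, P x} -> {ae mu, forall x, S x}.
Proof. by move=> H h; exact: (ae_imply2 (fun x p _ => H x p) h h). Qed.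

Lemma ae_neq (a : R) : {ae mu, forall x, x != a}.
Proof.
exists [set a]; split; [exact: measurable_set1|exact: lebesgue_measure_set1|].
by move=> x /= /negP; rewrite negbK => /eqP.
Qed.

Lemma nt_cvgP (f : Cplx R -> Cplx R) (t l : C) : nt_cvg f t (l : Cplx R) <->
  forall M e, 1 < M -> 0 < e -> exists2 d, 0 < d &
    forall z, stolz t M z -> cmod (z - t) < d -> cmod (f z - l) < e.
Proof.
split=> [H M e M1 e0|H M M1].
  have : nbhs (l : Cplx R) [set u : C | cmod (u - l) < e].
    by apply/nbhs_cmodP; exists e.
  move=> /(H M M1) /within_cmodP[d d0 Hd]; exists d => // z zS zd.
  exact: Hd.
move=> A /nbhs_cmodP[e e0 He]; apply/within_cmodP.
have [d d0 Hd] := H M e M1 e0; exists d => // z zd zS.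
by apply: He; exact: Hd.
Qed.

Lemma nt_cvg_ext (f g : Cplx R -> Cplx R) (t l : C) : (forall z, disk z -> f z = g z) ->
  nt_cvg f t (l : Cplx R) -> nt_cvg g t (l : Cplx R).
Proof.
move=> fg /nt_cvgP H; apply/nt_cvgP => M e M1 e0; have [d d0 Hd] := H M e M1 e0.
by exists d => // z zS zd; rewrite -fg; [exact: Hd|exact: zS.1].
Qed.

Lemma nt_cvgD (f g : Cplx R -> Cplx R) (t l m : C) :
  nt_cvg f t (l : Cplx R) -> nt_cvg g t (m : Cplx R) ->
  nt_cvg (fun z => f z + g z) t (l + m : Cplx R).
Proof. by move=> hf hg M M1; apply: cvgD; [exact: hf|exact: hg]. Qed.

Lemma nt_cvgM (f g : Cplx R -> Cplx R) (t l m : C) :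
  nt_cvg f t (l : Cplx R) -> nt_cvg g t (m : Cplx R) ->
  nt_cvg (fun z => f z * g z) t (l * m : Cplx R).
Proof. by move=> hf hg M M1; apply: cvgM; [exact: hf|exact: hg]. Qed.

Lemma nt_cvg_cst (c t : C) : nt_cvg (fun=> c : Cplx R) t (c : Cplx R).
Proof. by move=> M M1; exact: cvg_cst. Qed.

Lemma nt_cvg_id (t : C) : nt_cvg (fun z => z : Cplx R) t (t : Cplx R).
Proof. by apply/nt_cvgP => M e M1 e0; exists e. Qed.

Lemma stolz_ray (t : C) (s M : R) : cmod t = 1 -> 0 < s -> s < 1 -> 1 < M ->
  stolz t M ((1 - s)%:C%C * t) /\ cmod ((1 - s)%:C%C * t - t) = s.
Proof.
move=> t1 s0 s1 M1.
have E1 : cmod ((1 - s)%:C%C * t : C) = 1 - s.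
  by rewrite cmodM t1 mulr1 cmodR ger0_norm // subr_ge0 ltW.
have E2 : cmod ((1 - s)%:C%C * t - t : C) = s.
  have -> : (1 - s)%:C%C * t - t = - s%:C%C * t :> C by rewrite rmorphB rmorph1; ring.
  by rewrite cmodM cmodN t1 mulr1 cmodR gtr0_norm.
split => //; split; first by rewrite /disk /= E1 gtrBl.
by rewrite E2 E1 (_ : 1 - (1 - s) = s) ?ltr_pMl //; ring.
Qed.

Lemma nt_cvg_unique (f : Cplx R -> Cplx R) (t l m : C) : cmod t = 1 ->
  nt_cvg f t (l : Cplx R) -> nt_cvg f t (m : Cplx R) -> l = m.
Proof.
move=> t1 /nt_cvgP hl /nt_cvgP hm; apply/eqP; rewrite -subr_eq0 -cmod_eq0 eq_le cmod_ge0 andbT.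
apply/ler_addgt0Pr => e e0; rewrite add0r.
have [d1 d10 H1] := hl 2 (e / 2) (ltr1n _ 2) (divr_gt0 e0 (ltr0Sn _ 1)).
have [d2 d20 H2] := hm 2 (e / 2) (ltr1n _ 2) (divr_gt0 e0 (ltr0Sn _ 1)).
pose s := Num.min (Num.min d1 d2) 1 / 2.
have m0 : 0 < Num.min (Num.min d1 d2) 1 by rewrite !lt_min d10 d20 ltr01.
have s0 : 0 < s by rewrite divr_gt0.
have sm : s < Num.min (Num.min d1 d2) 1 by rewrite /s; lra.
move: sm; rewrite !lt_min => /andP[/andP[sd1 sd2] s1].
have [zS zd] := stolz_ray t1 s0 s1 (ltr1n _ 2 : 1 < 2).
have h1 := H1 _ zS; rewrite zd in h1; have h2 := H2 _ zS; rewrite zd in h2.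
rewrite (le_trans (cmod_triangle _ (f ((1 - s)%:C%C * t)) _)) // [e]splitr lerD //.
  by rewrite cmodB ltW // h1.
by rewrite ltW // h2.
Qed.

Lemma bvalE (f : Cplx R -> Cplx R) (t l : C) : cmod t = 1 ->
  nt_cvg f t (l : Cplx R) -> bval f t = l.
Proof.
move=> t1 H; apply: (nt_cvg_unique t1 _ H).
by rewrite /bval; apply: (@getI _ [set l : Cplx R | nt_cvg f t l] l).
Qed.

(** The Poisson kernel represents f and reproduces constants, so 2 pi (f z - F x0) is the integral
    of (F - F x0) times the kernel. At a common Lebesgue point of Re F and Im F, [fatou_kernel]
    makes it small in every Stolz angle. *)
Lemma nontangential_limit (f : Cplx R -> Cplx R) (F : R -> C) :
  holomorphic f -> radial_L2_limit f F ->
  {ae mu, forall x, T x -> nt_cvg f (expi x) (F x : Cplx R)}.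
Proof.
move=> Hf lF; have LF := radial_L2_limit_L2 Hf lF.
have pi0 : 0 < 2 * pi :> R by rewrite mulr_gt0 // pi_gt0.
have L1 : L2 (fun=> 1 : C) by apply: ccont_L2; exact: ccont_cst.
have [iRe iIm] : cintble T F.
  have E : F = (fun t => F t * 1) by apply/funext => t; rewrite mulr1.
  by rewrite E; exact: (L2_cintbleM LF L1).
have aRe := lebesgue_differentiation (integrable_locally_restrict (measurable_itv _) iRe).
have aIm := lebesgue_differentiation (integrable_locally_restrict (measurable_itv _) iIm).
pose Re t := complex.Re (F t); pose Im t := complex.Im (F t).
have aRI : {ae mu, forall x, lebesgue_pt (Re \_ T) x /\ lebesgue_pt (Im \_ T) x}.
  by apply: ae_imply2 aRe aIm => x.
have aB : {ae mu, forall x, x != 0 /\ x != 2 * pi :> R}.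
  by apply: ae_imply2 (ae_neq 0) (ae_neq (2 * pi)) => x.
apply: ae_imply2 aRI aB => x0 [ptRe ptIm] [x00 x02] /= /[!in_itv] /= /andP[xge xle].
have x0_gt0 : 0 < x0 by rewrite lt_neqAle eq_sym x00.
have x0_lt : x0 < 2 * pi by rewrite lt_neqAle x02.
apply/nt_cvgP => M e M1 e0.
have e2 : 0 < e / 2 by rewrite divr_gt0.
have [d1 d10 H1] := fatou_kernel x0_gt0 x0_lt M1 iRe ptRe e2.
have [d2 d20 H2] := fatou_kernel x0_gt0 x0_lt M1 iIm ptIm e2.
exists (Num.min d1 d2); first by rewrite lt_min d10.
move=> z zS; rewrite lt_min => /andP[/(H1 z zS) K1 /(H2 z zS) K2].
have z1 : cmod z < 1 := zS.1.
have LP : L2 (fun t => (poisson z t)%:C%C) by exact/ccont_L2/ccont_poisson.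
have E : (2 * pi)%:C%C * (f z - F x0) =
    cint T (fun t => (F t - F x0) * (poisson z t)%:C%C).
  rewrite mulrBr -(poisson_representation Hf lF z1).
  have D1 (u : C) : cmod u <= 1 -> derivable (fun=> 1 : Cplx R) (u : Cplx R) 1.
    by move=> _; exact: derivable_cst.
  have := poisson_formula z1 D1.
  have cP1 : cintble T (fun t => (poisson z t)%:C%C * (1 : C)).
    by apply: ccont_cintble; apply: ccontM; [exact: ccont_poisson|exact: ccont_cst].
  rewrite mulr1 => <-; rewrite [X in _ - X]mulrC -cintZ //.
  rewrite -cintB //; last 2 first.
  - exact: L2_cintbleM.
  - exact: cintbleZ.
  by apply: eq_cint => t _; rewrite mulr1 mulrBl.
have P0 t : 0 <= poisson z t := stolz_poisson_ge0 zS t.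
have LD : L2 (fun t => F t - F x0) by apply: L2B => //; apply: ccont_L2; exact: ccont_cst.
have [i1 i2] := L2_cintbleM LD LP.
have bound (g : R -> R) : mu.-integrable T (fun t => (g t * poisson z t)%:E) ->
    (\int[mu]_(t in T) (poisson z t * `|g t|)%:E <= (e / 2)%:E)%E ->
    `|\int[mu]_(t in T) (g t * poisson z t)| <= e / 2.
  move=> ig gle; rewrite (le_trans (le_normr_Rintegral _ ig)) //.
  rewrite -lee_fin /Rintegral fineK; last by apply: integrable_fin_num => //; exact: (integrable_norm ig).
  apply: le_trans gle; rewrite le_eqVlt; apply/orP; left; apply/eqP.
  apply: eq_integral => t _; rewrite normrM (ger0_norm (P0 t)) mulrC //.
have reE t : complex.Re ((F t - F x0) * (poisson z t)%:C%C) = (Re t - Re x0) * poisson z t.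
  by rewrite mulrC ReMr ReB mulrC.
have imE t : complex.Im ((F t - F x0) * (poisson z t)%:C%C) = (Im t - Im x0) * poisson z t.
  by rewrite mulrC ImMr ImB mulrC.
have j1 : mu.-integrable T (fun t => ((Re t - Re x0) * poisson z t)%:E).
  rewrite (_ : (fun t => _) = (fun t => (complex.Re ((F t - F x0) * (poisson z t)%:C%C))%:E)) //.
  by apply/funext => t; rewrite reE.
have j2 : mu.-integrable T (fun t => ((Im t - Im x0) * poisson z t)%:E).
  rewrite (_ : (fun t => _) = (fun t => (complex.Im ((F t - F x0) * (poisson z t)%:C%C))%:E)) //.
  by apply/funext => t; rewrite imE.
have : cmod ((2 * pi)%:C%C * (f z - F x0)) <= e.
  rewrite E (le_trans (cmod_le_ReIm _)) // [e]splitr; apply: lerD => /=.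
    under eq_Rintegral do rewrite reE; exact: (bound (fun t => Re t - Re x0) j1 K1).
  under eq_Rintegral do rewrite imE; exact: (bound (fun t => Im t - Im x0) j2 K2).
rewrite cmodM cmodR gtr0_norm // mulrC -ler_pdivlMr // => /le_lt_trans; apply.
rewrite ltr_pdivrMr // ltr_pMr //.
by have := @pi_ge2 R; lra.
Qed.

End NontangentialLimit.

(** * The angular derivative *)

Section JuliaCaratheodory.
Context {R : realType}.
Local Notation C := R[i].

Lemma is_derive_eps (u : R -> R) (s d : R) :
  (forall e, 0 < e -> exists2 h, 0 < h & forall s', `|s' - s| < h ->
    `|u s' - u s - d * (s' - s)| <= e * `|s' - s|) -> is_derive s (1 : R) u d.
Proof.
move=> H; have cv : (h^-1 *: (u (h *: 1 + s) - u s)) @[h --> 0^'] --> d.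
  apply/cvgrPdist_le => e e0; have [h h0 Hh] := H e e0.
  have : nbhs (0 : R) [set v | v != 0 -> `|d - v^-1 *: (u (v *: 1 + s) - u s)| <= e].
    apply/nbhs_ballP; exists h => // v; rewrite /ball /= sub0r normrN => vh v0.
    have := Hh (v + s); rewrite addrK => /(_ vh) {}Hh.
    have v1 : 0 < `|v| by rewrite normr_gt0.
    rewrite -(ler_pM2r v1) -normrM (le_trans _ Hh) // -normrN.
    rewrite /GRing.scale /= mulr1 -mulNr opprB mulrBl mulrAC mulVf // mul1r.
    by [].
  exact.
have dv : derivable u s 1 by apply/cvg_ex; exists d.
by split => //; apply/cvg_lim.
Qed.

Variables (w : Cplx R -> Cplx R) (t0 w0 w0' : C).
Hypothesis t01 : cmod t0 = 1.
Hypothesis Hw : holomorphic w.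
Hypothesis w_lim : nt_cvg w t0 (w0 : Cplx R).
Hypothesis w01 : cmod w0 = 1.
Hypothesis dw_lim : nt_cvg (derive1 w : Cplx R -> Cplx R) t0 (w0' : Cplx R).

Let w00 : w0 != 0. Proof. by rewrite -cmod_eq0 w01 oner_eq0. Qed.
Let cV : cmod (w0^-1) = 1. Proof. by rewrite cmodV w01 invr1. Qed.

(* [w] is differentiated along the rays to [t0] of every slope [tau]: the
   first-order expansions in all these directions force [t0 w0' / w0] to be
   real, as [Re (w / w0) <= 1]. *)
Let ray (tau s : R) : C := t0 * (1 - s%:C%C * (1 +i* tau)%C).

Let K (tau : R) : R := 1 + tau ^+ 2.
Let K1 tau : 1 <= K tau. Proof. by rewrite lerDl sqr_ge0. Qed.
Let K0 tau : 0 < K tau. Proof. by rewrite (lt_le_trans _ (K1 tau)). Qed.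

Let ray_dist tau s s' : cmod (ray tau s - ray tau s') = Num.sqrt (K tau) * `|s - s'|.
Proof.
have -> : ray tau s - ray tau s' = - t0 * (1 +i* tau)%C * (s - s')%:C%C.
  by rewrite /ray rmorphB; ring.
rewrite !cmodM cmodN t01 mul1r cmodR; congr (_ * _).
by rewrite /cmod /= expr1n.
Qed.

Let ray_dist0 tau s : 0 < s -> cmod (ray tau s - t0) = Num.sqrt (K tau) * s.
Proof.
move=> s0; have E : ray tau 0 = t0 by rewrite /ray mul0r subr0 mulr1.
rewrite -[X in _ - X]E.
by rewrite ray_dist subr0 gtr0_norm.
Qed.

(** If s K <= 1 then |1 - s (1 + i tau)|^2 = 1 - 2 s + s^2 K <= 1 - s <= (1 - s / 2)^2. Thus 1 -
    |ray| >= s / 2, to be compared with the distance sqrt(K) s to the vertex. *)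
Let ray_stolz tau s : 0 < s -> s * K tau <= 1 -> stolz t0 (2 * Num.sqrt (K tau) + 1) (ray tau s).
Proof.
move=> s0 sK; have sq0 : 0 <= Num.sqrt (K tau) by exact: sqrtr_ge0.
have n1 : cmod (ray tau s) <= 1 - s / 2.
  have s1 : s <= 1 by apply: le_trans sK; rewrite ler_peMr // ltW.
  rewrite -(ler_pXn2r (n := 2)) // ?nnegrE ?cmod_ge0 //; last by lra.
  rewrite /ray cmodM t01 mul1r cmod_sqr /= !(mul0r, mul1r, subr0, add0r, addr0).
  move: sK; rewrite /K => sK.
  have : s * (s * (1 + tau ^+ 2)) <= s by rewrite ler_piMr // ltW.
  by rewrite !expr2; nra.
split; first by rewrite /disk /=; lra.
rewrite ray_dist0 //; have h : s / 2 <= 1 - cmod (ray tau s) by lra.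
apply: (lt_le_trans _ (_ : (2 * Num.sqrt (K tau) + 1) * (s / 2) <= _)); last first.
  by rewrite ler_wpM2l // addr_ge0 // mulr_ge0.
by rewrite mulrDl mul1r (_ : _ * _ * (s / 2) = Num.sqrt (K tau) * s) ?ltrDl ?divr_gt0 //; field.
Qed.

Let u tau s : R := complex.Re (w (ray tau s) / w0).
Let slope tau : R := complex.Re ((1 +i* tau)%C * (t0 * (w0' / w0))).

Let u_derive tau s : 0 < s -> s * K tau <= 1 ->
  is_derive s (1 : R) (u tau) (complex.Re (derive1 w (ray tau s) / w0 * (- t0 * (1 +i* tau)%C))).
Proof.
move=> s0 sK; apply: is_derive_eps => e e0.
have sq0 : 0 < Num.sqrt (K tau) by rewrite sqrtr_gt0.
have [h h0 Hh] := derivable_cder (Hw (ray_stolz s0 sK).1) (divr_gt0 e0 sq0).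
exists (h / Num.sqrt (K tau)); first by rewrite divr_gt0.
move=> s' s'h; have D : cmod (ray tau s' - ray tau s) < h.
  by rewrite ray_dist mulrC -ltr_pdivlMr.
have := Hh _ D; rewrite ray_dist => H.
have -> : u tau s' - u tau s - complex.Re (derive1 w (ray tau s) / w0 * (- t0 * (1 +i* tau)%C)) * (s' - s) =
    complex.Re ((w (ray tau s') - w (ray tau s) - derive1 w (ray tau s) * (ray tau s' - ray tau s)) / w0).
  rewrite /u [complex.Re _ * _]mulrC -ReMr -!ReB; congr complex.Re.
  by rewrite /ray rmorphB; ring.
rewrite (le_trans (Re_le_cmod _)) // cmodM cV mulr1 (le_trans H) //.
by rewrite mulrA divfK // gt_eqF.
Qed.

(** Along the ray u' tends to -slope, by the limit of w'. The value of [w] at t0 itself is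
    arbitrary, so the mean value theorem is applied on [s1, s] with s1 > 0, and u(s1) is sent to 1
    by the limit of w. *)
Lemma julia_ray tau e : 0 < e -> exists2 del, 0 < del & forall s, 0 < s -> s < del ->
  `|1 - u tau s - s * slope tau| <= e * s.
Proof.
move=> e0; have sq0 : 0 < Num.sqrt (K tau) by rewrite sqrtr_gt0.
pose M := 2 * Num.sqrt (K tau) + 1.
have M1 : 1 < M by rewrite ltrDr mulr_gt0.
pose n := cmod ((1 +i* tau)%C : C).
have n0 : 0 < n by rewrite /n cmod_gt0 eq_complex /= oner_eq0.
have [d1 d10 H1] := (nt_cvgP _ _ _).1 dw_lim M (e / n) M1 (divr_gt0 e0 n0).
pose del := Num.min (K tau)^-1 (d1 / Num.sqrt (K tau)).
exists del; first by rewrite lt_min invr_gt0 K0 divr_gt0.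
have ok s : 0 < s -> s < del -> [/\ s * K tau <= 1, stolz t0 M (ray tau s) &
    `|complex.Re (derive1 w (ray tau s) / w0 * (- t0 * (1 +i* tau)%C)) + slope tau| <= e].
  move=> s0; rewrite lt_min => /andP[sK sd].
  have sK1 : s * K tau <= 1 by rewrite -ler_pdivlMr // mul1r ltW.
  have zS := ray_stolz s0 sK1; split => //.
  have zd : cmod (ray tau s - t0) < d1 by rewrite ray_dist0 // mulrC -ltr_pdivlMr.
  have := H1 _ zS zd => H.
  rewrite /slope -ReD (le_trans (Re_le_cmod _)) //.
  have -> : derive1 w (ray tau s) / w0 * (- t0 * (1 +i* tau)%C) + (1 +i* tau)%C * (t0 * (w0' / w0)) =
      (derive1 w (ray tau s) - w0') * (- t0 * w0^-1 * (1 +i* tau)%C) by ring.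
  rewrite cmodM [X in _ * X]cmodM cmodM cmodN t01 cV !mul1r -/n.
  by rewrite -ler_pdivlMr // ltW.
move=> s s0 sdel; apply/ler_addgt0Pr => eta eta0.
have eta2 : 0 < eta / 2 by rewrite divr_gt0.
have [d2 d20 H2] := (nt_cvgP _ _ _).1 w_lim M (eta / 2) M1 eta2.
pose B := `|slope tau| + 1.
have B0 : 0 < B by rewrite ltr_wpDl.
(* The three entries give s1 < s, bring u(s1) within eta / 2 of 1, and make s1 |slope| at most eta /
   2. *)
pose s1 := Num.min (s / 2) (Num.min (d2 / Num.sqrt (K tau) / 2) (eta / 2 / B)).
have s10 : 0 < s1 by rewrite !lt_min !divr_gt0.
have s1s : s1 < s.
  by rewrite (@le_lt_trans _ _ (s / 2)) ?ge_min ?lexx // ltr_pdivrMr // ltr_pMr // ltr1n.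
have s1d2 : s1 < d2 / Num.sqrt (K tau).
  rewrite (@le_lt_trans _ _ (d2 / Num.sqrt (K tau) / 2)) ?ge_min ?lexx ?orbT //.
  by rewrite ltr_pdivrMr // ltr_pMr ?ltr1n // divr_gt0.
have s1B : s1 * B <= eta / 2.
  by rewrite -ler_pdivlMr // !ge_min lexx !orbT.
have [_ z1S _] := ok s1 s10 (lt_trans s1s sdel).
have z1d : cmod (ray tau s1 - t0) < d2 by rewrite ray_dist0 // mulrC -ltr_pdivlMr.
have u1 : `|u tau s1 - 1| <= eta / 2.
  have -> : u tau s1 - 1 = complex.Re ((w (ray tau s1) - w0) / w0).
    by rewrite mulrBl mulfV // ReB.
  by rewrite (le_trans (Re_le_cmod _)) // cmodM cV mulr1 ltW // H2.
have der x : x \in `]s1, s[ -> is_derive x (1 : R) (u tau)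
    (complex.Re (derive1 w (ray tau x) / w0 * (- t0 * (1 +i* tau)%C))).
  rewrite in_itv /= => /andP[x1 x2]; have x0 := lt_trans s10 x1.
  by apply: u_derive => //; have [] := ok x x0 (lt_trans x2 sdel).
have cu : {within `[s1, s], continuous (u tau)}.
  apply: derivable_within_continuous => x; rewrite in_itv /= => /andP[x1 x2].
  have x0 := lt_le_trans s10 x1; have [xK _ _] := ok x x0 (le_lt_trans x2 sdel).
  exact: (@ex_derive _ _ _ _ _ _ _ (u_derive x0 xK)).
have [xi /[!in_itv] /= /andP[x1 x2] E] := MVT s1s der cu.
have [_ _ Hxi] := ok xi (lt_trans s10 x1) (lt_trans x2 sdel).
set D := complex.Re _ in E Hxi.
have -> : 1 - u tau s - s * slope tau =
    - ((D + slope tau) * (s - s1)) - (u tau s1 - 1) - s1 * slope tau.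
  have -> : u tau s = u tau s1 + D * (s - s1) by rewrite -E; ring.
  by ring.
have b1 : `|(D + slope tau) * (s - s1)| <= e * s.
  rewrite normrM; apply: ler_pM => //; rewrite ger0_norm; lra.
have b2 : `|s1 * slope tau| <= eta / 2.
  apply: le_trans s1B; rewrite normrM gtr0_norm // ler_wpM2l ?(ltW s10) // lerDl //.
rewrite (le_trans (ler_normB _ _)) // [eta]splitr addrA lerD //.
by rewrite (le_trans (ler_normB _ _)) // normrN lerD.
Qed.

End JuliaCaratheodory.

(** * Hardy space H2 *)

Section Hardy.
Context {R : realType}.
Local Notation C := R[i].
Local Notation mu := (@lebesgue_measure R).
Local Notation T := (`[0, 2 * pi]%classic : set R).

Lemma two_pi_gt0 : 0 < 2 * pi :> R.
Proof. by rewrite mulr_gt0 // pi_gt0. Qed.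

Lemma circ_int_le (g : R -> \bar R) (G : Cplx R -> \bar R) (M : R) :
  (forall x, G (expi x) = g x) ->
  (circ_int G <= M%:E)%E <-> (\int[mu]_(x in T) g x <= (2 * pi * M)%:E)%E.
Proof.
move=> E; rewrite /circ_int; under eq_integral do rewrite E.
by rewrite lee_pdivrMl ?two_pi_gt0 // -EFinM.
Qed.

Lemma hardy2P (f : Cplx R -> Cplx R) : hardy2 f <-> holomorphic f /\
  exists M, forall r, 0 <= r -> r < 1 -> \int[mu]_(t in T) (cmod (radial f r t) ^+ 2) <= M.
Proof.
split=> -[Hf [M HM]]; split => //.
  exists (2 * pi * M) => r r0 r1; have := HM r r0 r1.
  rewrite (circ_int_le (g := fun t => (cmod (radial f r t) ^+ 2)%:E)) // EFin_Rint_cont ?lee_fin //.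
  exact/ccont_sqr/ccont_radial.
exists (M / (2 * pi)) => r r0 r1.
rewrite (circ_int_le (g := fun t => (cmod (radial f r t) ^+ 2)%:E)) // EFin_Rint_cont ?lee_fin //.
  have -> : 2 * pi * (M / (2 * pi)) = M by rewrite mulrCA mulfV ?mulr1 // gt_eqF ?two_pi_gt0.
  exact: HM.
exact/ccont_sqr/ccont_radial.
Qed.

Lemma hardy2_radial_limit (f : Cplx R -> Cplx R) : hardy2 f ->
  exists F, radial_L2_limit f F.
Proof.
by move=> /hardy2P[Hf [M HM]]; have [F HF] := radial_limit Hf HM; exists F.
Qed.

Lemma bounded_hardy2 (f : Cplx R -> Cplx R) : holomorphic f ->
  (forall z, disk z -> cmod (f z) <= 1) -> hardy2 f.
Proof.
move=> Hf f1; apply/hardy2P; split => //; exists (1 * (2 * pi - 0)) => r r0 r1.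
rewrite -Rint_cst ?two_pi_ge0 //; apply: le_Rintegral => //.
- exact/continuous_integrable/ccont_sqr/ccont_radial.
- exact/continuous_integrable/cst_continuous.
move=> t _; rewrite exprn_ile1 ?cmod_ge0 // f1 //; exact: radial_disk.
Qed.

Lemma hardy2D (f g : Cplx R -> Cplx R) : hardy2 f -> hardy2 g ->
  hardy2 (fun z => f z + g z).
Proof.
move=> /hardy2P[Hf [M HM]] /hardy2P[Hg [N HN]]; apply/hardy2P; split.
  by move=> z zD; apply: derivableD; [exact: Hf|exact: Hg].
exists (2 * (M + N)) => r r0 r1.
have cf := ccont_radial Hf r0 r1; have cg := ccont_radial Hg r0 r1.
have i1 := continuous_integrable 0 (2 * pi) (ccont_sqr cf).
have i2 := continuous_integrable 0 (2 * pi) (ccont_sqr cg).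
have i3 := continuous_integrable 0 (2 * pi) (ccont_sqr (ccontD cf cg)).
have i4 : mu.-integrable T (fun t => (cmod (radial f r t) ^+ 2 + cmod (radial g r t) ^+ 2)%:E).
  exact: (@integrableD _ _ _ mu T (measurable_itv _) _ _ i1 i2).
apply: (@le_trans _ _ (\int[mu]_(t in T) (2 * (cmod (radial f r t) ^+ 2 + cmod (radial g r t) ^+ 2)))).
  apply: le_Rintegral => //; first exact: integrableZE.
  by move=> t _; exact: cmod_sqr_half_add.
rewrite RintegralZl // RintegralD // ler_wpM2l // lerD //; [exact: HM|exact: HN].
Qed.

Lemma hardy2M_bounded (f g : Cplx R -> Cplx R) : holomorphic g ->
  (forall z, disk z -> cmod (g z) <= 1) -> hardy2 f -> hardy2 (fun z => g z * f z).
Proof.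
move=> Hg g1 /hardy2P[Hf [M HM]].
have Hgf : holomorphic (fun z => g z * f z).
  by move=> z zD; apply: derivableM; [exact: Hg|exact: Hf].
apply/hardy2P; split => //; exists M => r r0 r1; apply: le_trans (HM r r0 r1).
apply: le_Rintegral => //.
- exact/continuous_integrable/ccont_sqr/ccont_radial.
- exact/continuous_integrable/ccont_sqr/ccont_radial.
move=> t _; rewrite /radial cmodM exprMn ler_piMl ?exprn_ge0 ?cmod_ge0 //.
by rewrite exprn_ile1 ?cmod_ge0 // g1 //; exact: radial_disk.
Qed.

End Hardy.

(** * Reality and sign of the angular derivative, and the difference quotient *)

Section JuliaConsequences.
Context {R : realType}.
Local Notation C := R[i].
Local Notation mu := (@lebesgue_measure R).
Local Notation T := (`[0, 2 * pi]%classic : set R).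
Variables (w : Cplx R -> Cplx R) (t0 w0 w0' : C).
Hypothesis t01 : cmod t0 = 1.
Hypothesis Hw : holomorphic w.
Hypothesis w_le1 : forall z, disk z -> cmod (w z) <= 1.
Hypothesis w_lim : nt_cvg w t0 (w0 : Cplx R).
Hypothesis w01 : cmod w0 = 1.
Hypothesis dw_lim : nt_cvg (derive1 w : Cplx R -> Cplx R) t0 (w0' : Cplx R).

Let L : C := t0 * (w0' / w0).

Definition unimodular_normalization (z : Cplx R) : Cplx R := w z / w0.
Local Notation W := unimodular_normalization.

Lemma normalization_holomorphic : holomorphic W.
Proof. by move=> z zD; apply: derivableM; [exact: Hw|exact: derivable_cst]. Qed.

Lemma normalization_le1 z : disk z -> cmod (W z) <= 1.
Proof. by move=> zD; rewrite cmodM cmodV w01 invr1 mulr1 w_le1. Qed.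

Let Re_W_le1 z : disk z -> complex.Re (W z) <= 1.
Proof.
by move=> zD; rewrite (le_trans (ler_norm _)) // (le_trans (Re_le_cmod _)) // normalization_le1.
Qed.

Let dilation_disk s : 0 < s -> s <= 1 -> @disk R ((1 - s)%:C%C * t0).
Proof.
by move=> s0 s1; rewrite /disk /= cmodM t01 mulr1 cmodR ger0_norm ?subr_ge0 // gtrBl.
Qed.

(** A negative value would give Re W > 1 at points of the disk on the ray of slope [tau], by
    [julia_ray]. *)
Lemma julia_halfplane tau : 0 <= complex.Re ((1 +i* tau)%C * L).
Proof.
set y := complex.Re _; rewrite leNgt; apply/negP => neg.
have e0 : 0 < - y / 2 by rewrite divr_gt0 // oppr_gt0.
have [del del0 H] := julia_ray t01 Hw w_lim w01 dw_lim tau e0.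
pose s := Num.min del (1 + tau ^+ 2)^-1 / 2.
have K0 : 0 < 1 + tau ^+ 2 by rewrite ltr_pwDl ?sqr_ge0.
have m0 : 0 < Num.min del (1 + tau ^+ 2)^-1 by rewrite lt_min del0 invr_gt0.
have s0 : 0 < s by rewrite divr_gt0.
have : s < Num.min del (1 + tau ^+ 2)^-1 by rewrite ltr_pdivrMr // ltr_pMr // ltr1n.
rewrite lt_min => /andP[sd sK].
have sK1 : s * (1 + tau ^+ 2) < 1 by rewrite -ltr_pdivlMr // mul1r.
have zD : @disk R (t0 * (1 - s%:C%C * (1 +i* tau)%C)).
  rewrite /disk /= cmodM t01 mul1r -(ltr_pXn2r (n := 2)) // ?nnegrE ?cmod_ge0 //.
  rewrite expr1n cmod_sqr /= !(mul0r, mul1r, subr0, add0r, addr0, mulr1).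
  have : s * (s * (1 + tau ^+ 2)) < s by rewrite gtr_pMr.
  by rewrite !expr2; nra.
have := H s s0 sd; rewrite -/L -/y => /(le_trans (ler_norm _)).
have := Re_W_le1 zD; rewrite /W; set x := complex.Re _ => x1 Hs.
have : - (s * y) <= - y / 2 * s by apply: le_trans Hs; rewrite lerDr subr_ge0.
have : s * y < 0 by rewrite nmulr_llt0.
by lra.
Qed.

(** Re L - tau Im L is nonnegative for every real tau; if Im L were nonzero, the chosen [tau] would
    make it -1. *)
Lemma julia_real : complex.Im L = 0.
Proof.
apply/eqP/negPn/negP => L0; pose tau := (complex.Re L + 1) / complex.Im L.
have := julia_halfplane tau; rewrite ReM /= mul1r /tau divfK //.
by rewrite opprD addNKr oppr_ge0 ler10.
Qed.

Lemma julia_nonneg : 0 <= complex.Re L.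
Proof. by have := julia_halfplane 0; rewrite ReM /= mul1r mul0r subr0. Qed.

Lemma julia_radial e : 0 < e -> exists2 del, 0 < del & forall s, 0 < s -> s < del ->
  1 - complex.Re (W ((1 - s)%:C%C * t0)) <= (complex.Re L + e) * s.
Proof.
move=> e0; have [del del0 H] := julia_ray t01 Hw w_lim w01 dw_lim 0 e0.
exists del => // s s0 sd; have := H s s0 sd; rewrite -/L.
have -> : t0 * (1 - s%:C%C * (1 +i* 0)%C) = (1 - s)%:C%C * t0.
  by rewrite (_ : (1 +i* 0)%C = 1 :> C) // mulr1 mulrC rmorphB rmorph1.
rewrite (_ : (1 +i* 0)%C = 1 :> C) // mul1r => /(le_trans (ler_norm _)).
by rewrite /W; lra.
Qed.

Definition difference_quotient (z : Cplx R) : Cplx R := (W z - 1) / (z - t0).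
Local Notation h := difference_quotient.

Lemma disk_sub_neq0 (z : C) : disk z -> z - t0 != 0.
Proof. by rewrite subr_eq0; apply: contraTneq => ->; rewrite /disk /= t01 ltxx. Qed.

Lemma derivable_inv_sub (z : Cplx R) : disk z -> derivable (fun z : Cplx R => (z - t0)^-1 : Cplx R) z 1.
Proof.
move=> zD; apply: derivableV; first exact: disk_sub_neq0.
by apply: derivableB; [exact: derivable_id|exact: derivable_cst].
Qed.

Lemma difference_quotient_holomorphic : holomorphic h.
Proof.
move=> z zD; have D1 : derivable (fun v : Cplx R => W v - (1 : Cplx R)) z 1.
  exact: (derivableB (normalization_holomorphic zD) (@derivable_cst _ _ _ (1 : Cplx R) z 1)).
exact: (derivableM D1 (derivable_inv_sub zD)).
Qed.

Lemma normalization_sqr_le (z : C) : cmod z <= 1 -> cmod (z - 1) ^+ 2 <= 2 * (1 - complex.Re z).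
Proof.
move=> z1; have : cmod z ^+ 2 <= 1 by rewrite exprn_ile1 ?cmod_ge0.
by rewrite !cmod_sqr ReB ImB /= subr0 !expr2; lra.
Qed.

Lemma poisson_Re_formula (q : Cplx R -> Cplx R) (z : C) : cmod z < 1 ->
  (forall u : C, cmod u <= 1 -> derivable q u 1) ->
  \int[mu]_(t in T) (poisson z t * (1 - complex.Re (q (expi t)))) =
  2 * pi * (1 - complex.Re (q z)).
Proof.
move=> z1 Hq; pose q1 (u : Cplx R) : Cplx R := 1 - q u.
have Hq1 (u : C) : cmod u <= 1 -> derivable q1 u 1.
  by move=> u1; apply: derivableB; [exact: derivable_cst|exact: Hq].
have := congr1 (@complex.Re R) (poisson_formula z1 Hq1).
rewrite ReMr /q1 ReB /= => <-.
by apply: eq_Rintegral => t _; rewrite ReMr ReB.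
Qed.

(** This turns the denominator of h on the circle of radius r into that of the Poisson kernel at r
    t0. *)
Lemma dilation_dist r t : cmod (r%:C%C * expi t - t0) = cmod (expi t - r%:C%C * t0).
Proof.
have te := expi_neq0 t; have J := expiJ t; have t0J : t0 * conjc t0 = 1 by rewrite mulcJ t01 expr1n.
rewrite -[LHS]mul1r -{1}t01 -(cmodJ t0) -[RHS]mulr1 -(cmod_expi (- t)) -!cmodM -[LHS]cmodJ.
rewrite conjcM conjcK conjcB conjcM conjc_real.
have -> : expi (- t) = conjc (expi t) :> C by rewrite /expi cosN sinN.
have -> : t0 * (r%:C%C * conjc (expi t) - conjc t0) = r%:C%C * t0 * conjc (expi t) - 1.
  by rewrite -t0J; ring.
by rewrite mulrBl J cmodB.
Qed.

(** From |W - 1|^2 <= 2 (1 - Re W), the mean of |h|^2 on radius r is bounded by a Poisson integral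
    that is evaluated exactly at r^2 t0; there [julia_radial] applies with s = 1 - r^2. *)
Lemma difference_quotient_hardy2 : hardy2 h.
Proof.
apply/hardy2P; split; first exact: difference_quotient_holomorphic.
have L0 := julia_nonneg; have tp := two_pi_gt0 (R := R).
have [del del0 H] := julia_radial ltr01.
(* For s < del the radial estimate gives Re L + 1; for s >= del the trivial 1 - Re W <= 2 gives 2 /
   del. *)
exists (4 * pi * (complex.Re L + 1 + 2 / del)) => r r0 r1.
pose z : C := r%:C%C * t0.
have z1 : cmod z < 1 by rewrite cmodM t01 mulr1 cmodR ger0_norm.
have cz : cmod z = r by rewrite cmodM t01 mulr1 cmodR ger0_norm.
have Wr (u : C) : cmod u <= 1 -> derivable (fun v : Cplx R => W (r%:C%C * v) : Cplx R) u 1.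
  by move=> u1; exact: (@derivable_dilation _ W normalization_holomorphic r u r0 r1 u1).
have rr : 0 < 1 - r ^+ 2 by rewrite subr_gt0 exprn_ilt1.
have PW : \int[mu]_(t in T) (poisson z t * (1 - complex.Re (radial W r t))) =
    2 * pi * (1 - complex.Re (W (r%:C%C * z))) := poisson_Re_formula z1 Wr.
have cW : ccont (radial W r) by exact: (ccont_radial normalization_holomorphic r0 r1).
have cP : continuous (poisson z) by have [] := ccont_poisson z1.
have cPW : continuous (fun t => poisson z t * (1 - complex.Re (radial W r t))).
  move=> t; apply: cvgM; first exact: cP.
  by apply: cvgB; [exact: cvg_cst|exact: cW.1].
apply: (@le_trans _ _ (2 / (1 - r ^+ 2) * \int[mu]_(t in T) (poisson z t * (1 - complex.Re (radial W r t))))).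
  rewrite -RintegralZl //; last exact: continuous_integrable.
  apply: le_Rintegral => //.
  - exact: (continuous_integrable _ _ (ccont_sqr (ccont_radial difference_quotient_holomorphic r0 r1))).
  - by apply: integrableZE => //; exact: continuous_integrable.
  move=> t _; have zD : @disk R (r%:C%C * expi t) by exact: radial_disk.
  rewrite /radial /h cmodM cmodV exprMn dilation_dist -/z /poisson cz exprVn.
  have -> : 2 / (1 - r ^+ 2) * ((1 - r ^+ 2) / cmod (expi t - z) ^+ 2 * (1 - complex.Re (W (r%:C%C * expi t)))) =
     2 * (1 - complex.Re (W (r%:C%C * expi t))) / cmod (expi t - z) ^+ 2.
    have n1 : cmod (expi t - z) != 0 by rewrite cmod_eq0 unit_sub_neq0.
    by field; rewrite n1 gt_eqF.
  rewrite ler_wpM2r ?invr_ge0 ?exprn_ge0 ?cmod_ge0 //.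
  by apply: normalization_sqr_le; exact: normalization_le1.
rewrite PW; pose s := 1 - r ^+ 2.
have -> : r%:C%C * z = (1 - s)%:C%C * t0.
  by rewrite /s /z mulrA -rmorphM /=; congr (_%:C%C * _); ring.
have s1 : s <= 1 by rewrite /s gerBl sqr_ge0.
rewrite -/s; have s0 : 0 < s by [].
have key : 1 - complex.Re (W ((1 - s)%:C%C * t0)) <= (complex.Re L + 1 + 2 / del) * s.
  have [sd|ds] := ltP s del.
    by apply: (le_trans (H s s0 sd)); rewrite ler_wpM2r ?(ltW s0) // lerDl divr_ge0 // ltW.
  apply: (@le_trans _ _ 2).
    have := Re_le_cmod (W ((1 - s)%:C%C * t0)); have := normalization_le1 (dilation_disk s0 s1).
    by rewrite ler_norml; lra.
  rewrite -ler_pdivrMr // (le_trans (_ : _ <= 2 / del)) ?lerDr ?addr_ge0 //.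
  by rewrite ler_wpM2l // lef_pV2.
rewrite (_ : 2 / s * (2 * pi * _) = 4 * pi * ((1 - complex.Re (W ((1 - s)%:C%C * t0))) / s)); last by field; rewrite gt_eqF.
rewrite ler_wpM2l ?mulr_ge0 ?pi_ge0 // ler_pdivrMr //.
Qed.

End JuliaConsequences.

Section NonMeasurableComparison.
Context {R : realType}.
Local Notation mu := (@lebesgue_measure R).
Import HBNNSimple.

(* The integral of a nonnegative function is defined as a supremum over simple
   functions even when the function is not measurable, which is the case of
   [bval], defined only up to a null set; no measurability is needed here. *)
Lemma ae_le_integral (D : set R) (G1 G2 : R -> \bar R) :
  (forall x, D x -> 0 <= G1 x)%E -> (forall x, D x -> 0 <= G2 x)%E ->
  {ae mu, forall x, D x -> (G1 x <= G2 x)%E} ->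
  (\int[mu]_(x in D) G1 x <= \int[mu]_(x in D) G2 x)%E.
Proof.
move=> G10 G20 [N [mN N0 sN]]; rewrite !ge0_integralE //.
apply: ge_ereal_sup => _ [h /= hG1 <-].
have mNC : measurable (~` N) by exact: measurableC.
apply: le_ereal_sup_tmp; exists (sintegral mu (proj_nnsfun h mNC)).
  exists (proj_nnsfun h mNC) => //= x; rewrite /mindic indicE.
  have [xN|xN] := boolP (x \in ~` N); last first.
    by rewrite mulr0 /patch; case: ifPn => // /set_mem; exact: G20.
  rewrite mulr1 (le_trans (hG1 x)) // /patch; case: ifPn => // /set_mem Dx.
  by apply: contrapT => H; move/set_mem: xN; apply; apply: sN => /= /(_ Dx).
rewrite -!integralT_nnsfun le_eqVlt; apply/orP; left; apply/eqP.
apply: ge0_ae_eq_integral => //.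
- exact/measurable_EFinP.
- exact/measurable_EFinP.
- by move=> x _; rewrite lee_fin.
- by move=> x _; rewrite lee_fin.
- exists N; split => // x /= H; apply: contrapT => xN; apply: H => _.
  by rewrite /= /mindic indicE mem_set // mulr1.
Qed.

End NonMeasurableComparison.

(** * The boundary integral of 1 - Re W *)

Section BoundaryBound.
Context {R : realType}.
Local Notation C := R[i].
Local Notation mu := (@lebesgue_measure R).
Local Notation T := (`[0, 2 * pi]%classic : set R).

(* [y / (y^2 + 1/n)] converges to [y^-1] even at [y = 0], where [y^-1 = 0]. *)
Lemma measurable_inv_cont (D : set R) (g : R -> R) : measurable D -> continuous g ->
  measurable_fun D (fun x => (g x)^-1).
Proof.
move=> mD cg.
have pos (y : R) n : 0 < y ^+ 2 + n.+1%:R^-1 by rewrite ltr_wpDl ?sqr_ge0 // invr_gt0 ltr0n.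
apply: (measurable_fun_cvg (h := fun n x => g x / (g x ^+ 2 + n.+1%:R^-1))) => [n|x _].
  apply: measurable_funS measurableT (@subsetT _ _) _; apply: continuous_measurable_fun => x.
  apply: cvgM; first exact: cg.
  apply: cvgV; first by rewrite gt_eqF.
  by apply: cvgD; [rewrite expr2; under eq_fun do rewrite expr2; apply: cvgM; exact: cg|exact: cvg_cst].
have [->|g0] := eqVneq (g x) 0.
  by rewrite invr0; under eq_fun do rewrite mul0r; exact: cvg_cst.
have -> : (g x)^-1 = g x / (g x ^+ 2 + 0) by rewrite addr0 expr2 invfM mulVKf.
apply: cvgM; first exact: cvg_cst.
apply: cvgV; first by rewrite addr0 expf_neq0.
by apply: cvgD; [exact: cvg_cst|exact: cvg_harmonic].
Qed.

Lemma ae_expi_neq (t0 : C) : {ae mu, forall x, T x -> expi x != t0}.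
Proof.
have aB : {ae mu, forall x, x != 0 /\ x != 2 * pi :> R}.
  by apply: ae_imply2 (ae_neq 0) (ae_neq (2 * pi)) => x.
have inT (x : R) : T x -> x != 0 -> x != 2 * pi -> 0 < x /\ x < 2 * pi.
  rewrite /= in_itv /= => /andP[x0 x1] n0 n1.
  by split; rewrite lt_neqAle ?x0 ?x1 ?n1 // eq_sym n0.
have [[x1 [x10 x11 E]]|no] := pselect (exists x1, [/\ 0 < x1, x1 < 2 * pi & expi x1 = t0]).
  apply: ae_imply2 aB (ae_neq x1) => x [n0 n1] nx Tx.
  have [xp xl] := inT x Tx n0 n1; apply: contra nx => /eqP; rewrite -E => /expi_inj -> //.
  by rewrite ltr_norml; apply/andP; split; lra.
apply: ae_imply aB => x [n0 n1] Tx; apply/negP => /eqP E; apply: no.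
by have [? ?] := inT x Tx n0 n1; exists x.
Qed.

Variables (W : Cplx R -> Cplx R) (t0 : C) (l : R) (Ws : R -> C).
Hypothesis t01 : cmod t0 = 1.
Hypothesis HW : holomorphic W.
Hypothesis W1 : forall z, disk z -> cmod (W z) <= 1.
Hypothesis l0 : 0 <= l.
Hypothesis W_radial : forall e, 0 < e -> exists2 del, 0 < del & forall s, 0 < s -> s < del ->
  1 - complex.Re (W ((1 - s)%:C%C * t0)) <= (l + e) * s.
Hypothesis lW : radial_L2_limit W Ws.

Lemma boundary_le1 : {ae mu, forall x, T x -> cmod (Ws x) <= 1}.
Proof.
apply: ae_imply (nontangential_limit HW lW) => x H Tx.
have /nt_cvgP lim := H Tx.
apply/ler_addgt0Pr => e e0; have [d d0 Hd] := lim 2 e (ltr1n _ 2) e0.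
pose s := Num.min d 1 / 2.
have m0 : 0 < Num.min d 1 by rewrite lt_min d0 ltr01.
have s0 : 0 < s by rewrite divr_gt0.
have : s < Num.min d 1 by rewrite ltr_pdivrMr // ltr_pMr // ltr1n.
rewrite lt_min => /andP[sd s1].
have [zS zd] := stolz_ray (cmod_expi x) s0 s1 (ltr1n _ 2 : 1 < 2).
have := Hd _ zS; rewrite zd => /(_ sd) H1.
have := W1 zS.1; have := cmodBD (Ws x) (W ((1 - s)%:C%C * expi x)).
by move: H1; rewrite cmodB; lra.
Qed.

(** The shift by 2 keeps every [s_ n] strictly below 1, so the points [zn n] lie on the open radius
    towards t0. *)
Let s_ n : R := n.+2%:R^-1.

Let s_gt0 n : 0 < s_ n. Proof. by rewrite invr_gt0 ltr0n. Qed.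
Let s_lt1 n : s_ n < 1. Proof. by rewrite invf_lt1 ?ltr1n // ltr0n. Qed.

Let zn n : C := (1 - s_ n)%:C%C * t0.
Let zn1 n : cmod (zn n) < 1.
Proof. by rewrite cmodM t01 mulr1 cmodR ger0_norm ?gtrBl // subr_ge0 ltW. Qed.
Let czn n : cmod (zn n) = 1 - s_ n.
Proof. by rewrite cmodM t01 mulr1 cmodR ger0_norm // subr_ge0 ltW. Qed.

Lemma poisson_integral_Re (z : C) : cmod z < 1 ->
  mu.-integrable T (fun t => ((1 - complex.Re (Ws t)) * poisson z t)%:E) /\
  \int[mu]_(t in T) ((1 - complex.Re (Ws t)) * poisson z t) = 2 * pi * (1 - complex.Re (W z)).
Proof.
move=> z1; have LW := radial_L2_limit_L2 HW lW.
have LP : L2 (fun t => (poisson z t)%:C%C) by exact/ccont_L2/ccont_poisson.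
have cP : continuous (poisson z) by have [] := ccont_poisson z1.
have iP := continuous_integrable 0 (2 * pi) cP.
have [iWP _] := L2_cintbleM LW LP.
have H1 := congr1 (@complex.Re R) (poisson_representation HW lW z1).
have D1 (u : C) : cmod u <= 1 -> derivable (fun=> 1 : Cplx R) (u : Cplx R) 1.
  by move=> _; exact: derivable_cst.
have H2 := congr1 (@complex.Re R) (poisson_formula z1 D1).
rewrite !ReMr /= in H1 H2.
have E t : (1 - complex.Re (Ws t)) * poisson z t =
    poisson z t - complex.Re (Ws t * (poisson z t)%:C%C).
  by rewrite [Ws t * _]mulrC ReMr; ring.
split.
  rewrite (_ : (fun t => _) = (fun t => (poisson z t - complex.Re (Ws t * (poisson z t)%:C%C))%:E)).
    exact: (@integrableB _ _ _ mu T (measurable_itv _) _ _ iP iWP).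
  by apply/funext => t; rewrite E.
under eq_Rintegral do rewrite E.
rewrite RintegralB // H1 mulrBr mulr1; congr (_ - _).
by rewrite mulr1 in H2; rewrite -[RHS]H2; apply: eq_Rintegral => t _ /=; ring.
Qed.

(* Fatou's lemma for the Poisson integrals of [1 - Re W] at the radial points
   [(1 - s) t0]: as [s -> 0], the kernel divided by [s] tends to [2 / |e - t0|^2]. *)
Let bound_eta eta : 0 < eta -> eta <= 1 ->
  (\int[mu]_(t in T) (2 * `|1 - complex.Re (Ws t)| * (cmod (expi t - t0) ^+ 2)^-1)%:E <=
    (2 * pi * (l + eta) * (1 + eta))%:E)%E.
Proof.
move=> eta0 eta1; have LW := radial_L2_limit_L2 HW lW.
have cd w : continuous (fun t : R => cmod (expi t - w) ^+ 2).
  by apply: ccont_sqr; apply: ccontB; [exact: ccont_expi|exact: ccont_cst].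
have mabs : measurable_fun T (fun t => 2 * `|1 - complex.Re (Ws t)|).
  apply: measurable_funM => //; apply: measurableT_comp => //.
  by apply: measurable_funB => //; exact: LW.1.1.
pose g n t := 2 * `|1 - complex.Re (Ws t)| * (cmod (expi t - zn n) ^+ 2)^-1.
have mg n : measurable_fun T (g n).
  by apply: measurable_funM => //; exact: measurable_inv_cont.
apply: (@fatou_le _ _ _ g) => //.
- by apply: measurable_funM => //; exact: measurable_inv_cont.
- by move=> n t _; rewrite /g !mulr_ge0 // invr_ge0 exprn_ge0 // cmod_ge0.
- by move=> t _; rewrite !mulr_ge0 // invr_ge0 exprn_ge0 // cmod_ge0.
- apply: ae_imply (ae_expi_neq t0) => x H Tx; have {H}ne := H Tx.
  apply: cvgM; first exact: cvg_cst.
  apply: cvgV; first by rewrite expf_neq0 // cmod_eq0 subr_eq0.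
  have sto0 : s_ n @[n --> \oo] --> (0 : R).
    apply/cvgrPdist_lt => e e0; exists (Num.bound e^-1) => // n /= hn.
    rewrite sub0r normrN gtr0_norm // /s_ invf_plt ?posrE //.
    rewrite (lt_le_trans (archi_boundP _)) ?invr_ge0 ?(ltW e0) // ler_nat.
    exact: leqW (leqW hn).
  rewrite cmod_sqr ReB ImB; under eq_fun do rewrite cmod_sqr ReB ImB /zn ReMr ImMr.
  have c1 (a b : R) : (a - (1 - s_ n) * b) @[n --> \oo] --> a - b.
    have -> : a - b = a - (1 - 0) * b by rewrite subr0 mul1r.
    apply: cvgB; first exact: cvg_cst.
    by apply: cvgM; [apply: cvgB => //; exact: cvg_cst|exact: cvg_cst].
  by under eq_fun do rewrite !expr2; rewrite !expr2; apply: cvgD; apply: cvgM; exact: c1.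
have [del del0 Hdel] := W_radial eta0.
pose n0 := Num.bound (Num.min del eta)^-1.
have m0 : 0 < Num.min del eta by rewrite lt_min del0.
exists n0 => // n /= n0n.
have : s_ n < Num.min del eta.
  rewrite /s_ invf_plt ?posrE // (lt_le_trans (archi_boundP _)) ?invr_ge0 ?(ltW m0) // ler_nat.
  exact: leqW (leqW n0n).
rewrite lt_min => /andP[sdel seta].
have [iP EP] := poisson_integral_Re (zn1 n).
have sn0 := s_gt0 n; have sn1 := s_lt1 n.
have dp : 0 < 1 - cmod (zn n) ^+ 2 by rewrite czn expr2; nra.
have gE t : cmod (Ws t) <= 1 -> g n t =
    2 / (1 - cmod (zn n) ^+ 2) * ((1 - complex.Re (Ws t)) * poisson (zn n) t).
  move=> le1; rewrite /g ger0_norm; last first.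
    by rewrite subr_ge0 (le_trans _ le1) // (le_trans (ler_norm _)) // Re_le_cmod.
  rewrite /poisson; field.
  by rewrite (gt_eqF dp) cmod_eq0 unit_sub_neq0.
have -> : (\int[mu]_(t in T) (g n t)%:E)%E =
    (\int[mu]_(t in T) (2 / (1 - cmod (zn n) ^+ 2) * ((1 - complex.Re (Ws t)) * poisson (zn n) t))%:E)%E.
  have iQ := @integrableZE _ T _ (2 / (1 - cmod (zn n) ^+ 2)) (measurable_itv _) iP.
  apply: ae_eq_integral => //.
  - by apply/measurable_EFinP; exact: mg.
  - exact: (measurable_int mu iQ).
  - by apply: ae_imply boundary_le1 => t H Tt; rewrite gE // H.
have -> : (\int[mu]_(t in T) (2 / (1 - cmod (zn n) ^+ 2) * ((1 - complex.Re (Ws t)) * poisson (zn n) t))%:E)%E =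
    (2 / (1 - cmod (zn n) ^+ 2) * (2 * pi * (1 - complex.Re (W (zn n)))))%:E.
  rewrite -EP -RintegralZl // /Rintegral fineK //.
  by apply: integrable_fin_num => //; exact: integrableZE.
rewrite lee_fin.
apply: (@le_trans _ _ (2 / (1 - cmod (zn n) ^+ 2) * (2 * pi * ((l + eta) * s_ n)))).
  rewrite ler_wpM2l ?divr_ge0 ?(ltW dp) // ler_wpM2l ?two_pi_ge0 //; exact: Hdel.
have -> : 1 - cmod (zn n) ^+ 2 = s_ n * (2 - s_ n) by rewrite czn; ring.
have s2 : 0 < 2 - s_ n by lra.
have -> : 2 / (s_ n * (2 - s_ n)) * (2 * pi * ((l + eta) * s_ n)) = 2 * pi * (l + eta) * (2 / (2 - s_ n)).
  by field; rewrite !gt_eqF.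
rewrite ler_wpM2l ?mulr_ge0 ?pi_ge0 ?addr_ge0 ?(ltW eta0) //.
(* Since s_ n < eta <= 1, (1 + eta) (2 - s_ n) >= 2 + eta - eta^2 >= 2. *)
rewrite ler_pdivrMr //; nra.
Qed.

Lemma boundary_bound :
  (\int[mu]_(t in T) (2 * `|1 - complex.Re (Ws t)| * (cmod (expi t - t0) ^+ 2)^-1)%:E <=
    (2 * pi * l)%:E)%E.
Proof.
have ll := l0; have tp := two_pi_gt0 (R := R).
(* As eta <= 1, (l + eta) (1 + eta) <= l + eta (l + 2); the second entry makes the excess at most
   [e]. *)
apply/lee_addgt0Pr => e e0; pose eta := Num.min 1 (e / (2 * pi * (l + 2))).
have k0 : 0 < 2 * pi * (l + 2) by rewrite mulr_gt0 //; lra.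
have eta0 : 0 < eta by rewrite lt_min ltr01 divr_gt0.
have eta1 : eta <= 1 by rewrite ge_min lexx.
have etak : eta * (2 * pi * (l + 2)) <= e by rewrite -ler_pdivlMr // ge_min lexx orbT.
apply: (le_trans (bound_eta eta0 eta1)); rewrite -EFinD lee_fin.
apply: (le_trans _ (_ : 2 * pi * l + eta * (2 * pi * (l + 2)) <= _)); last by rewrite lerD2l.
have -> : 2 * pi * l + eta * (2 * pi * (l + 2)) = 2 * pi * (l + eta * (l + 2)) by ring.
rewrite -mulrA ler_wpM2l ?(ltW tp) //; nra.
Qed.

End BoundaryBound.

(** * Comparison of the deviations *)

Section DeviationComparison.
Context {R : realType}.
Local Notation C := R[i].
Local Notation mu := (@lebesgue_measure R).
Local Notation T := (`[0, 2 * pi]%classic : set R).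

(* As [e] and [t0] are unimodular, [W F H^*] equals [t0 e F H] plus
   [(1 - |W|^2) t0 e F / (e - t0)]; AM-GM absorbs the latter. *)
Lemma boundary_inequality (W F H e t0 : C) : cmod e = 1 -> cmod t0 = 1 -> e != t0 ->
  cmod W <= 1 -> H * (e - t0) = W - 1 ->
  cmod (W * F + H) ^+ 2 <= cmod F ^+ 2 + 2 * `|1 - complex.Re W| * (cmod (e - t0) ^+ 2)^-1 +
    2 * complex.Re (t0 * (e * F * H)).
Proof.
move=> e1 t1 ne W1 HE; set dl := e - t0 in HE *.
have dl0 : dl != 0 by rewrite subr_eq0.
have cd0 : 0 < cmod dl by rewrite cmod_gt0.
have e0 : e != 0 by rewrite -cmod_eq0 e1 oner_eq0.
have t0' : t0 != 0 by rewrite -cmod_eq0 t1 oner_eq0.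
have conj1 (u : C) : cmod u = 1 -> u != 0 -> conjc u = u^-1.
  by move=> u1 u0; apply: (mulfI u0); rewrite mulfV // mulcJ u1 expr1n.
have {}HE : H = (W - 1) / dl by rewrite -HE mulfK.
have W2 : 0 <= 1 - cmod W ^+ 2 by rewrite subr_ge0 exprn_ile1 ?cmod_ge0.
have cross : W * F * conjc H = t0 * (e * F * H) +
    (1 - cmod W ^+ 2)%:C%C * (t0 * e * F / dl).
  have -> : conjc H = (conjc W - 1) / (- dl / (e * t0)).
    rewrite HE conjcM conjc_inv !conjcB conjc1 (conj1 e) // (conj1 t0) //; congr (_ / _).
    by rewrite /dl; field; rewrite e0 t0'.
  have -> : (1 - cmod W ^+ 2)%:C%C = 1 - W * conjc W :> C by rewrite mulcJ rmorphB rmorph1.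
  by rewrite HE; move: (conjc W) => cW; field; rewrite dl0 e0 t0'.
have sq : cmod (W * F + H) ^+ 2 =
    cmod W ^+ 2 * cmod F ^+ 2 + cmod H ^+ 2 + 2 * complex.Re (W * F * conjc H).
  rewrite -exprMn -cmodM !cmod_sqr; move: (W * F) => [x y]; case: (H) => v z /=; ring.
rewrite sq cross ReD ReMr.
have H2 : cmod H ^+ 2 = (cmod W ^+ 2 - 2 * complex.Re W + 1) * (cmod dl ^+ 2)^-1.
  by rewrite HE cmodM cmodV exprMn exprVn; congr (_ * _); rewrite !cmod_sqr ReB ImB /=; ring.
have ReW : complex.Re W <= 1 by rewrite (le_trans (ler_norm _)) // (le_trans (Re_le_cmod _)).
rewrite H2 (ger0_norm (_ : 0 <= 1 - complex.Re W)) ?subr_ge0 //.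
have cs : 2 * complex.Re (t0 * e * F / dl) <= cmod F ^+ 2 + (cmod dl ^+ 2)^-1.
  apply: (@le_trans _ _ (2 * (cmod F * (cmod dl)^-1))).
    rewrite ler_wpM2l // (le_trans (ler_norm _)) // (le_trans (Re_le_cmod _)) //.
    by rewrite cmodM cmodM cmodM t1 e1 !mul1r cmodV.
  by rewrite -exprVn -subr_ge0 (_ : _ - _ = (cmod F - (cmod dl)^-1) ^+ 2) ?sqr_ge0 //; ring.
(* The two sides of the goal differ by exactly 1 - |W|^2 times the slack in [cs]. *)
have := ler_wpM2l W2 cs.
set a := cmod F ^+ 2; set b := (cmod dl ^+ 2)^-1; set c := cmod W ^+ 2.
set r := complex.Re W; set x := complex.Re _; set y := complex.Re _.
by move=> h; rewrite -subr_ge0; rewrite -subr_ge0 in h; apply: le_trans h _; rewrite le_eqVlt; apply/orP; left; apply/eqP; ring.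
Qed.

(** Off t0, k = f (z - t0) + 1 with f the difference quotient, so [bval k] is F (e - t0) + 1 a.e.
    The integrals are matched by two inequalities through [ae_le_integral], as the left integrand
    need not be measurable. *)
Lemma deviationE (t0 : C) (k : Cplx R -> Cplx R) (F : R -> C) : cmod t0 = 1 ->
  holomorphic (fun z => (k z - 1) / (z - t0)) ->
  radial_L2_limit (fun z => (k z - 1) / (z - t0)) F ->
  deviation t0 k = ((2 * pi)^-1 * n2 F)%:E.
Proof.
move=> t1 Hf lF; have LF := radial_L2_limit_L2 Hf lF.
have ae_eq : {ae mu, forall x, T x ->
    cmod (bval k (expi x) - 1) ^+ 2 / cmod (expi x - t0) ^+ 2 = cmod (F x) ^+ 2}.
  apply: ae_imply2 (nontangential_limit Hf lF) (ae_expi_neq t0) => x lim ne Tx.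
  have {}ne := ne Tx; have nz : expi x - t0 != 0 by rewrite subr_eq0.
  have -> : bval k (expi x) = F x * (expi x - t0) + 1.
    apply: bvalE; first exact: cmod_expi.
    apply: (@nt_cvg_ext _ (fun z => (k z - 1) / (z - t0) * (z + - t0) + 1)).
      by move=> z zD; rewrite divfK ?subrK // (disk_sub_neq0 t1).
    apply: nt_cvgD; last exact: nt_cvg_cst.
    apply: nt_cvgM; first exact: lim.
    by apply: nt_cvgD; [exact: nt_cvg_id|exact: nt_cvg_cst].
  by rewrite addrK cmodM exprMn mulfK // expf_neq0 // cmod_eq0.
rewrite /deviation /circ_int EFinM; congr (_ * _)%E; rewrite -n2_fin //.
by apply/eqP; rewrite eq_le; apply/andP; split; apply: ae_le_integral => [x _|x _|];
  rewrite ?lee_fin ?divr_ge0 ?exprn_ge0 ?cmod_ge0 //;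
  apply: ae_imply ae_eq => x H Tx; rewrite lee_fin H.
Qed.

Lemma deviation_ge0 (t0 : C) (k : Cplx R -> Cplx R) : (0 <= deviation t0 k)%E.
Proof.
rewrite /deviation /circ_int mule_ge0 //; first by rewrite lee_fin invr_ge0 two_pi_ge0.
by apply: integral_ge0 => x _; rewrite lee_fin divr_ge0 ?exprn_ge0 ?cmod_ge0.
Qed.

Lemma ae_Rintegral_ge0 (psi : R -> R) : mu.-integrable T (fun t => (psi t)%:E) ->
  {ae mu, forall t, T t -> 0 <= psi t} -> 0 <= \int[mu]_(t in T) psi t.
Proof.
move=> ip H; have -> : \int[mu]_(t in T) psi t = \int[mu]_(t in T) `|psi t|.
  rewrite /Rintegral; congr fine; apply: ae_eq_integral => //.
  - exact: (measurable_int mu ip).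
  - exact: (measurable_int mu (integrable_norm ip)).
  - by apply: ae_imply H => t h Tt; rewrite ger0_norm // h.
by apply: Rintegral_ge0.
Qed.


Lemma contractive_perturbation_le (W f h : Cplx R -> Cplx R) (t0 : C) (l : R) (Ws F H F2 : R -> C) :
  cmod t0 = 1 -> holomorphic W -> (forall z, disk z -> cmod (W z) <= 1) -> 0 <= l ->
  (forall e, 0 < e -> exists2 del, 0 < del & forall s, 0 < s -> s < del ->
    1 - complex.Re (W ((1 - s)%:C%C * t0)) <= (l + e) * s) ->
  holomorphic f -> holomorphic h -> (forall z, disk z -> h z * (z - t0) = W z - 1) ->
  radial_L2_limit W Ws -> radial_L2_limit f F -> radial_L2_limit h H ->
  radial_L2_limit (fun z => W z * f z + h z) F2 ->
  n2 F2 <= n2 F + 2 * pi * l.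
Proof.
have mT : measurable T by exact: measurable_itv.
move=> t01 HW W1 l0 Wr Hf Hh hW lW lF lH lF2.
have Hf2 : holomorphic (fun z => W z * f z + h z).
  move=> z zD; exact: (derivableD (derivableM (HW z zD) (Hf z zD)) (Hh z zD)).
have LW := radial_L2_limit_L2 HW lW; have LF := radial_L2_limit_L2 Hf lF.
have LH := radial_L2_limit_L2 Hh lH; have LF2 := radial_L2_limit_L2 Hf2 lF2.
pose q t := 2 * `|1 - complex.Re (Ws t)| * (cmod (expi t - t0) ^+ 2)^-1.
have bq := boundary_bound t01 HW W1 l0 Wr lW; rewrite -/q in bq.
have iq : mu.-integrable T (fun t => (q t)%:E).
  apply: ge0_integrable.
  - apply: measurable_funM.
      apply: measurable_funM; first exact: measurable_cst.
      apply: measurableT_comp; first exact: normr_measurable.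
      by apply: measurable_funB; [exact: measurable_cst|exact: LW.1.1].
    apply: measurable_inv_cont => //.
    exact: (ccont_sqr (ccontB (@ccont_expi R) (ccont_cst t0))).
  - by move=> t; rewrite !mulr_ge0 ?invr_ge0 ?exprn_ge0 ?cmod_ge0.
  - exact: le_lt_trans bq (ltry _).
have rq : \int[mu]_(t in T) q t <= 2 * pi * l.
  rewrite -lee_fin; apply: le_trans bq; rewrite /Rintegral fineK //.
  exact: integrable_fin_num.
have LeF : L2 (fun t => expi t * F t).
  apply: (@L2M_bounded _ _ _ 1) => //; first by apply: ccont_cmeas => //; exact: ccont_expi.
  by move=> t; exact: cmod_expi_le1.
have ieFH : cintble T (fun t => expi t * F t * H t) := L2_cintbleM LeF LH.
have it := cintbleZ t0 mT ieFH.
have rt : \int[mu]_(t in T) complex.Re (t0 * (expi t * F t * H t)) = 0.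
  have := congr1 (@complex.Re R) (cintZ t0 mT ieFH).
  by rewrite (cint_product_zero Hf Hh lF lH) mulr0.
have pos : {ae mu, forall t, T t -> 0 <= cmod (F t) ^+ 2 + q t +
    2 * complex.Re (t0 * (expi t * F t * H t)) - cmod (F2 t) ^+ 2}.
  (* The L2 limits were chosen independently; the pointwise relations between them follow a.e. from
     uniqueness of nontangential limits. *)
  have aeWs := ae_imply2 (fun x P Q => conj P Q) (nontangential_limit HW lW) (boundary_le1 HW W1 lW).
  have aeh := ae_imply2 (fun x P Q => conj P Q) (nontangential_limit Hh lH) (ae_expi_neq t0).
  have aef := ae_imply2 (fun x P Q => conj P Q) (nontangential_limit Hf lF) (nontangential_limit Hf2 lF2).
  apply: ae_imply2 aef (ae_imply2 (fun x P Q => conj P Q) aeWs aeh) => t [cf cf2] [[cW W1t] [ch ne]] Tt.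
  have {}cf := cf Tt; have {}cf2 := cf2 Tt; have {}cW := cW Tt; have {}ch := ch Tt.
  have e1 := cmod_expi t.
  have HE : H t * (expi t - t0) = Ws t - 1.
    apply: (nt_cvg_unique e1 (f := fun z => h z * (z + - t0))).
      apply: nt_cvgM; first exact: ch.
      by apply: nt_cvgD; [exact: nt_cvg_id|exact: nt_cvg_cst].
    apply: (@nt_cvg_ext _ (fun z => W z + - 1)); first by move=> z zD; rewrite hW.
    by apply: nt_cvgD; [exact: cW|exact: nt_cvg_cst].
  have -> : F2 t = Ws t * F t + H t.
    apply: (nt_cvg_unique e1 cf2); apply: nt_cvgD; last exact: ch.
    by apply: nt_cvgM; [exact: cW|exact: cf].
  have := boundary_inequality (F t) e1 t01 (ne Tt) (W1t Tt) HE.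
  by rewrite -subr_ge0.
have i1 := L2_integrable LF; have i2 := L2_integrable LF2.
have i3 := integrableZE 2 mT it.1.
have i4 : mu.-integrable T (fun t => (cmod (F t) ^+ 2 + q t)%:E).
  exact: (@integrableD _ _ _ mu T mT _ _ i1 iq).
have i5 : mu.-integrable T (fun t => (cmod (F t) ^+ 2 + q t + 2 * complex.Re (t0 * (expi t * F t * H t)))%:E).
  exact: (@integrableD _ _ _ mu T mT _ _ i4 i3).
have i6 : mu.-integrable T (fun t => (cmod (F t) ^+ 2 + q t + 2 * complex.Re (t0 * (expi t * F t * H t)) - cmod (F2 t) ^+ 2)%:E).
  exact: (@integrableB _ _ _ mu T mT _ _ i5 i2).
have rz : \int[mu]_(t in T) (2 * complex.Re (t0 * (expi t * F t * H t))) = 0.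
  by rewrite RintegralZl ?rt ?mulr0 //; exact: it.1.
have := ae_Rintegral_ge0 i6 pos.
rewrite RintegralB // RintegralD // RintegralD //.
rewrite rz addr0.
by rewrite subr_ge0 => /le_trans; apply; rewrite lerD2l.
Qed.

End DeviationComparison.

Theorem theorem6p1 (R : realType) (G : set (Cplx R -> Cplx R)) (t0 : Cplx R)
  (Delta phi : Cplx R -> Cplx R)
  (beta : (Cplx R -> Cplx R) -> Cplx R) (w : Cplx R -> Cplx R)
  (w0 w0' : Cplx R) :
  fuchsian G ->
  cmod t0 = 1 ->
  (\esum_(g in G) (cmod (derive1 g t0))%:E < +oo)%E ->
  bounded_characteristic (derive1 (martin G t0)) ->
  inner_outer_factorization (derive1 (martin G t0)) Delta phi ->
  assumption_A1 Delta t0 ->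
  assumption_A2 G t0 ->
  unitary_character G beta ->
  automorphic G beta w ->
  (forall z, disk z -> cmod (w z) <= 1) ->
  nt_cvg w t0 w0 ->
  cmod w0 = 1 ->
  nt_cvg (derive1 w : Cplx R -> Cplx R) t0 w0' ->
  forall (alpha : (Cplx R -> Cplx R) -> Cplx R) (k kbeta : Cplx R -> Cplx R),
  unitary_character G alpha ->
  extremal G t0 alpha k ->
  extremal G t0 (fun g => alpha g * beta g) kbeta ->
  (((fine (deviation t0 kbeta) - fine (deviation t0 k))%:C)%C : R[i])
    <= t0 * (w0' / w0).
Proof.
move=> _ t01 _ _ _ _ _ _ [Hw Aw] w1 lw w01 ldw alpha k kbeta _ [[[Hk Ak] hk] _] [_ minb].
pose W := unimodular_normalization w w0; pose h := difference_quotient w t0 w0.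
pose f (z : Cplx R) : Cplx R := (k z - 1) / (z - t0).
pose f2 (z : Cplx R) : Cplx R := (W z * k z - 1) / (z - t0).
have HW : holomorphic W := normalization_holomorphic Hw.
have W1 z : disk z -> cmod (W z) <= 1 := normalization_le1 w1 w01 (z := z).
have hh : hardy2 h := difference_quotient_hardy2 t01 Hw w1 lw w01 ldw.
have ef2 : f2 = (fun z => W z * f z + h z).
  by apply/funext => z; rewrite /f2 /f /h /difference_quotient -/W; ring.
have hf2 : hardy2 f2 by rewrite ef2; apply: hardy2D hh; exact: hardy2M_bounded.
have [F lF] := hardy2_radial_limit hk; have [H lH] := hardy2_radial_limit hh.
have [Ws lW] := hardy2_radial_limit (bounded_hardy2 HW W1).
have [F2 lF2] := hardy2_radial_limit hf2.
have adm : admissible G t0 (fun g => alpha g * beta g) (fun z => W z * k z).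
  split; last exact: hf2.
  split=> [z zD|g z Gg zD]; first exact: (derivableM (HW z zD) (Hk z zD)).
  by rewrite /W /unimodular_normalization (Aw _ _ Gg zD) (Ak _ _ Gg zD); ring.
have key := minb _ adm.
rewrite (deviationE t01 hf2.1 lF2) in key.
have L0 := julia_nonneg t01 Hw w1 lw w01 ldw; have LI := julia_real t01 Hw w1 lw w01 ldw.
have le2 : n2 F2 <= n2 F + 2 * pi * complex.Re (t0 * (w0' / w0)).
  apply: (contractive_perturbation_le t01 HW W1 L0 _ hk.1 hh.1 _ lW lF lH).
  - by move=> e e0; exact: (julia_radial t01 Hw lw w01 ldw e0).
  - by move=> z zD; rewrite /h /difference_quotient divfK // disk_sub_neq0.
  - by rewrite -ef2.
have dk := deviationE t01 hk.1 lF.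
have d0 := deviation_ge0 t0 kbeta.
(* Comparison with the competitor W k makes the deviation finite, so [fine] does not hide an
   infinite value. *)
have fin : deviation t0 kbeta \is a fin_num by rewrite ge0_fin_numE // (le_lt_trans key) // ltry.
rewrite -(fineK fin) lee_fin in key.
(* The order of R[i] asks for equal imaginary parts, supplied by [julia_real], besides the
   inequality of real parts. *)
rewrite dk /= lecE /= LI eqxx /=.
apply: le_trans (_ : (2 * pi)^-1 * n2 F2 - (2 * pi)^-1 * n2 F <= _); first by rewrite lerB.
have p0 := two_pi_gt0 (R := R).
by rewrite -mulrBr ler_pdivrMl // lerBlDl.
Qed.
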